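(* Let $\epsilon\in(0,1/2)$ and let $(m_i)$, $(r_i)$ be sequences of positive integers with $\lim_{i\to\infty}m_i=\infty$ and $\limsup_{i\to\infty}\binom{m_i}{\le r_i}2^{-m_i}<1-H(\epsilon)$. There exist $c,c',c''>0$ such that, if $f$ is drawn uniformly from $RM(m_i,r_i)$ and $\tilde f$ is obtained from $f$ by flipping each coordinate independently with probability $\epsilon$, then as $i\to\infty$ the algorithm $\mathrm{RMRec2}(m_i,r_i,\epsilon,\tilde f,c,c')$ returns $f$ with probability $1-O(2^{-2^{c''\sqrt{m_i}}})$.
   Context: $H$ is the binary entropy function and $\binom{m}{\le r}=\sum_{j=0}^r\binom mj$. $RM(m,r)$ is the set of evaluation vectors $(f(x))_{x\in\mathbb{F}_2^m}$ of polynomials over $\mathbb{F}_2$ in $m$ variables of degree at most $r$. Algorithm $\mathrm{RMRec}(M,r,\epsilon,g,c')$ for $g\in\{0,1\}^{\mathbb{F}_2^M}$: (1) for each $x$ let $\hat g(x)$ be the most likely value of the codeword bit at $x$ given all of $g$, assuming a uniform codeword of $RM(M,r)$ sent through a channel flipping each bit independently with probability $\epsilon$ (uniformly random if tied); (2) let $\ell$ be the list of all elements of $RM(M,r)$ disagreeing with $\hat g$ on at most $2^{M-c'\sqrt M\log_2(M)/2}/2$ coordinates; (3) return the element of $\ell$ agreeing with $g$ on the most coordinates (ties uniformly at random). Algorithm $\mathrm{RMRec2}(m,r,\epsilon,\tilde f,c,c')$: (1) let $m'=\lceil\sqrt m/c\rceil$; (2) partition the coordinate indices $\{1,\dots,m\}$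 of $\mathbb{F}_2^m$ into sets $S_1,\dots,S_{m'}$ with sizes as close to equal as possible; (3) for each $1\le j\le m'$ and $x\in\{0,1\}^{S_j}$, let $\tilde f_{S_j,x}$ be the restriction of $\tilde f$ to the points whose coordinates indexed by $S_j$ equal $x$ (viewed as a word indexed by $\mathbb{F}_2^{m-|S_j|}$; the corresponding restriction of $f$ lies in $RM(m-|S_j|,r)$), and set $f^{(j,x)}=\mathrm{RMRec}(m-|S_j|,r,\epsilon,\tilde f_{S_j,x},c')$; (4) for each $y\in\mathbb{F}_2^m$ set $\hat f(y)$ to the most common value of $f^{(j,y_{S_j})}(y)$ over $1\le j\le m'$, where $y_{S_j}$ is the substring of $y$ indexed by $S_j$; (5) let $\ell$ be the list of all elements of $RM(m,r)$ disagreeing with $\hat f$ on at most $2^{m-\sqrt m\log_2(m)}/2$ coordinates; (6) return the element of $\ell$ agreeing with $\tilde f$ on the largest number of coordinates. *)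

(* Defs.v *)
From HB Require Import structures.
From mathcomp Require Import all_boot all_order all_algebra.
From mathcomp Require Import all_classical all_reals all_analysis.
Set Implicit Arguments. Unset Strict Implicit. Unset Printing Implicit Defensive.
Import Order.TTheory GRing.Theory Num.Theory.
Local Open Scope ring_scope.

Section RM.
Variable R : realType.

Definition pt (M : nat) := {ffun 'I_M -> bool}.
Definition word (M : nat) := {ffun pt M -> bool}.

(* a monomial prod_i x_i^(e_i), exponents e_i <= r, evaluated at x (over F_2) *)
Definition deg (M r : nat) (e : {ffun 'I_M -> 'I_r.+1}) : nat := (\sum_i (e i : nat))%N.
Definition monom_eval (M r : nat) (e : {ffun 'I_M -> 'I_r.+1}) (x : pt M) : bool :=
  \big[andb/true]_i (((e i : nat) == 0%N) || x i).
(* a polynomial = set of monomials with coefficient 1 (coefficients in F_2) *)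
Definition poly_eval (M r : nat) (a : {ffun {ffun 'I_M -> 'I_r.+1} -> bool}) (x : pt M) : bool :=
  \big[addb/false]_(e | a e) monom_eval e x.
Definition RM (M r : nat) : {set word M} :=
  [set w : word M | [exists a : {ffun {ffun 'I_M -> 'I_r.+1} -> bool},
      [forall e, a e ==> (deg e <= r)%N] && (w == [ffun x => poly_eval a x])]].

Definition dH (M : nat) (w1 w2 : word M) : nat := #|[set x | w1 x != w2 x]|.
Definition agree (M : nat) (w1 w2 : word M) : nat := #|[set x | w1 x == w2 x]|.
Definition zero_word (M : nat) : word M := [ffun => false].

Definition log2 (x : R) : R := ln x / ln 2.
Definition H (e : R) : R := - e * log2 e - (1 - e) * log2 (1 - e).
Definition binom_le (m r : nat) : nat := (\sum_(j < r.+1) 'C(m, j))%N.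

Definition chan (M : nat) (eps : R) (f g : word M) : R :=
  \prod_x (if g x == f x then 1 - eps else eps).

(* probability that a value with score a is chosen against an alternative
   with score b, when the larger score wins and ties are broken uniformly *)
Definition choiceP (a b : R) : R :=
  if b < a then 1 else if a == b then 1 / 2 else 0.

Definition argmax_unif (M : nat) (l : {set word M}) (g out : word M) : R :=
  let A := [set c in l | [forall c' in l, (agree c' g <= agree c g)%N]] in
  if out \in A then 1 / (#|A|%:R) else 0.

(* Pr[ RMRec(M,r,eps,g,c') = out ].  Randomness: tie-breaks in steps (1), (3).
   Convention (unspecified in the paper): if the list in step (2) is empty,
   RMRec outputs the zero word. *)
Definition RMRec_prob (M r : nat) (eps : R) (g : word M) (c' : R) (out : word M) : R :=
  let L := fun (b : bool) (x : pt M) => \sum_(c in RM M r | c x == b) chan eps c g in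
  let T := 2 `^ (M%:R - c' * Num.sqrt (M%:R) * log2 (M%:R) / 2) / 2 in
  \sum_(h : word M)
    (\prod_x choiceP (L (h x) x) (L (~~ h x) x)) *
    (let l := [set c in RM M r | (dH c h)%:R <= T] in
     if #|l| == 0%N then (out == zero_word M)%:R else argmax_unif l g out).

Definition mprime (m : nat) (c : R) : nat := `|Num.ceil (Num.sqrt (m%:R) / c)|%N.
Definition Spart (m mp : nat) (j : 'I_mp) : {set 'I_m} := [set i : 'I_m | (i %% mp == j)%N].
(* the point of the subcube {y | y_S = x_S} with free coordinates z
   (free coordinates ~: S identified with 'I_#|~:S| in increasing order) *)
Definition embed (m : nat) (S : {set 'I_m}) (x : pt m) (z : pt #|~: S|) : pt m :=
  [ffun i => if [pick j0 : 'I_#|~: S| | enum_val j0 == i] is Some j0 then z j0 else x i].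
(* canonical representative of x_S : coordinates outside S set to 0 *)
Definition rep (m : nat) (S : {set 'I_m}) (y : pt m) : pt m := [ffun i => (i \in S) && y i].
Definition reps (m : nat) (S : {set 'I_m}) : {set pt m} := [set x | rep S x == x].
Definition restrict (m : nat) (S : {set 'I_m}) (g : word m) (x : pt m) : word #|~: S| :=
  [ffun z => g (@embed _ S x z)].

(* Pr[ RMRec2(m,r,eps,ft,c,c') = Some out ] (None = empty list in step (5)).
   W j is the word on F_2^m collecting the outputs f^(j,x) on all subcubes. *)
Definition RMRec2_prob (m r : nat) (eps : R) (ft : word m) (c c' : R) (out : word m) : R :=
  let mp := mprime m c in
  let S := @Spart m mp in
  let PW := fun (j : 'I_mp) (W : word m) =>
    \prod_(x in reps (S j))
       RMRec_prob r eps (restrict (S j) ft x) c' [ffun z => W (@embed _ (S j) x z)] in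
  \sum_(W : {ffun 'I_mp -> word m})
    (\prod_j PW j (W j)) *
    \sum_(fh : word m)
      (\prod_y choiceP (#|[set j | W j y == fh y]|%:R) (#|[set j | W j y != fh y]|%:R)) *
      (let l := [set c0 in RM m r |
                  (dH c0 fh)%:R <= 2 `^ (m%:R - Num.sqrt (m%:R) * log2 (m%:R)) / 2] in
       argmax_unif l ft out).

Definition success_prob (m r : nat) (eps c c' : R) : R :=
  \sum_(f in RM m r) (1 / (#|RM m r|%:R)) *
    \sum_(ft : word m) chan eps f ft * RMRec2_prob r eps ft c c' f.

End RM.

(* Main.v *)
(* The likelihood that a single bit of a codeword is 1 given the other received bits is, by entropy
   tensorization, positively correlated with that bit as soon as the rate is below 1 - H(eps)
   ([weak_predictor]). Put F_2^n into F_2^(n+k), k ~ sqrt n, as the graph of a linear map Q: every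
   graph carries a weak predictor of the bit at the origin, and since the density of the code
   moves by at most k / sqrt n, one may average these predictors over Q. In the Fourier expansion
   of the average a character of size |A| survives with probability at most (|A| + 1)^-k, and
   hypercontractivity controls the moments of the characters of small size. So the bit error is
   expR (- Omega (sqrt M * ln M)), and a list decoding radius of the same order is harmless,
   because low-weight codewords are few: a codeword of weight at most 2^(M-k-4) is the majority of
   M + 1 of its k-fold derivatives, each of which is constant along k directions. Finally the
   blocks S_j are disjoint, so for a uniform point y the subcubes through y fail independently
   once the average number of failures in each direction has concentrated, which
   makes the majority vote wrong on a tiny fraction of the points except with probability
   doubly exponentially small in sqrt m. *)
Require Import Defs.
From HB Require Import structures.
From mathcomp Require Import all_boot all_order all_algebra.
From mathcomp Require Import all_classical all_reals all_analysis.
From mathcomp Require Import ring lra zify.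
Set Implicit Arguments. Unset Strict Implicit. Unset Printing Implicit Defensive.
Import Order.TTheory GRing.Theory Num.Theory.
Local Open Scope ring_scope.

(** * Product measures on the cube *)

(** Optimality enters only through the bitwise likelihood rule: to bound its error it suffices to
    exhibit some predictor of the bit at the origin whose sign follows the codeword, because the
    likelihood rule errs least on average over codewords and linearity makes its error the same for
    all of them. The weak predictor has a mean bounded below by a constant but uncontrolled
    fluctuations; averaging over graphs keeps the mean and damps every nonconstant character. Graphs
    serve better than arbitrary subspaces because a point of a graph returns its base point, so
    distinct characters never merge. The room for averaging is limited by the size 2^n / sqrt n of
    the largest binomial coefficients: k extra dimensions cost k / sqrt n of rate, hence k of order
    sqrt M. Characters whose size is a power of M then put the factor ln M into the exponent. This
    factor is what list decoding needs: with c' equal to the exponent of the bit error, Markov's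
    inequality still leaves expR (- Omega (sqrt M * ln M)), which is below expR (- B * sqrt M) for
    every B, so c' need not depend on c. *)

Section BernoulliExpectation.
Variables (R : realType) (w : bool -> R).

Definition wt_prod (X : finType) (z : {ffun X -> bool}) : R := \prod_x w (z x).
Definition expec (X : finType) (F : {ffun X -> bool} -> R) : R :=
  \sum_z wt_prod z * F z.

Definition depends_on (X : finType) (T : Type) (B : {pred X})
    (F : {ffun X -> bool} -> T) : Prop :=
  forall z z' : {ffun X -> bool}, {in B, z =1 z'} -> F z = F z'.

Definition mix (X : finType) (B : {pred X}) (z z' : {ffun X -> bool}) :=
  [ffun x => if x \in B then z x else z' x].

Hypothesis w1 : w true + w false = 1.

Lemma expec_prod (X : finType) (A : {pred X}) (phi : X -> bool -> R) :
  expec (fun z : {ffun X -> bool} => \prod_(x in A) phi x (z x)) =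
  \prod_(x in A) (w true * phi x true + w false * phi x false).
Proof.
rewrite /expec /wt_prod.
transitivity (\sum_(z : {ffun X -> bool})
    \prod_x (w (z x) * (if x \in A then phi x (z x) else 1))).
  by apply: eq_bigr => z _; rewrite (big_mkcond (fun x => x \in A)) -big_split.
rewrite -(bigA_distr_bigA (fun x b => w b * (if x \in A then phi x b else 1))) /=.
rewrite [RHS]big_mkcond; apply: eq_bigr => x _.
by rewrite big_bool /=; case: ifP => // _; rewrite !mulr1.
Qed.

Lemma expec_cst (X : finType) (c : R) :
  expec (fun _ : {ffun X -> bool} => c) = c.
Proof.
rewrite /expec -big_distrl /= -[RHS]mul1r; congr (_ * _).
have := expec_prod (fun x : X => false) (fun _ _ => 1).
rewrite [X in _ = X]big_pred0 // => <-; apply: eq_bigr => z _.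
by rewrite big_pred0 // mulr1.
Qed.

Lemma expecD (X : finType) (F G : {ffun X -> bool} -> R) :
  expec (fun z => F z + G z) = expec F + expec G.
Proof. by rewrite -big_split; apply: eq_bigr => z _; rewrite mulrDr. Qed.

Lemma expecZ (X : finType) (c : R) (F : {ffun X -> bool} -> R) :
  expec (fun z => c * F z) = c * expec F.
Proof. by rewrite big_distrr; apply: eq_bigr => z _ /=; rewrite mulrCA. Qed.

Lemma expec_sum (X : finType) (I : Type) (s : seq I) (P : pred I)
    (F : I -> {ffun X -> bool} -> R) :
  expec (fun z => \sum_(i <- s | P i) F i z) = \sum_(i <- s | P i) expec (F i).
Proof.
rewrite /expec exchange_big /=; apply: eq_bigr => z _.
by rewrite big_distrr.
Qed.

Lemma eq_expec (X : finType) (F G : {ffun X -> bool} -> R) :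
  F =1 G -> expec F = expec G.
Proof. by move=> FG; apply: eq_bigr => z _; rewrite FG. Qed.

(** Take two independent copies [z] and [z'] and exchange their coordinates outside [B]: the joint
    weight is preserved, while [G z] becomes [G z']. *)
Lemma expec_indep (X : finType) (B : {pred X}) (F G : {ffun X -> bool} -> R) :
  depends_on B F -> depends_on [predC B] G ->
  expec (fun z => F z * G z) = expec F * expec G.
Proof.
move=> dF dG.
rewrite -[LHS]mulr1 -[X in _ * X](expec_cst X 1) /expec.
rewrite !big_distrlr /= !pair_big /=.
pose h (p : {ffun X -> bool} * {ffun X -> bool}) := (mix B p.1 p.2, mix B p.2 p.1).
have hK : involutive h.
  by move=> [z z']; rewrite /h /=; congr (_, _); apply/ffunP => x; rewrite !ffunE;
     case: (x \in B).
rewrite (reindex_inj (inv_inj hK)) /=; apply: eq_bigr => -[z z'] _ /=.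
rewrite (dF (mix B z z') z); last by move=> x xB; rewrite ffunE xB.
rewrite (dG (mix B z z') z'); last first.
  by move=> x; rewrite inE /= ffunE => /negbTE ->.
have E : wt_prod (mix B z z') * wt_prod (mix B z' z) = wt_prod z * wt_prod z'.
  rewrite /wt_prod -!big_split; apply: eq_bigr => x _ /=; rewrite !ffunE.
  by case: ifP => // _; rewrite mulrC.
by rewrite mulr1 mulrAC E; ring.
Qed.

Lemma expec_indep_seq (X : finType) (J : eqType) (s : seq J) (B : J -> {set X})
    (F : J -> {ffun X -> bool} -> R) :
  uniq s -> {in s &, forall i j, i != j -> [disjoint B i & B j]} ->
  {in s, forall j, depends_on (mem (B j)) (F j)} ->
  expec (fun z => \prod_(j <- s) F j z) = \prod_(j <- s) expec (F j).
Proof.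
elim: s => [_ _ _|j s IH /= /andP[js us] dis dep].
  by rewrite big_nil; rewrite -[RHS](expec_cst X); apply: eq_expec => z; rewrite big_nil.
rewrite big_cons -IH //; first last.
- by move=> i si; apply: dep; rewrite inE si orbT.
- by move=> a b sa sb; apply: dis; rewrite inE ?sa ?sb orbT.
rewrite -(expec_indep (B := mem (B j))).
- by apply: eq_expec => z; rewrite big_cons.
- by apply: dep; rewrite inE eqxx.
move=> z z' zz'; rewrite !big_seq; apply: eq_bigr => i si.
apply: (dep i); first by rewrite inE si orbT.
move=> x xB; apply: zz'; rewrite !inE; apply/negP => xBj.
have ij : i != j by apply: contraNneq js => <-.
have dij : [disjoint B i & B j] by apply: dis; rewrite ?inE ?eqxx ?si ?orbT.
by rewrite (disjointFr dij xB) in xBj.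
Qed.

Lemma expec_indep_family (X J : finType) (A : {pred J}) (B : J -> {set X})
    (F : J -> {ffun X -> bool} -> R) :
  {in A &, forall i j, i != j -> [disjoint B i & B j]} ->
  {in A, forall j, depends_on (mem (B j)) (F j)} ->
  expec (fun z => \prod_(j in A) F j z) = \prod_(j in A) expec (F j).
Proof.
move=> dis dep; rewrite -big_enum /= -(expec_indep_seq (B := B)).
- by apply: eq_expec => z; rewrite big_enum.
- exact: enum_uniq.
- by move=> i j; rewrite !mem_enum; apply: dis.
- by move=> i; rewrite mem_enum; apply: dep.
Qed.

(** Writing [F] as a combination of point masses reduces the claim to [expec_prod] on the
    coordinates in the image of [h]. *)
Lemma expec_comp_inj (X Y : finType) (h : X -> Y) (F : {ffun X -> bool} -> R) :
  injective h ->
  expec (fun z : {ffun Y -> bool} => F [ffun x => z (h x)]) = expec F.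
Proof.
move=> hI.
have E (z : {ffun Y -> bool}) : F [ffun x => z (h x)] =
    \sum_u F u * \prod_x (z (h x) == u x)%:R.
  rewrite (bigD1 [ffun x => z (h x)]) //= [X in _ + X]big1 => [|u uz].
    by rewrite addr0 big1 ?mulr1 // => x _; rewrite ffunE eqxx.
  apply/eqP; rewrite mulf_eq0; apply/orP; right.
  rewrite prodf_seq_eq0; apply/hasP.
  have [x hx] : exists x, z (h x) != u x.
    apply/existsP; rewrite -negb_forall; apply: contra uz => /forallP H.
    by apply/eqP/ffunP => x; rewrite ffunE (eqP (H x)).
  by exists x; [exact: mem_index_enum|rewrite /= (negbTE hx)].
rewrite (eq_expec E) expec_sum; apply: eq_bigr => u _.
rewrite expecZ mulrC; congr (_ * _).
pose phi (y : Y) (b : bool) : R := \prod_(x | h x == y) (b == u x)%:R.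
have -> : expec (fun z : {ffun Y -> bool} => \prod_x (z (h x) == u x)%:R) =
   expec (fun z : {ffun Y -> bool} => \prod_(y in h @: predT) phi y (z y)).
  apply: eq_expec => z; rewrite big_imset /=; last by move=> a b _ _; apply: hI.
  rewrite [RHS]big_mkcond; apply: eq_bigr => x _; rewrite /phi /=.
  by rewrite (big_pred1 x) // => x'; rewrite /= (inj_eq hI).
rewrite expec_prod big_imset /=; last by move=> a b _ _; apply: hI.
rewrite [LHS]big_mkcond /wt_prod; apply: eq_bigr => x _; rewrite /phi /=.
rewrite !(big_pred1 x); try by move=> x'; rewrite /= (inj_eq hI).
by case: (u x); rewrite /= !mulr1 mulr0 ?addr0 ?add0r.
Qed.

Lemma expec_perm (X : finType) (h : X -> X) (F : {ffun X -> bool} -> R) :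
  injective h -> expec (fun z => F [ffun x => z (h x)]) = expec F.
Proof. exact: expec_comp_inj. Qed.

Hypothesis w0 : forall b, 0 < w b.

Lemma wt_prod_gt0 (X : finType) (z : {ffun X -> bool}) : 0 < wt_prod z.
Proof. by apply: prodr_gt0. Qed.

Lemma ler_expec (X : finType) (F G : {ffun X -> bool} -> R) :
  (forall z, F z <= G z) -> expec F <= expec G.
Proof.
by move=> FG; apply: ler_sum => z _; apply: ler_wpM2l; rewrite ?FG // ltW ?wt_prod_gt0.
Qed.

Lemma expec_ge0 (X : finType) (F : {ffun X -> bool} -> R) :
  (forall z, 0 <= F z) -> 0 <= expec F.
Proof. by move=> F0; rewrite -(expec_cst X 0); apply: ler_expec. Qed.

Lemma expec_eq0 (X : finType) (F : {ffun X -> bool} -> R) :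
  (forall z, 0 <= F z) -> expec F <= 0 -> forall z, F z = 0.
Proof.
move=> F0 E0 z; have /eqP : expec F = 0 by apply/eqP; rewrite eq_le E0 expec_ge0.
rewrite psumr_eq0; last by move=> u _; rewrite mulr_ge0 // ltW ?wt_prod_gt0.
move=> /allP/(_ z (mem_index_enum _)) /=.
by rewrite mulf_eq0 gt_eqF ?wt_prod_gt0 //= => /eqP.
Qed.

End BernoulliExpectation.


(** * Reed-Muller codes *)

Definition addpt (T : finType) (x y : {ffun T -> bool}) : {ffun T -> bool} :=
  [ffun i => x i (+) y i].

Lemma addptA (T : finType) : associative (@addpt T).
Proof. by move=> x y z; apply/ffunP => i; rewrite !ffunE addbA. Qed.

Lemma addptC (T : finType) : commutative (@addpt T).
Proof. by move=> x y; apply/ffunP => i; rewrite !ffunE addbC. Qed.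

Lemma addptK (T : finType) (y : {ffun T -> bool}) : involutive (fun x => addpt x y).
Proof. by move=> x; apply/ffunP => i; rewrite !ffunE -addbA addbb addbF. Qed.

Lemma addptKl (T : finType) (y : {ffun T -> bool}) : involutive (fun x => addpt y x).
Proof. by move=> x; rewrite addptC (addptC y) addptK. Qed.

Definition monomial (M : nat) (A : {set 'I_M}) (x : pt M) : bool :=
  [forall i in A, x i].
Definition anf (M : nat) (a : {set {set 'I_M}}) : word M :=
  [ffun x => \big[addb/false]_(A in a) monomial A x].
Definition low_degree (M d : nat) : {set {set 'I_M}} := [set A : {set 'I_M} | (#|A| < d)%N].
(** The degree bound is strict, so that [code M 0] is the zero code and the truncated [d - k] is the
    right parameter after [k] derivatives even when [k > d]. [RM_code] records the resulting shift
    by one. *)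
Definition code (M d : nat) : {set word M} := [set anf a | a in powerset (low_degree M d)].

Definition partial_sum (n d : nat) : nat := (\sum_(j < d) 'C(n, j))%N.

Lemma card_low_degree (M d : nat) : #|low_degree M d| = partial_sum M d.
Proof.
rewrite /partial_sum; elim: d => [|d IH].
  by rewrite big_ord0; apply: eq_card0 => A; rewrite inE.
have E : 'C(M, d) = #|[set A : {set 'I_M} | #|A| == d]| by rewrite card_draws card_ord.
rewrite big_ord_recr /= -IH E -cardsUI [X in (_ + X)%N]eq_card0 ?addn0.
  by apply: eq_card => A; rewrite !inE ltnS leq_eqVlt orbC.
by move=> A; rewrite !inE; apply/negP => /andP[] /[swap] /eqP ->; rewrite ltnn.
Qed.

Lemma card_code (M d : nat) : (#|code M d| <= 2 ^ partial_sum M d)%N.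
Proof.
by rewrite (leq_trans (leq_imset_card _ _)) // card_powerset card_low_degree.
Qed.

Lemma anf_mem (M : nat) (a : {set {set 'I_M}}) (d : nat) :
  (forall A, A \in a -> (#|A| < d)%N) -> anf a \in code M d.
Proof.
move=> H; apply/imsetP; exists a => //; rewrite inE.
by apply/fintype.subsetP => A /H; rewrite inE.
Qed.

Lemma big_addb_mask (I : finType) (a : pred I) (f : I -> bool) :
  \big[addb/false]_(i | a i) f i = \big[addb/false]_i (a i && f i).
Proof. by rewrite big_mkcond; apply: eq_bigr => i _; case: (a i). Qed.

Lemma code0 (M d : nat) : zero_word M \in code M d.
Proof.
have -> : zero_word M = anf (finset.set0).
  by apply/ffunP => x; rewrite !ffunE big_set0.
by apply: anf_mem => A; rewrite inE.
Qed.

Lemma codeD (M d : nat) (u v : word M) :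
  u \in code M d -> v \in code M d -> addpt u v \in code M d.
Proof.
move=> /imsetP[a ad ->] /imsetP[b bd ->].
have -> : addpt (anf a) (anf b) = anf [set A | (A \in a) (+) (A \in b)].
  apply/ffunP => x; rewrite !ffunE [RHS]big_addb_mask [X in X (+) _]big_addb_mask.
  rewrite [X in _ (+) X]big_addb_mask -big_split; apply: eq_bigr => A _ /=.
  by rewrite inE; case: (A \in a); case: (A \in b); case: (monomial A x).
move: ad bd; rewrite !inE => /fintype.subsetP ad /fintype.subsetP bd.
apply: anf_mem => A; rewrite inE => AA.
have /orP[] : (A \in a) || (A \in b) by case: (A \in a) AA.
  by move/ad; rewrite inE.
by move/bd; rewrite inE.
Qed.

Lemma code_le (M d d' : nat) (u : word M) :
  (d <= d')%N -> u \in code M d -> u \in code M d'.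
Proof.
move=> dd' /imsetP[a]; rewrite inE => /fintype.subsetP ad ->.
by apply: anf_mem => A /ad; rewrite inE => /leq_trans -> .
Qed.

Lemma code_monomial (M d : nat) (A : {set 'I_M}) :
  (#|A| < d)%N -> [ffun x => monomial A x] \in code M d.
Proof.
move=> Ad; have -> : [ffun x => monomial A x] = anf [set A].
  by apply/ffunP => x; rewrite !ffunE big_set1.
by apply: anf_mem => B; rewrite inE => /eqP ->.
Qed.

(** [code] is the span of its monomials, so a property closed under sums need only be checked on
    them. *)
Lemma code_ind (M d : nat) (P : word M -> Prop) :
  P (zero_word M) -> (forall u v, P u -> P v -> P (addpt u v)) ->
  (forall A : {set 'I_M}, (#|A| < d)%N -> P [ffun x => monomial A x]) ->
  forall w, w \in code M d -> P w.
Proof.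
move=> P0 PD PM w /imsetP[a]; rewrite inE => /fintype.subsetP ad ->.
have {ad} : {in enum a, forall A : {set 'I_M}, (#|A| < d)%N}.
  by move=> A; rewrite mem_enum => /ad; rewrite inE.
rewrite (_ : anf a = [ffun x => \big[addb/false]_(A <- enum a) monomial A x]); last first.
  by apply/ffunP => x; rewrite !ffunE big_enum.
elim: (enum a) => [_|A s IH H].
  by rewrite (_ : [ffun _ => _] = zero_word M) //; apply/ffunP => x; rewrite !ffunE big_nil.
rewrite (_ : [ffun _ => _] = addpt [ffun x => monomial A x]
   [ffun x => \big[addb/false]_(A <- s) monomial A x]); last first.
  by apply/ffunP => x; rewrite !ffunE big_cons.
apply: PD; first by apply: PM; apply: H; rewrite inE eqxx.
by apply: IH => B sB; apply: H; rewrite inE sB orbT.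
Qed.

Lemma code_zero_degree (M : nat) (u : word M) : u \in code M 0 -> u = zero_word M.
Proof.
move: u; apply: code_ind => //.
by move=> u v -> ->; apply/ffunP => x; rewrite !ffunE.
Qed.

Lemma code_cst (M d : nat) (b : bool) : [ffun _ => b] \in code M d.+1.
Proof.
case: b; last exact: code0.
rewrite (_ : [ffun _ => true] = [ffun x => monomial finset.set0 x]).
  by apply: code_monomial; rewrite cards0.
by apply/ffunP => x; rewrite !ffunE; apply/esym/forallP => i; rewrite inE.
Qed.

Lemma code_coord (M : nat) (i : 'I_M) : [ffun x : pt M => x i] \in code M 2.
Proof.
rewrite (_ : [ffun x : pt M => x i] = [ffun x => monomial [set i] x]).
  by apply: code_monomial; rewrite cards1.
apply/ffunP => x; rewrite !ffunE; apply/idP/forallP => [xi j|/(_ i)].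
  by rewrite inE; apply/implyP => /eqP ->.
by rewrite inE eqxx.
Qed.

Definition mulw (M : nat) (u v : word M) : word M := [ffun x => u x && v x].

Lemma code_mul_deg1 (M d : nat) (u v : word M) :
  u \in code M 2 -> v \in code M d -> mulw u v \in code M d.+1.
Proof.
move=> + vd; move: u; apply: code_ind.
- by rewrite (_ : mulw _ _ = zero_word M) ?code0 //; apply/ffunP => x; rewrite !ffunE.
- move=> u u' Hu Hu'; rewrite (_ : mulw _ _ = addpt (mulw u v) (mulw u' v)) ?codeD //.
  by apply/ffunP => x; rewrite !ffunE andb_addl.
move=> A A2; move: v vd; apply: code_ind.
- by rewrite (_ : mulw _ _ = zero_word M) ?code0 //; apply/ffunP => x; rewrite !ffunE andbF.
- move=> u u' Hu Hu'; set m := [ffun x => _].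
  rewrite (_ : mulw m _ = addpt (mulw m u) (mulw m u')) ?codeD //.
  by apply/ffunP => x; rewrite !ffunE andb_addr.
move=> B Bd; rewrite (_ : mulw _ _ = [ffun x => monomial (A :|: B) x]); last first.
  apply/ffunP => x; rewrite !ffunE; apply/andP/forallP.
    move=> [/forallP xA /forallP xB] i; rewrite inE; apply/implyP => /orP[].
      by apply/implyP/xA.
    by apply/implyP/xB.
  move=> H; split; apply/forallP => i; apply/implyP => iA; move: (H i).
    by rewrite inE iA.
  by rewrite inE iA orbT.
apply: code_monomial; rewrite cardsU (leq_ltn_trans (leq_subr _ _)) //.
by move: A2 Bd => /=; lia.
Qed.

Lemma monomial_enum (M : nat) (A : {set 'I_M}) (x : pt M) :
  monomial A x = all x (enum A).
Proof.
apply/forallP/allP => [H i|H i]; first by rewrite mem_enum; apply/implyP/H.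
by apply/implyP => iA; apply: H; rewrite mem_enum.
Qed.

(** A monomial becomes a product of as many affine forms, so the degree cannot grow. Translations,
    hyperplane sections, graphs of linear maps and restrictions to subcubes are all instances. *)
Lemma code_comp (M M' d : nat) (L : pt M' -> pt M) (w : word M) :
  (forall i, [ffun x => L x i] \in code M' 2) -> w \in code M d ->
  [ffun x => w (L x)] \in code M' d.
Proof.
move=> HL; move: w; apply: code_ind.
- by rewrite (_ : [ffun _ => _] = zero_word M') ?code0 //; apply/ffunP => x; rewrite !ffunE.
- move=> u v Hu Hv.
  rewrite (_ : [ffun _ => _] = addpt [ffun x => u (L x)] [ffun x => v (L x)]) ?codeD //.
  by apply/ffunP => x; rewrite !ffunE.
move=> A; rewrite cardE => /code_le; apply.
rewrite (_ : [ffun _ => _] = [ffun x => all (L x) (enum A)]); last first.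
  by apply/ffunP => x; rewrite !ffunE monomial_enum.
elim: (enum A) => [|i s IH] /=; first exact: code_cst.
rewrite (_ : [ffun _ => _] = mulw [ffun x => L x i] [ffun x => all (L x) s]).
  exact: code_mul_deg1.
by apply/ffunP => x; rewrite !ffunE.
Qed.

Lemma code_coord_affine (M : nat) (i : 'I_M) (y : pt M) :
  [ffun x : pt M => addpt x y i] \in code M 2.
Proof.
rewrite (_ : [ffun _ => _] = addpt [ffun x : pt M => x i] [ffun _ => y i]).
  by rewrite codeD ?code_coord ?code_cst.
by apply/ffunP => x; rewrite !ffunE.
Qed.

Lemma code_shift (M d : nat) (y : pt M) (w : word M) :
  w \in code M d -> [ffun x => w (addpt x y)] \in code M d.
Proof. by apply: code_comp => i; apply: code_coord_affine. Qed.

Definition deriv (M : nat) (y : pt M) (w : word M) : word M :=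
  [ffun x => w x (+) w (addpt x y)].

Lemma deriv0 (M : nat) (y : pt M) : deriv y (zero_word M) = zero_word M.
Proof. by apply/ffunP => x; rewrite !ffunE. Qed.

Lemma code_deriv (M d : nat) (y : pt M) (w : word M) :
  w \in code M d -> deriv y w \in code M d.-1.
Proof.
case: d => [/code_zero_degree ->|d /=]; first by rewrite deriv0 code0.
move: w; apply: code_ind.
- by rewrite deriv0 code0.
- move=> u v Hu Hv; rewrite (_ : deriv _ _ = addpt (deriv y u) (deriv y v)) ?codeD //.
  by apply/ffunP => x; rewrite !ffunE addbACA.
move=> A; rewrite cardE ltnS => /code_le; apply.
rewrite (_ : [ffun x => monomial A x] = [ffun x : pt M => all x (enum A)]); last first.
  by apply/ffunP => x; rewrite !ffunE monomial_enum.
elim: (enum A) => [|i s IH] /=.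
  by rewrite (_ : deriv _ _ = zero_word M) ?code0 //; apply/ffunP => x; rewrite !ffunE.
pose v := [ffun x : pt M => all x s].
have Hv : v \in code M (size s).+1.
  rewrite /v; elim: (s) => [|j s' IH'] /=; first exact: code_cst.
  rewrite (_ : [ffun _ => _] = mulw [ffun x : pt M => x j] [ffun x : pt M => all x s']).
    by rewrite code_mul_deg1 ?code_coord.
  by apply/ffunP => x; rewrite !ffunE.
(* Discrete Leibniz rule: D_y (x_i v) = x_i D_y v + y_i v(. + y), and both terms have one degree
   less than x_i v. *)
rewrite (_ : deriv _ _ = addpt (mulw [ffun x : pt M => x i] (deriv y v))
    (if y i then [ffun x => v (addpt x y)] else zero_word M)); last first.
  apply/ffunP => x; rewrite !ffunE.
  by case: (y i); rewrite ?ffunE; case: (x i); case: (all x s); case: (all _ s).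
apply: codeD; first by rewrite code_mul_deg1 ?code_coord.
by case: (y i); rewrite ?code0 // code_shift.
Qed.

(** Over F_2 a positive power of a variable is the variable itself, so an exponent vector evaluates
    as the squarefree monomial on its support, whose size is at most its degree. *)
Lemma RM_code (M r : nat) : RM M r = code M r.+1.
Proof.
apply/setP => w; apply/idP/idP.
  rewrite inE => /existsP[a /andP[/forallP ar /eqP ->]].
  rewrite (_ : [ffun _ => _] =
    [ffun x => \big[addb/false]_(e <- enum [pred e | a e]) monom_eval e x]); last first.
    by apply/ffunP => x; rewrite !ffunE /poly_eval big_enum; apply: eq_bigl => e; rewrite inE.
  have {ar} : {in enum [pred e | a e], forall e, (deg e <= r)%N}.
    by move=> e; rewrite mem_enum inE => ae; apply: (implyP (ar e)).
  elim: (enum [pred e | a e]) => [_|e s IH H].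
    by rewrite (_ : [ffun _ => _] = zero_word M) ?code0 //; apply/ffunP => x; rewrite !ffunE big_nil.
  rewrite (_ : [ffun _ => _] = addpt [ffun x => monom_eval e x]
     [ffun x => \big[addb/false]_(A <- s) monom_eval A x]); last first.
    by apply/ffunP => x; rewrite !ffunE big_cons.
  apply: codeD; last by apply: IH => f sf; apply: H; rewrite inE sf orbT.
  rewrite (_ : [ffun _ => _] =
      [ffun x => monomial [set i | (e i : nat) != 0%N] x]); last first.
    apply/ffunP => x; rewrite !ffunE /monom_eval big_all_cond; apply/allP/forallP => [H' i|H' i _].
      by have := H' i (mem_index_enum _); rewrite !inE /=; case: eqP.
    by have := H' i; rewrite /= inE; case: (x i); rewrite ?orbT ?orbF ?implybF ?negbK.
  apply: code_monomial; rewrite ltnS (leq_trans _ (H e _)) ?inE ?eqxx //.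
  rewrite -sum1_card /deg big_mkcond; apply: leq_sum => i _.
  by rewrite inE; case: eqP => //= /eqP; rewrite -lt0n.
move: w; apply: code_ind.
- rewrite inE; apply/existsP; exists [ffun _ => false]; apply/andP; split.
    by apply/forallP => e; rewrite ffunE.
  by apply/eqP/ffunP => x; rewrite !ffunE /poly_eval big_pred0 // => e; rewrite ffunE.
- move=> u v; rewrite !inE => /existsP[a /andP[/forallP ar /eqP ->]].
  move=> /existsP[b /andP[/forallP br /eqP ->]].
  apply/existsP; exists (addpt a b); apply/andP; split.
    apply/forallP => e; apply/implyP; rewrite ffunE => ab.
    have /orP[] : a e || b e by case: (a e) ab.
      exact/implyP/ar.
    exact/implyP/br.
  apply/eqP/ffunP => x; rewrite !ffunE /poly_eval [RHS]big_addb_mask.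
  rewrite [X in X (+) _]big_addb_mask [X in _ (+) X]big_addb_mask -big_split.
  by apply: eq_bigr => e _ /=; rewrite ffunE andb_addl.
move=> A Ar; pose e : {ffun 'I_M -> 'I_r.+1} := [ffun i => if i \in A then inord 1 else ord0].
have eE i : (e i : nat) = (i \in A).
  (* [inord 1] has value 1 only if r > 0; this holds because [A] contains [i] and has at most r
     elements. *)
  rewrite ffunE; case: ifP => //= iA; rewrite inordK // ltnS.
  by apply: leq_trans (_ : #|A| <= _)%N => //; apply/card_gt0P; exists i.
rewrite inE; apply/existsP; exists [ffun f => f == e]; apply/andP; split.
  apply/forallP => f; apply/implyP; rewrite ffunE => /eqP ->.
  rewrite /deg; under eq_bigr => i _ do rewrite eE.
  by rewrite -big_mkcond sum1_card.
apply/eqP/ffunP => x; rewrite !ffunE /poly_eval (big_pred1 e); last first.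
  by move=> f; rewrite ffunE.
rewrite /monom_eval big_all_cond; apply/forallP/allP => [H i _|H i].
  by have := H i; rewrite /= eE; case: (i \in A).
by have := H i (mem_index_enum _); rewrite /= eE; case: (i \in A).
Qed.


(** * Few codewords of low weight *)

Definition derivs (M : nat) (ys : seq (pt M)) (w : word M) : word M :=
  foldl (fun u y => deriv y u) w ys.

Lemma derivs0 (M : nat) (ys : seq (pt M)) : derivs ys (zero_word M) = zero_word M.
Proof. by elim: ys => //= y ys; rewrite deriv0. Qed.

Lemma code_derivs (M d : nat) (ys : seq (pt M)) (w : word M) :
  w \in code M d -> derivs ys w \in code M (d - size ys).
Proof.
elim: ys d w => [|y ys IH] d w wd /=; first by rewrite subn0.
by rewrite subnS -subn1 subnAC subn1; apply/IH/code_deriv.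
Qed.

Section HyperplaneReduction.
Variables (M : nat) (y1 : pt M.+1) (i0 : 'I_M.+1).
Hypothesis y1i0 : y1 i0.

(** The hyperplane x_i0 = 0 is a complement of the line through [y1], hence a model of the quotient
    by that line: [ins] is its inclusion, [red] the projection onto it along [y1], [proj] the same
    in coordinates. *)
Let ins (x : pt M) : pt M.+1 :=
  [ffun i => if unlift i0 i is Some j then x j else false].
Let red (y : pt M.+1) : pt M.+1 := if y i0 then addpt y y1 else y.
Let proj (y : pt M.+1) : pt M := [ffun j => red y (lift i0 j)].

Let ins_proj (y : pt M.+1) : ins (proj y) = red y.
Proof.
apply/ffunP => i; rewrite ffunE; case: unliftP => [j ->|->]; first by rewrite ffunE.
by rewrite /red; case E: (y i0); rewrite ?ffunE E ?y1i0.
Qed.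

Let red_inv (g : word M.+1) (x y : pt M.+1) :
  (forall x, g (addpt x y1) = g x) -> g (addpt x (red y)) = g (addpt x y).
Proof. by move=> gy; rewrite /red; case: ifP => // _; rewrite addptA gy. Qed.

Let derivs_ins (g : word M.+1) (ys : seq (pt M.+1)) :
  (forall x, g (addpt x y1) = g x) ->
  derivs ys g = [ffun x => derivs (map proj ys) [ffun x' => g (ins x')] (proj x)].
Proof.
elim: ys g => [|y ys IH] g gy /=.
  apply/ffunP => x; rewrite !ffunE ins_proj.
  have <- : addpt [ffun => false] (red x) = red x.
    by apply/ffunP => i; rewrite !ffunE.
  rewrite red_inv //; congr (g _).
  by apply/ffunP => i; rewrite !ffunE.
rewrite IH; last first.
  by move=> x; rewrite !ffunE gy -addptA (addptC y1) addptA gy.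
apply/ffunP => x; rewrite !ffunE; congr (derivs _ _ _).
apply/ffunP => x'; rewrite !ffunE -(red_inv _ _ gy) -ins_proj.
by congr (_ (+) g _); apply/ffunP => i; rewrite !ffunE; case: unliftP => [j _|]; rewrite ?ffunE.
Qed.

(** The derivative along [y1] is invariant under [y1], so it lives on the quotient: one variable and
    one degree are lost, and the remaining derivatives are taken along the projected directions. *)
Lemma card_derivs_hyperplane (d : nat) (ys : seq (pt M.+1)) :
  exists ys' : seq (pt M), size ys' = size ys /\
  (#|[set derivs (y1 :: ys) w | w in code M.+1 d]| <=
   #|[set derivs ys' w | w in code M d.-1]|)%N.
Proof.
exists (map proj ys); split; first by rewrite size_map.
pose ext (u : word M) : word M.+1 := [ffun x => u (proj x)].
apply: (leq_trans _ (leq_imset_card ext _)); apply: subset_leq_card.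
apply/fintype.subsetP => _ /imsetP[w wd ->] /=.
have gy x : deriv y1 w (addpt x y1) = deriv y1 w x.
  by rewrite !ffunE addptK addbC.
rewrite derivs_ins //; apply/imsetP.
exists (derivs (map proj ys) [ffun x' => deriv y1 w (ins x')]) => //.
apply: imset_f; apply: code_comp (code_deriv y1 wd) => i.
case: (unliftP i0 i) => [j ->|->].
  rewrite (_ : [ffun _ => _] = [ffun x : pt M => x j]) ?code_coord //.
  by apply/ffunP => x; rewrite !ffunE liftK.
rewrite (_ : [ffun _ => _] = zero_word M) ?code0 //.
by apply/ffunP => x; rewrite !ffunE unlift_none.
Qed.

End HyperplaneReduction.

Lemma card_derivs (M d : nat) (ys : seq (pt M)) :
  (#|[set derivs ys w | w in code M d]| <=
   2 ^ partial_sum (M - size ys) (d - size ys))%N.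
Proof.
move Ek : (size ys) => k.
elim: k M d ys Ek => [|k IH] M d [|y1 ys] //=.
  by rewrite !subn0 (leq_trans (leq_imset_card _ _)) ?card_code.
case=> Ek.
(* Directions need not be independent, and projection may send a later one to zero. Then all the
   derivatives vanish and a single word is left. *)
have [i0 y1i0|y10] := pickP y1; last first.
  have Z w : deriv y1 w = zero_word M.
    apply/ffunP => x; rewrite !ffunE (_ : addpt x y1 = x) ?addbb //.
    by apply/ffunP => i; rewrite ffunE y10 addbF.
  apply: (@leq_trans #|[set zero_word M]|); last by rewrite cards1 expn_gt0.
  apply/subset_leq_card/fintype.subsetP => _ /imsetP[w _ ->].
  by rewrite inE /= Z derivs0.
case: M i0 y1 ys Ek y1i0 => [|M] i0 y1 ys Ek y1i0; first by have := ltn_ord i0.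
have [ys' [sz H]] := card_derivs_hyperplane y1i0 d ys.
apply: leq_trans H _; rewrite subSS (_ : d - k.+1 = d.-1 - k)%N; last by lia.
by apply: IH; rewrite sz.
Qed.

Definition weight (M : nat) (w : word M) : nat := #|[set x | w x]|.

Lemma weight_sum (M : nat) (w : word M) : weight w = (\sum_x w x)%N.
Proof.
by rewrite /weight -sum1_card big_mkcond; apply: eq_bigr => x _; rewrite inE; case: (w x).
Qed.

Lemma weight_deriv (M : nat) (y : pt M) (w : word M) :
  (weight (deriv y w) <= (weight w).*2)%N.
Proof.
rewrite -addnn !weight_sum [X in (_ <= _ + X)%N](reindex_inj (inv_inj (addptK y))) -big_split.
by apply: leq_sum => x _; rewrite ffunE; case: (w x); case: (w _).
Qed.

Fixpoint seqs_of (T : Type) (s : seq T) (k : nat) : seq (seq T) :=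
  if k is k'.+1 then [seq y :: l | y <- s, l <- seqs_of s k'] else [:: [::]].

Lemma size_seqs_of (T : Type) (s : seq T) (k : nat) :
  size (seqs_of s k) = (size s ^ k)%N.
Proof. by elim: k => // k IH; rewrite /= size_allpairs IH expnS. Qed.

Lemma mem_seqs_of (T : eqType) (s : seq T) (k : nat) (l : seq T) :
  l \in seqs_of s k -> size l = k.
Proof.
elim: k l => [|k IH] l /=; first by rewrite inE => /eqP ->.
by move=> /allpairsP[[y l'] /= [_ /IH <- ->]].
Qed.

Lemma mem_seqs_of_sub (T : eqType) (s : seq T) (k : nat) (l : seq T) :
  l \in seqs_of s k -> {subset l <= s}.
Proof.
elim: k l => [|k IH] l /=; first by rewrite inE => /eqP ->.
move=> /allpairsP[[y l'] /= [ys /IH H ->]] x; rewrite inE => /orP[/eqP ->//|].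
exact: H.
Qed.

Lemma sum_prod_seqs_of (T : Type) (s : seq T) (k : nat) (g : T -> nat) :
  (\sum_(l <- seqs_of s k) \prod_(y <- l) g y = (\sum_(y <- s) g y) ^ k)%N.
Proof.
elim: k => [|k IH] /=; first by rewrite big_seq1 big_nil.
rewrite big_allpairs_dep expnS -IH big_distrl /=; apply: eq_bigr => y _.
by rewrite big_distrr; apply: eq_bigr => l _; rewrite big_cons.
Qed.

Lemma card_pt (M : nat) : #|pt M| = (2 ^ M)%N.
Proof. by rewrite card_ffun card_bool card_ord. Qed.

Lemma sum_word_shift (M : nat) (w : word M) (x : pt M) :
  (\sum_y w (addpt x y) = weight w)%N.
Proof.
by rewrite weight_sum [RHS](reindex_inj (inv_inj (addptKl x))).
Qed.

(** A single derivative differs from [w] at [x] only if [w] is 1 at the shifted point, and its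
    weight is at most doubled. If [w] has density p, the probability of error over random directions
    is thus at most 2 * (2^(k-1) - 1) * p + p = (2^k - 1) * p. *)
Lemma deriv_errors (M k : nat) (w : word M) (x : pt M) :
  (2 ^ M * \sum_(ys <- seqs_of (enum (pt M)) k) (derivs ys w x != w x) <=
   (2 ^ k).-1 * weight w * (2 ^ M) ^ k)%N.
Proof.
elim: k w => [|k IH] w.
  by rewrite big_seq1 /= eqxx muln0.
rewrite /= big_allpairs_dep big_enum /=.
apply: (@leq_trans (2 ^ M * (\sum_(y : pt M)
   ((\sum_(ys <- seqs_of (enum (pt M)) k) (derivs ys (deriv y w) x != deriv y w x)) +
    w (addpt x y) * (2 ^ M) ^ k))))%N.
  rewrite leq_mul2l; apply/orP; right; apply: leq_sum => y _.
  rewrite -(card_pt M) cardE -size_seqs_of -sum1_size big_distrr -big_split /=.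
  apply: leq_sum => ys _; rewrite muln1 [deriv y w x]ffunE.
  by case: (derivs _ _ _); case: (w x); case: (w _).
rewrite big_split mulnDr /= big_distrr /= -big_distrl /= sum_word_shift.
apply: (@leq_trans (2 ^ M * ((2 ^ k).-1 * (weight w).*2 * (2 ^ M) ^ k) +
   2 ^ M * (weight w * (2 ^ M) ^ k)))%N.
  rewrite leq_add2r -[X in (_ <= X * _)%N](card_pt M) -sum_nat_const; apply: leq_sum => y _.
  apply: leq_trans (IH _) _.
  by rewrite leq_mul2r leq_mul2l weight_deriv !orbT.
rewrite -(leq_add2r (weight w * (2 ^ M) ^ k.+1)) -{3}(mul1n (weight w)) -mulnA.
rewrite !expnS -mulnDl.
have : (0 < 2 ^ k)%N by rewrite expn_gt0.
move: (2 ^ k)%N (2 ^ M)%N ((2 ^ M) ^ k)%N (weight w) => [//|a] b c d _.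
rewrite /= -addnn; nia.
Qed.

Definition majority (M : nat) (us : seq (word M)) : word M :=
  [ffun x => (size us < (count (fun u : word M => u x) us).*2)%N].

Lemma majority_derivs (M : nat) (L : seq (seq (pt M))) (w : word M) :
  (forall x, ((\sum_(ys <- L) (derivs ys w x != w x)).*2 < size L)%N) ->
  w = majority [seq derivs ys w | ys <- L].
Proof.
move=> H; apply/ffunP => x; rewrite ffunE size_map count_map -sum1_count.
have E : (\sum_(ys <- L | derivs ys w x) 1 + \sum_(ys <- L) ~~ (derivs ys w x) = size L)%N.
  rewrite big_mkcond -big_split /= -sum1_size; apply: eq_bigr => ys _.
  by case: (derivs ys w x).
have := H x; case: (w x).
  rewrite (eq_bigr (fun ys => ~~ (derivs ys w x) : nat)); last by move=> ys _; case: (derivs _ _ _).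
  by move: E; set a := (\sum_(_ <- _ | _) _)%N; set b := (\sum_(_ <- _) _)%N; lia.
rewrite (eq_bigr (fun ys => derivs ys w x : nat)); last by move=> ys _; case: (derivs _ _ _).
rewrite [X in X.*2](_ : _ = \sum_(ys <- L | derivs ys w x) 1)%N.
  by move=> H'; apply/esym/negbTE; rewrite -leqNgt ltnW.
by rewrite [RHS]big_mkcond; apply: eq_bigr => ys _; case: (derivs _ _ _).
Qed.

(* Majority vote over [M.+1] tuples: the weight [\prod (16 or 1)] dominates
   [4 ^ M.+1] as soon as half of the tuples are wrong at [x], and the average of
   each factor is at most 2, so the union bound over the [2 ^ M] points [x] closes. *)
Lemma exists_good_directions (M k : nat) (w : word M) :
  (weight w * 2 ^ (k + 4) <= 2 ^ M)%N ->
  exists2 L, L \in seqs_of (seqs_of (enum (pt M)) k) M.+1 &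
    w = majority [seq derivs ys w | ys <- L].
Proof.
move=> wk; set SS := seqs_of _ k.
pose bad (L : seq (seq (pt M))) (x : pt M) :=
  (size L <= (\sum_(ys <- L) (derivs ys w x != w x)).*2)%N.
have [/hasP[L LS HL]|] := boolP (has (fun L => [forall x, ~~ bad L x]) (seqs_of SS M.+1)).
  exists L => //; apply: majority_derivs => x.
  by rewrite ltnNge; apply: (forallP HL).
move=> /hasPn H; exfalso.
pose P := ((2 ^ M) ^ k)%N.
have sizeSS : size SS = P by rewrite size_seqs_of -cardE card_pt.
pose g x ys := if derivs ys w x != w x then 16%N else 1%N.
have gsum x : (\sum_(ys <- SS) g x ys <= 2 * P)%N.
  rewrite (eq_bigr (fun ys => 1 + 15 * (derivs ys w x != w x)))%N; last first.
    by move=> ys _; rewrite /g; case: (_ != _).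
  rewrite big_split /= sum1_size sizeSS -big_distrr /= mul2n -addnn leq_add2l.
  have := deriv_errors k w x; rewrite -/SS -/P.
  set e := (\sum_(_ <- _) _)%N => He.
  have k0 : (0 < 2 ^ k)%N by rewrite expn_gt0.
  have M0 : (0 < 2 ^ M)%N by rewrite expn_gt0.
  have : (2 ^ M * (16 * e) <= 2 ^ M * P)%N.
    apply: (@leq_trans (16 * ((2 ^ k) * weight w * P)))%N.
      rewrite mulnCA leq_mul2l /=; apply: leq_trans He _.
      by rewrite !leq_mul2r leq_pred !orbT.
    rewrite expnD in wk; rewrite !mulnA leq_mul2r; apply/orP; right.
    by move: wk; rewrite (_ : 2 ^ 4 = 16)%N //; lia.
  by rewrite leq_pmul2l //; lia.
have badprod x L : L \in seqs_of SS M.+1 ->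
    (bad L x * 4 ^ M.+1 <= \prod_(ys <- L) g x ys)%N.
  move=> /mem_seqs_of sL.
  have -> : (\prod_(ys <- L) g x ys = 16 ^ (\sum_(ys <- L) (derivs ys w x != w x)))%N.
    rewrite expn_sum; apply: eq_bigr => ys _; rewrite /g.
    by case: (_ != _).
  case: (boolP (bad L x)) => [H'|_]; last by rewrite mul0n.
  by rewrite mul1n -sL (_ : 16 = 4 ^ 2)%N // -expnM leq_exp2l // mul2n.
have : (size (seqs_of SS M.+1) * 4 ^ M.+1 <= 2 ^ M * (2 * P) ^ M.+1)%N.
  rewrite -sum1_size big_distrl /=.
  apply: (@leq_trans (\sum_(L <- seqs_of SS M.+1) \sum_x \prod_(ys <- L) g x ys)%N).
    rewrite big_seq [X in (_ <= X)%N]big_seq; apply: leq_sum => L LS.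
    have := H L LS; rewrite negb_forall => /existsP[x /negPn bx].
    rewrite (bigD1 x) //=; apply: leq_trans (leq_addr _ _).
    by have := badprod x L LS; rewrite bx.
  rewrite exchange_big -[X in (_ <= X * _)%N](card_pt M) -sum_nat_const.
  by apply: leq_sum => x _; rewrite (sum_prod_seqs_of _ _ (g x)) leq_exp2r.
rewrite size_seqs_of sizeSS expnMn (_ : 4 = 2 * 2)%N // expnMn.
have P0 : (0 < P ^ M.+1)%N by rewrite !expn_gt0.
have T0 : (0 < 2 ^ M)%N by rewrite expn_gt0.
rewrite mulnCA [X in (_ <= X)%N]mulnCA leq_pmul2l ?expn_gt0 //.
rewrite mulnC leq_pmul2r // leq_exp2l // ltnn //.
Qed.

(** Take k = d: all d-fold derivatives vanish, and so does their majority. This plays the part of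
    the minimum distance and ends the range of weight levels in [ml_sum_dyadic]. *)
Lemma low_weight_zero (M d : nat) (w : word M) :
  w \in code M d -> (weight w * 2 ^ (d + 4) <= 2 ^ M)%N -> w = zero_word M.
Proof.
move=> wd /exists_good_directions[L LS ->].
apply/ffunP => x; rewrite !ffunE size_map count_map.
rewrite (eq_in_count (a2 := pred0)) ?count_pred0 // => ys /(mem_seqs_of_sub LS).
move=> /mem_seqs_of sz /=.
have := code_derivs ys wd; rewrite sz subnn => /code_zero_degree ->.
by rewrite ffunE.
Qed.

Lemma card_covered (T : finType) (I : eqType) (s : seq I) (F : {set T}) (G : I -> {set T})
    (B : nat) :
  (forall f, f \in F -> exists2 i, i \in s & f \in G i) ->
  (forall i, i \in s -> (#|G i| <= B)%N) -> (#|F| <= size s * B)%N.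
Proof.
elim: s F => [|i s IH] F HF HG.
  rewrite mul0n leqn0 cards_eq0; apply/eqP/setP => f; rewrite inE.
  by apply/negP => /HF[].
rewrite -(cardsID (G i) F) /= mulSn leq_add //.
  by apply: leq_trans (HG i _); rewrite ?inE ?eqxx // subset_leq_card // subsetIr.
apply: IH => [f|j js]; last by apply: HG; rewrite inE js orbT.
rewrite !inE => /andP[fi /HF[j]]; rewrite inE => /orP[/eqP ->|js fj].
  by rewrite (negbTE fi).
by exists j.
Qed.

(** The first factor counts the choices of M + 1 tuples of k directions; given them, each of the M +
    1 voters is one of the derivatives counted by [card_derivs]. *)
Lemma card_low_weight (M d k : nat) :
  (#|[set w in code M d | weight w * 2 ^ (k + 4) <= 2 ^ M]| <=
   (2 ^ M) ^ (k * M.+1) * (2 ^ partial_sum (M - k) (d - k)) ^ M.+1)%N.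
Proof.
set B := (2 ^ partial_sum _ _)%N.
have sz : size (seqs_of (seqs_of (enum (pt M)) k) M.+1) = ((2 ^ M) ^ (k * M.+1))%N.
  by rewrite !size_seqs_of -cardE card_pt expnM.
rewrite -sz.
pose S (ys : seq (pt M)) : {set word M} := [set derivs ys w | w in code M d].
pose G (L : seq (seq (pt M))) : {set word M} :=
  [set majority (codom h) | h : {ffun 'I_M.+1 -> word M} in
     family (fun i : 'I_M.+1 => mem (S (nth [::] L i)))].
apply: (card_covered (G := G)) => [f|L LS].
  rewrite inE => /andP[fd /exists_good_directions[L LS fL]]; exists L => //.
  apply/imsetP; exists [ffun i : 'I_M.+1 => derivs (nth [::] L i) f].
    by apply/familyP => i; rewrite ffunE; apply: imset_f.
  rewrite [LHS]fL; congr majority.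
  rewrite -[in LHS](mkseq_nth [::] L) (mem_seqs_of LS) /mkseq -val_enum_ord -map_comp -map_comp.
  by rewrite codomE; apply: eq_map => i /=; rewrite ffunE.
apply: leq_trans (leq_imset_card _ _) _; rewrite card_family.
rewrite foldrE big_map big_enum /=.
apply: (@leq_trans (\prod_(i : 'I_M.+1) B)%N); last by rewrite prod_nat_const card_ord.
apply: leq_prod => i _.
have iS : nth [::] L i \in seqs_of (enum (pt M)) k.
  by apply: (mem_seqs_of_sub LS); rewrite mem_nth // (mem_seqs_of LS).
by have := card_derivs d (nth [::] L i); rewrite (mem_seqs_of iS).
Qed.

(** * A weak predictor from the entropy deficit *)

Definition flip (X : finType) (x : X) (y : {ffun X -> bool}) : {ffun X -> bool} :=
  [ffun u => y u (+) (u == x)].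

Lemma flipK (X : finType) (x : X) : involutive (flip x).
Proof. by move=> y; apply/ffunP => u; rewrite !ffunE -addbA addbb addbF. Qed.

Lemma sum_flip (R : realType) (X : finType) (x : X) (F : {ffun X -> bool} -> R) :
  \sum_y F (flip x y) = \sum_y F y.
Proof. by rewrite [RHS](reindex_inj (inv_inj (flipK x))). Qed.

Lemma ln_le_sub1 (R : realType) (x : R) : 0 < x -> ln x <= x - 1.
Proof. by move=> x0; have := le_ln1Dx (x := x - 1); rewrite (_ : 1 + (x - 1) = x); last ring; apply; lra. Qed.

Section EntropyTensorization.
Variables (R : realType) (X : finType) (P : {ffun X -> bool} -> R).
Hypothesis P0 : forall y, 0 < P y.

Let marginal (s : seq X) (y : {ffun X -> bool}) : R :=
  \sum_(y' : {ffun X -> bool} | all (fun x => y' x == y x) s) P y'.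

Let marginal_gt0 s y : 0 < marginal s y.
Proof.
rewrite /marginal (bigD1 y) /=; last by apply/allP.
by apply: ltr_wpDr => //; apply: sumr_ge0 => y' _; apply: ltW.
Qed.

Let marginal_flip s x y : x \notin s -> marginal s (flip x y) = marginal s y.
Proof.
move=> xs; apply: eq_bigl => y'; apply: eq_in_all => u us.
by rewrite ffunE (_ : u == x = false) ?addbF //; apply: contraNF xs => /eqP <-.
Qed.

Let marginal_cons s x y : x \notin s ->
  marginal (x :: s) y + marginal (x :: s) (flip x y) = marginal s y.
Proof.
move=> xs; rewrite /marginal [RHS](bigID (fun y' : {ffun X -> bool} => y' x == y x)) /=.
congr (_ + _); apply: eq_bigl => y'; first by rewrite andbC.
rewrite ffunE eqxx addbT andbC -eqbF_neg; congr (_ && _).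
  apply: eq_in_all => u us.
  by rewrite ffunE (_ : u == x = false) ?addbF //; apply: contraNF xs => /eqP <-.
by case: (y' x); case: (y x).
Qed.

(** The ratio [P y / (P y + P (flip x y))] is the conditional probability of the bit at [x] given
    the others, so this is the mean squared bias of that bit. By ln t <= t - 1 it bounds the
    conditional entropy deficit ln 2 - H(y_x | rest). *)
Definition coord_gain (x : X) : R :=
  \sum_y P y * (2 * P y / (P y + P (flip x y)) - 1).

Let marginal_step s x : x \notin s ->
  \sum_y P y * ln (2 * marginal (x :: s) y / marginal s y) <= coord_gain x.
Proof.
move=> xs; pose m := marginal s; pose m' := marginal (x :: s).
have m0 y : 0 < m y by exact: marginal_gt0.
have m'0 y : 0 < m' y by exact: marginal_gt0.
pose S y := P y + P (flip x y).
have S0 y : 0 < S y by rewrite addr_gt0.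
apply: (@le_trans _ _ (\sum_y ((m' y / m y * S y - P y) + P y * (2 * P y / S y - 1)))).
  apply: ler_sum => y _.
  (* The last factor produces the gain at [x]. The first is a ratio whose integral against [P]
     equals that of 1, so after ln t <= t - 1 its logarithm contributes nothing: knowing all other
     bits can only enlarge the deficit. *)
  have -> : 2 * m' y / m y = (m' y / m y * (S y / P y)) * (2 * P y / S y).
    by field; rewrite !gt_eqF.
  have h1 : 0 < m' y / m y * (S y / P y) by rewrite mulr_gt0 ?divr_gt0.
  have h2 : 0 < 2 * P y / S y by rewrite divr_gt0 // mulr_gt0.
  rewrite lnM ?posrE //.
  rewrite mulrDr lerD //; last first.
    by apply: ler_wpM2l; [exact: ltW|exact: ln_le_sub1].
  apply: (@le_trans _ _ (P y * (m' y / m y * (S y / P y) - 1))).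
    by apply: ler_wpM2l; [exact: ltW|exact: ln_le_sub1].
  by rewrite le_eqVlt; apply/orP; left; apply/eqP; field; rewrite !gt_eqF.
rewrite big_split /= -/(coord_gain x) gerDr sumrB subr_le0.
under eq_bigr => y _ do rewrite mulrDr.
rewrite big_split /= -[X in _ + X](sum_flip x) -big_split /=.
apply: ler_sum => y _; rewrite flipK -mulrDl /m marginal_flip // -mulrDl.
by rewrite marginal_cons // divff ?mul1r // gt_eqF // marginal_gt0.
Qed.

(** Chain rule: adding the coordinates one at a time leads from the empty marginal to [P], and
    [marginal_step] pays for each conditional factor. *)
Lemma entropy_tensorization :
  \sum_y P y = 1 ->
  \sum_y P y * ln (2 ^+ #|X| * P y) <= \sum_x coord_gain x.
Proof.
move=> P1.
have H s : uniq s ->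
    \sum_y P y * ln (2 ^+ size s * marginal s y) <= \sum_(x <- s) coord_gain x.
  elim: s => [_|x s IH /= /andP[xs us]].
    rewrite big_nil big1 // => y _; rewrite /marginal /= P1 expr0 mulr1.
    by rewrite ln1 mulr0.
  rewrite big_cons; apply: le_trans (lerD (marginal_step xs) (IH us)).
  rewrite -big_split; apply: ler_sum => y _ /=; rewrite -mulrDr.
  apply: ler_wpM2l; first exact: ltW.
  rewrite -lnM ?posrE ?divr_gt0 ?mulr_gt0 ?exprn_gt0 ?marginal_gt0 //.
  rewrite le_eqVlt; apply/orP; left; apply/eqP; congr (ln _).
  by rewrite exprS; field; rewrite gt_eqF // marginal_gt0.
have := H _ (enum_uniq X); rewrite -cardE big_enum; apply: le_trans.
rewrite le_eqVlt; apply/orP; left; apply/eqP; apply: eq_bigr => y _.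
rewrite /marginal (big_pred1 y) // => y'.
apply/allP/eqP => [H'|-> //]; apply/ffunP => x.
by apply/eqP/H'; rewrite mem_enum.
Qed.

End EntropyTensorization.

Section Noise.
Variables (R : realType) (eps : R).
Definition nu (b : bool) : R := if b then eps else 1 - eps.

Lemma nu1 : nu true + nu false = 1.
Proof. by rewrite /nu addrC subrK. Qed.

Lemma chanE (M : nat) (f g : word M) : chan eps f g = wt_prod nu (addpt f g).
Proof.
apply: eq_bigr => x _; rewrite ffunE /nu.
by case: (f x); case: (g x).
Qed.

Lemma sum_chan (M : nat) (f : word M) (F : word M -> R) :
  \sum_g chan eps f g * F g = expec nu (fun z => F (addpt f z)).
Proof.
rewrite /expec (reindex_inj (inv_inj (addptKl f))); apply: eq_bigr => z _.
by rewrite chanE addptKl.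
Qed.

Lemma sum_chan1 (M : nat) (f : word M) : \sum_g chan eps f g = 1.
Proof.
rewrite -[RHS](expec_cst nu1 (pt M)) -(sum_chan f (fun _ => 1)).
by apply: eq_bigr => g _; rewrite mulr1.
Qed.

Hypotheses (eps_gt0 : 0 < eps) (eps_lt : eps < 1 / 2).

Lemma nu_gt0 (b : bool) : 0 < nu b.
Proof. by rewrite /nu; case: b => //; move: eps_lt eps_gt0 => ? ?; lra. Qed.

Lemma chan_gt0 (M : nat) (f g : word M) : 0 < chan eps f g.
Proof. by rewrite chanE wt_prod_gt0 //; apply: nu_gt0. Qed.

Lemma expec_coord (X : finType) (x : X) (phi : bool -> R) :
  expec nu (fun z : {ffun X -> bool} => phi (z x)) =
  eps * phi true + (1 - eps) * phi false.
Proof.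
have := expec_prod nu1 (pred1 x) (fun _ b => phi b).
rewrite big_pred1_eq /= => <-; apply: eq_expec => z.
by rewrite big_pred1_eq.
Qed.

Lemma noise_entropy (X : finType) :
  expec nu (fun z : {ffun X -> bool} => ln (wt_prod nu z)) =
  (#|X|)%:R * (eps * ln eps + (1 - eps) * ln (1 - eps)).
Proof.
rewrite (eq_expec nu (G := fun z : {ffun X -> bool} => \sum_x ln (nu (z x)))).
  rewrite expec_sum mulr_natl -sumr_const; apply: eq_bigr => x _.
  by rewrite (expec_coord x (fun b => ln (nu b))).
(* Positivity is carried along the product because [lnM] asks for it at each factor. *)
move=> z; apply: (@proj2 (0 < wt_prod nu z)); rewrite /wt_prod.
elim/big_rec2: _ => [|x y1 y2 _ [IH0 IH]]; first by rewrite ln1.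
by rewrite mulr_gt0 ?nu_gt0 // lnM ?posrE ?nu_gt0 // IH.
Qed.

Section WeakPredictor.
Variables (M d : nat).
Let C := code M d.
Let origin : pt M := [ffun => false].
Let prior : R := (#|C|%:R)^-1.
Let P (y : word M) : R := prior * \sum_(f in C) chan eps f y.

Let prior_gt0 : 0 < prior.
Proof. by rewrite invr_gt0 ltr0n; apply/card_gt0P; exists (zero_word M); exact: code0. Qed.

Let P_gt0 y : 0 < P y.
Proof.
rewrite mulr_gt0 // (bigD1 (zero_word M)) /=; last exact: code0.
by apply: ltr_wpDr; rewrite ?chan_gt0 // sumr_ge0 // => f _; rewrite ltW // chan_gt0.
Qed.

Let sum_P (F : word M -> R) :
  \sum_y P y * F y = prior * \sum_(f in C) expec nu (fun z => F (addpt f z)).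
Proof.
under eq_bigr => y _ do rewrite /P -mulrA big_distrl /=.
rewrite -big_distrr /= exchange_big /=; congr (_ * _).
by apply: eq_bigr => f _; rewrite sum_chan.
Qed.

Let sum_P_cst (c : R) : prior * \sum_(f in C) c = c.
Proof.
rewrite sumr_const -mulr_natl mulrA mulVf ?mul1r // -invr_eq0.
by rewrite gt_eqF.
Qed.

Let sum_P1 : \sum_y P y = 1.
Proof.
have := sum_P (fun _ => 1); under eq_bigr do rewrite mulr1.
move=> ->; rewrite -[RHS](sum_P_cst 1); congr (_ * _).
by apply: eq_bigr => f _; rewrite (expec_cst nu1).
Qed.

Let addf_in (f g : word M) : f \in C -> (addpt f g \in C) = (g \in C).
Proof.
move=> fC; apply/idP/idP => [H|]; last exact: codeD.
by rewrite -(addptKl f g); apply: codeD.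
Qed.

Let P_add (f y : word M) : f \in C -> P (addpt f y) = P y.
Proof.
move=> fC; congr (_ * _); rewrite (reindex_inj (inv_inj (addptKl f))) /=.
apply: eq_big => [g|g _]; first exact: addf_in.
rewrite !chanE; congr (wt_prod _ _).
by apply/ffunP => x; rewrite !ffunE; case: (f x); case: (g x); case: (y x).
Qed.

Let shift (x : pt M) (y : word M) : word M := [ffun u => y (addpt u x)].

Let shiftK x : involutive (shift x).
Proof. by move=> y; apply/ffunP => u; rewrite !ffunE addptK. Qed.

Let shift_in x f : (shift x f \in C) = (f \in C).
Proof.
apply/idP/idP; last exact: code_shift.
by rewrite -{2}(shiftK x f); apply: code_shift.
Qed.

Let P_shift x y : P (shift x y) = P y.
Proof.
congr (_ * _); rewrite (reindex_inj (inv_inj (shiftK x))) /=.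
apply: eq_big => [g|g _]; first exact: shift_in.
rewrite /chan (reindex_inj (inv_inj (addptK x))) /=; apply: eq_bigr => u _.
by rewrite !ffunE addptK.
Qed.

Let coord_gain_shift x : coord_gain P x = coord_gain P origin.
Proof.
rewrite /coord_gain (reindex_inj (inv_inj (shiftK x))); apply: eq_bigr => y _.
rewrite P_shift (_ : flip x (shift x y) = shift x (flip origin y)) ?P_shift //.
apply/ffunP => u; rewrite !ffunE; congr (_ (+) _).
apply/eqP/eqP => [->|ux]; first by apply/ffunP => i; rewrite !ffunE addbb.
rewrite -[LHS](addptK x) ux; apply/ffunP => i; by rewrite !ffunE.
Qed.

(** Entropy balance: given the codeword, the received word has the entropy of the noise. Dropping
    from [P] all codewords but the true one shows that its total entropy exceeds this by at most the
    logarithm of the size of the code. Translation invariance spreads the deficit evenly over the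
    points. *)
Let gain_lower : 
  (2 ^ M)%:R * (ln 2 + (eps * ln eps + (1 - eps) * ln (1 - eps))) -
    ln 2 * (partial_sum M d)%:R <= (2 ^ M)%:R * coord_gain P origin.
Proof.
have -> : (2 ^ M)%:R * coord_gain P origin = \sum_x coord_gain P x.
  by rewrite (eq_bigr _ (fun x _ => coord_gain_shift x)) sumr_const card_pt mulr_natl.
apply: le_trans (entropy_tensorization P_gt0 sum_P1).
rewrite sum_P card_pt.
apply: (@le_trans _ _ (prior * \sum_(f in C) ((2 ^ M)%:R * ln 2 + ln prior +
   (2 ^ M)%:R * (eps * ln eps + (1 - eps) * ln (1 - eps))))).
  have C0 : (0 < #|C|)%N by apply/card_gt0P; exists (zero_word M); exact: code0.
  have : ln prior >= - (ln 2 * (partial_sum M d)%:R).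
    rewrite /prior lnV ?posrE ?ltr0n // lerN2 mulrC mulr_natl -lnXn //.
    by rewrite ler_ln ?posrE ?exprn_gt0 ?ltr0n // -natrX ler_nat card_code.
  by rewrite sum_P_cst mulrDr; lra.
apply: ler_wpM2l; first exact: ltW.
apply: ler_sum => f fC.
have := noise_entropy (pt M); rewrite card_pt => <-.
set c := (_ + ln prior); rewrite -[X in X + _](expec_cst nu1 (pt M) c) -expecD {}/c.
apply: (ler_expec nu_gt0) => z.
rewrite P_add // lnM ?posrE ?exprn_gt0 // lnXn // mulr_natl -addrA lerD2l.
rewrite /P lnM ?posrE //; last first.
  rewrite (bigD1 (zero_word M)) /=; last exact: code0.
  by apply: ltr_wpDr; rewrite ?chan_gt0 // sumr_ge0 // => g _; rewrite ltW // chan_gt0.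
rewrite lerD2l ler_ln ?posrE ?wt_prod_gt0 //; try exact: nu_gt0; last first.
  rewrite (bigD1 (zero_word M)) /=; last exact: code0.
  by apply: ltr_wpDr; rewrite ?chan_gt0 // sumr_ge0 // => g _; rewrite ltW // chan_gt0.
rewrite (bigD1 (zero_word M)) /=; last exact: code0.
rewrite chanE (_ : addpt (zero_word M) z = z); last by apply/ffunP => x; rewrite !ffunE.
by rewrite lerDl sumr_ge0 // => g _; rewrite ltW // chan_gt0.
Qed.

Let sgn (b : bool) : R := if b then -1 else 1.
(** Posterior mean of the sign of the received bit at the origin given all the other bits; the
    factor [sgn (y origin)] makes the formula invariant under flipping that bit. *)
Let rho (y : word M) : R :=
  sgn (y origin) * (P y - P (flip origin y)) / (P y + P (flip origin y)).

Lemma weak_predictor (delta : R) :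
  0 <= delta ->
  (partial_sum M d)%:R <= (1 - H eps - delta) * 2 ^+ M ->
  exists rho : word M -> R,
  [/\ depends_on (predC1 ([ffun => false] : pt M)) rho,
      forall y, `|rho y| <= 1,
      forall f y, f \in code M d ->
        rho (addpt f y) = (if f [ffun => false] then -1 else 1) * rho y
    & delta * ln 2 <= expec nu rho].
Proof.
move=> d0 rate; exists rho.
have S0 y : 0 < P y + P (flip origin y) by rewrite addr_gt0.
have flip_rho y : rho (flip origin y) = rho y.
  rewrite /rho flipK ffunE eqxx addbT addrC -opprB mulrN.
  rewrite (addrC (P (flip origin y))) !mulNr -!mulrA; case: (y origin) => /=; ring.
have dep : depends_on (predC1 origin) rho.
  move=> z z' zz'; have [e|ne] := eqVneq (z origin) (z' origin).
    congr rho; apply/ffunP => x; have [->//|xo] := eqVneq x origin.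
    by apply: zz'; rewrite !inE.
  rewrite -[RHS]flip_rho; congr rho; apply/ffunP => x; rewrite ffunE.
  have [->|xo] := eqVneq x origin.
    by move: ne; case: (z origin); case: (z' origin).
  by rewrite addbF; apply: zz'; rewrite !inE.
have add_rho f y : f \in C -> rho (addpt f y) = sgn (f origin) * rho y.
  move=> fC; rewrite /rho P_add // ffunE.
  rewrite (_ : flip origin (addpt f y) = addpt f (flip origin y)) ?P_add //; last first.
    by apply/ffunP => u; rewrite !ffunE addbA.
  rewrite !mulrA; congr (_ * _ / _).
  by rewrite /sgn; case: (f origin); case: (y origin) => /=; ring.
split=> // [y|].
  rewrite /rho normrM normrM (_ : `|sgn _| = 1) ?mul1r; last first.
    by rewrite /sgn; case: ifP; rewrite ?normrN normr1.
  rewrite normfV (gtr0_norm (S0 y)) ler_pdivrMr // mul1r ler_norml.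
  by have := P_gt0 y; have := P_gt0 (flip origin y) => ? ?; lra.
(* The gain is the mean of the predictor times the sign of the received bit. After reduction to the
   zero codeword this sign is that of a noise bit, of mean 1 - 2 eps and independent of [rho]. *)
have gainE : coord_gain P origin = (1 - 2 * eps) * expec nu rho.
  transitivity (\sum_y P y * (sgn (y origin) * rho y)).
    apply: eq_bigr => y _; congr (_ * _); rewrite /rho.
    move: (S0 y); move: (P y) (P (flip origin y)) => a b ab.
    by rewrite /sgn; case: (y origin); field; rewrite gt_eqF.
  rewrite sum_P -[RHS](sum_P_cst); congr (_ * _); apply: eq_bigr => f fC.
  transitivity (expec nu (fun z : word M => sgn (z origin) * rho z)).
    apply: eq_expec => z; rewrite add_rho // ffunE mulrA; congr (_ * _).
    by rewrite /sgn; case: (f origin); case: (z origin) => /=; ring.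
  rewrite (expec_indep nu1 (B := pred1 origin) (F := fun z => sgn (z origin))) //.
    by rewrite expec_coord /sgn; congr (_ * _); ring.
  by move=> z z' H'; congr sgn; apply: H'; rewrite inE.
have l2 : 0 < ln (2 : R) by rewrite ln_gt0 // ltr1n.
have M0 : 0 < ((2 ^ M)%:R : R) by rewrite ltr0n expn_gt0.
have gain_ge : delta * ln 2 <= coord_gain P origin.
  rewrite -(ler_pM2l M0); apply: le_trans gain_lower.
  have HE : H eps * ln 2 = - (eps * ln eps + (1 - eps) * ln (1 - eps)).
    by rewrite /H /log2; field; rewrite gt_eqF.
  apply: (@le_trans _ _ ((2 ^ M)%:R * (ln 2 - H eps * ln 2) -
     ln 2 * ((1 - H eps - delta) * 2 ^+ M))).
    by rewrite natrX le_eqVlt; apply/orP; left; apply/eqP; ring.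
  rewrite HE opprK lerD2l lerN2; apply: ler_wpM2l => //; exact: ltW.
move: gain_ge; rewrite gainE => gain_ge.
have e0 : 0 <= expec nu rho.
  have : 0 <= (1 - 2 * eps) * expec nu rho.
    by apply: le_trans gain_ge; rewrite mulr_ge0 // ltW.
  by rewrite pmulr_rge0 //; move: eps_lt => ?; lra.
apply: le_trans gain_ge _; rewrite -[X in _ <= X]mul1r ler_wpM2r //; move: eps_gt0 => ?; lra.
Qed.

End WeakPredictor.

End Noise.

(** * Biased Fourier analysis *)

Section ScalarHypercontractivity.
Variable R : realType.

Lemma ler_pow (n : nat) (x y : R) : 0 <= x -> x <= y -> x ^+ n <= y ^+ n.
Proof. by move=> x0 xy; rewrite lerXn2r ?nnegrE // (le_trans x0). Qed.

Lemma pow1D_le (n : nat) (x : R) :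
  -1 <= x <= 1 -> (1 + x) ^+ n <= 1 + n%:R * x + 3 ^+ n * x ^+ 2.
Proof.
move=> /andP[x1 x2]; elim: n => [|n IH].
  by rewrite !expr0 mul0r addr0 mul1r lerDl sqr_ge0.
rewrite exprS mulrC; apply: (@le_trans _ _ ((1 + n%:R * x + 3 ^+ n * x ^+ 2) * (1 + x))).
  by rewrite ler_wpM2r //; lra.
have n3 : n%:R <= 3 ^+ n :> R by rewrite -natrX ler_nat ltnW // ltn_expl.
have p3 : 0 <= 3 ^+ n :> R by rewrite exprn_ge0.
have xx : 0 <= x ^+ 2 by rewrite sqr_ge0.
rewrite -[n.+1]addn1 natrD (exprD _ n 1) expr1 -subr_ge0.
rewrite (_ : _ - _ = x ^+ 2 * ((3 ^+ n - n%:R) + 3 ^+ n * (1 - x))); last by ring.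
by rewrite mulr_ge0 // addr_ge0 ?subr_ge0 // mulr_ge0 // subr_ge0.
Qed.

Lemma bernoulli_le (n : nat) (c : R) : 0 <= c -> 1 + n%:R * c <= (1 + c) ^+ n.
Proof.
move=> c0; elim: n => [|n IH]; first by rewrite mul0r addr0 expr0.
rewrite exprS; apply: (@le_trans _ _ ((1 + c) * (1 + n%:R * c))); last first.
  by rewrite ler_wpM2l // addr_ge0.
rewrite -addn1 natrD -subr_ge0 (_ : _ - _ = n%:R * c ^+ 2); last by ring.
by rewrite mulr_ge0 // sqr_ge0.
Qed.

Lemma pow4_add_le (j : nat) : 4 ^+ j + (2 * j)%:R <= 9 ^+ j :> R.
Proof.
rewrite -!natrX -natrD ler_nat; elim: j => // j IH.
by rewrite !expnS; move: (4 ^ j)%N (9 ^ j)%N IH (expn_gt0 4 j) => a b IH a0; lia.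
Qed.

(** The linear term is kept exactly, since it will be averaged against a centred bit. For |x| <= 1 a
    quadratic bound is enough; beyond that (1 + x)^2 <= 4 x^2, and 9^j exceeds 4^j with room for the
    linear term. *)
Lemma two_point_normalized (j : nat) (x : R) : (0 < j)%N ->
  ((1 + x) ^+ 2) ^+ j <= (2 * j)%:R * x + (1 + 9 ^+ j * x ^+ 2) ^+ j.
Proof.
move=> j0; have xx : 0 <= x ^+ 2 by rewrite sqr_ge0.
have p9 : 1 <= 9 ^+ j :> R by rewrite exprn_ege1 // ler1n.
have [x1|x1] := boolP (-1 <= x <= 1).
  rewrite -exprM; apply: le_trans (pow1D_le _ x1) _.
  have c0 : 0 <= 9 ^+ j * x ^+ 2 by rewrite mulr_ge0 // (le_trans _ p9).
  have := bernoulli_le j c0.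
  have : 9 ^+ j * x ^+ 2 <= j%:R * (9 ^+ j * x ^+ 2) by rewrite ler_peMl // ler1n.
  by rewrite [3 ^+ _]exprM (_ : 3 ^+ 2 = 9 :> R); [lra|ring].
have xx1 : 1 <= x ^+ 2.
  by have [|] := lerP x (-1); have [|] := lerP 1 x; rewrite ?expr2; try nra;
     move=> a b; move: x1; rewrite (ltW b) (ltW a).
have h1 : ((1 + x) ^+ 2) ^+ j <= 4 ^+ j * (x ^+ 2) ^+ j.
  have hh : (1 + x) ^+ 2 <= 4 * x ^+ 2 by move: xx1; rewrite !expr2; nra.
  by rewrite -exprMn; apply: ler_pow => //; apply: sqr_ge0.
have h2 : x ^+ 2 <= (x ^+ 2) ^+ j by rewrite -{1}(expr1 (x ^+ 2)) ler_weXn2l.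
have h3 : - x <= x ^+ 2.
  rewrite -subr_ge0 opprK; have := sqr_ge0 (x + 1); move: xx1; rewrite !expr2; nra.
have h4 : (9 ^+ j * x ^+ 2) ^+ j <= (1 + 9 ^+ j * x ^+ 2) ^+ j.
  by apply: ler_pow; [apply: mulr_ge0 => //; apply: le_trans p9|rewrite lerDr].
have h5 : 9 ^+ j * (x ^+ 2) ^+ j <= (9 ^+ j * x ^+ 2) ^+ j.
  rewrite [X in _ <= X]exprMn; apply: ler_wpM2r; first exact: exprn_ge0.
  by rewrite -[X in X <= _]expr1 ler_weXn2l.
have := pow4_add_le j; have : 0 <= (2 * j)%:R :> R by [].
move: xx1 h1 h2 h3 h4 h5; move: ((1 + x) ^+ 2 ^+ j) (x ^+ 2) ((x ^+ 2) ^+ j) => A B t.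
move: (4 ^+ j) (9 ^+ j) (2 * j)%:R => a b c; set D := (b * B) ^+ j; set E := (_ + _) ^+ j.
move=> B1 h1 h2 h3 h4 h5 c0 abc.
have t0 : 0 <= t by lra.
have : 0 <= c * (t + x) by apply: mulr_ge0 => //; lra.
have : 0 <= t * (b - (a + c)) by apply: mulr_ge0 => //; lra.
by lra.
Qed.

Lemma two_point (j : nat) (a y : R) : (0 < j)%N ->
  ((a + y) ^+ 2) ^+ j <=
  (2 * j)%:R * a ^+ (2 * j).-1 * y + (a ^+ 2 + 9 ^+ j * y ^+ 2) ^+ j.
Proof.
move=> j0; have [->|a0] := eqVneq a 0.
  rewrite add0r expr0n (_ : (_.-1 == 0)%N = false); last by lia.
  rewrite mulr0 mul0r add0r expr0n add0r; apply: ler_pow; first exact: sqr_ge0.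
  by rewrite ler_peMl ?sqr_ge0 // exprn_ege1 // ler1n.
have := two_point_normalized (y / a) j0.
have p : 0 < (a ^+ 2) ^+ j by rewrite exprn_gt0 // exprn_even_gt0.
rewrite -(ler_pM2l p) mulrDr -!exprMn.
have -> : a * (1 + y / a) = a + y by field.
have -> : a ^+ 2 * (1 + 9 ^+ j * (y / a) ^+ 2) = a ^+ 2 + 9 ^+ j * y ^+ 2 by field.
congr (_ <= _ + _); rewrite -exprM -{1}(@prednK (2 * j)) ?muln_gt0 // exprS.
by field.
Qed.

Lemma convex_pow (t x y : R) (j : nat) : 0 <= t <= 1 -> 0 <= x -> 0 <= y ->
  (t * x + (1 - t) * y) ^+ j <= t * x ^+ j + (1 - t) * y ^+ j.
Proof.
move=> /andP[t0 t1] x0 y0; have t1' : 0 <= 1 - t by rewrite subr_ge0.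
elim: j => [|j IH]; first by rewrite !expr0 !mulr1 addrC subrK.
rewrite exprS; apply: (@le_trans _ _ ((t * x + (1 - t) * y) * (t * x ^+ j + (1 - t) * y ^+ j))).
  by rewrite ler_wpM2l // addr_ge0 // mulr_ge0.
rewrite !exprS -subr_ge0.
(* Chebyshev: x - y and x^j - y^j have the same sign. *)
rewrite (_ : _ - _ = t * (1 - t) * ((x - y) * (x ^+ j - y ^+ j))); last by ring.
apply: mulr_ge0; first exact: mulr_ge0.
have [xy|/ltW xy] := lerP x y.
  by rewrite -mulrNN !opprB; apply: mulr_ge0; rewrite subr_ge0 // ler_pow.
by apply: mulr_ge0; rewrite subr_ge0 // ler_pow.
Qed.

End ScalarHypercontractivity.

Lemma sum_setU1 (R : realType) (X : finType) (x : X) (F : {set X} -> R) :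
  \sum_A F A = \sum_(A : {set X} | x \notin A) (F A + F (x |: A)).
Proof.
rewrite (bigID (fun A : {set X} => x \notin A)) /= big_split /=; congr (_ + _).
rewrite (reindex_onto (fun A => x |: A) (fun A => A :\ x)) /=.
  apply: eq_bigl => A; rewrite setU11 /=; apply/eqP/idP => [<-|xA].
    by rewrite !inE eqxx.
  by rewrite setU1K.
by move=> A; rewrite negbK => xA; apply: finset.setD1K.
Qed.

Section Fourier.
Variables (R : realType) (eps : R).
Hypotheses (eps_gt0 : 0 < eps) (eps_lt : eps < 1 / 2).
Local Notation E := (expec (nu eps)).

Definition phi (b : bool) : R := (b%:R - eps) / Num.sqrt (eps * (1 - eps)).
Definition chi (X : finType) (A : {set X}) (z : {ffun X -> bool}) : R :=
  \prod_(x in A) phi (z x).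
Definition fourier (X : finType) (F : {ffun X -> bool} -> R) (A : {set X}) : R :=
  E (fun z => F z * chi A z).

Let eps1_gt0 : 0 < 1 - eps.
Proof. by move: eps_gt0 eps_lt => ? ?; lra. Qed.

Let sd_sqr : Num.sqrt (eps * (1 - eps)) ^+ 2 = eps * (1 - eps).
Proof. by rewrite sqr_sqrtr // mulr_ge0 // ltW. Qed.

Let sd_gt0 : 0 < Num.sqrt (eps * (1 - eps)).
Proof. by rewrite sqrtr_gt0 mulr_gt0. Qed.

Let phi_mul b b' : phi b * phi b' = (b%:R - eps) * (b'%:R - eps) / (eps * (1 - eps)).
Proof. by rewrite -sd_sqr /phi; field; rewrite gt_eqF. Qed.

Let mean_phi : nu eps true * phi true + nu eps false * phi false = 0.
Proof. by rewrite /nu /phi /=; field; rewrite gt_eqF. Qed.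

Let var_phi : nu eps true * (phi true * phi true) + nu eps false * (phi false * phi false) = 1.
Proof. by rewrite !phi_mul /nu /=; field; rewrite !gt_eqF. Qed.

Let phi_kernel b b' : nu eps b' * (1 + phi b * phi b') = (b == b')%:R.
Proof. by rewrite phi_mul /nu; case: b; case: b' => /=; field; rewrite !gt_eqF. Qed.

Let phi_sqr_le b : phi b ^+ 2 <= (eps * (1 - eps))^-1.
Proof.
rewrite expr2 phi_mul -[X in _ <= X]mul1r ler_wpM2r ?invr_ge0 ?mulr_ge0 ?(ltW eps_gt0) ?ltW //.
move: eps_gt0 eps_lt => ? ?; case: b => /=; nra.
Qed.

Lemma expec_chi (X : finType) (A B : {set X}) : E (fun z => chi A z * chi B z) = (A == B)%:R.
Proof.
pose g (x : X) (b : bool) : R := (if x \in A then phi b else 1) * (if x \in B then phi b else 1).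
transitivity (E (fun z : {ffun X -> bool} => \prod_(x in {: X}) g x (z x))).
  apply: eq_expec => z; rewrite /chi big_mkcond [X in _ * X]big_mkcond -big_split.
  by apply: eq_bigl => x; rewrite inE.
rewrite (expec_prod (nu1 eps)); have [AB|neq] := eqVneq A B.
  rewrite big1 // => x _; rewrite /g AB; case: ifP => _; first exact: var_phi.
  by rewrite !mulr1 nu1.
have [x xAB] : exists x, (x \in A) != (x \in B).
  apply/existsP; apply: contraNT neq; rewrite negb_exists => /forallP H.
  by apply/eqP/setP => x; apply/eqP; have := H x; rewrite negbK.
apply/eqP; rewrite prodf_seq_eq0; apply/hasP; exists x; first exact: mem_index_enum.
rewrite inE /= /g; move: xAB.
by case: (x \in A); case: (x \in B); rewrite // ?mulr1 ?mul1r mean_phi.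
Qed.

(** Inversion by a kernel: the sum over [A] of [chi A z' * chi A z] factors over the coordinates,
    and [phi_kernel] identifies it, times the weight of [z'], with the indicator of z = z'. *)
Lemma fourier_expansion (X : finType) (F : {ffun X -> bool} -> R) z :
  F z = \sum_A fourier F A * chi A z.
Proof.
transitivity (\sum_z' F z' * (z == z')%:R).
  rewrite (bigD1 z) //= eqxx mulr1 big1 ?addr0 // => z' zz'.
  by rewrite eq_sym (negbTE zz') mulr0.
rewrite /fourier /expec; under [RHS]eq_bigr => A _ do rewrite big_distrl /=.
rewrite exchange_big; apply: eq_bigr => z' _ /=.
transitivity (wt_prod (nu eps) z' * F z' * \sum_A chi A z' * chi A z); last first.
  by rewrite big_distrr; apply: eq_bigr => A _ /=; rewrite !mulrA.
rewrite mulrAC mulrC; congr (_ * _).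
transitivity (\prod_x (nu eps (z' x) * (1 + phi (z x) * phi (z' x)))).
  under eq_bigr => x _ do rewrite phi_kernel.
  have [->|neq] := eqVneq z z'; first by rewrite big1 // => x _; rewrite eqxx.
  have [x xz] : exists x, z x != z' x.
    apply/existsP; apply: contraNT neq; rewrite negb_exists => /forallP H.
    by apply/eqP/ffunP => x; apply/eqP; have := H x; rewrite negbK.
  apply/esym/eqP; rewrite prodf_seq_eq0; apply/hasP; exists x; first exact: mem_index_enum.
  by rewrite /= (negbTE xz).
rewrite big_split; congr (_ * _); under eq_bigr => x _ do rewrite addrC.
rewrite (bigA_distr (R := R)) ; apply: eq_bigr => A _; rewrite /chi -big_split.
by rewrite [RHS]big_mkcond; apply: eq_bigr => x _; case: ifP => // _; rewrite mulrC.
Qed.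

Lemma parseval (X : finType) (u : {set X} -> R) :
  E (fun z => (\sum_A u A * chi A z) ^+ 2) = \sum_A u A ^+ 2.
Proof.
rewrite (eq_expec _ (G := fun z : {ffun X -> bool} =>
   \sum_A \sum_B (u A * u B) * (chi A z * chi B z))); last first.
  by move=> z; rewrite expr2 big_distrlr; apply: eq_bigr => A _; apply: eq_bigr => B _ /=; ring.
rewrite expec_sum; apply: eq_bigr => A _; rewrite expec_sum (bigD1 A) //= big1.
  by rewrite addr0 expecZ expec_chi eqxx mulr1 expr2.
by move=> B BA; rewrite expecZ expec_chi eq_sym (negbTE BA) mulr0.
Qed.

Lemma fourier_sqr_sum (X : finType) (F : {ffun X -> bool} -> R) :
  \sum_A fourier F A ^+ 2 = E (fun z => F z ^+ 2).
Proof. by rewrite -parseval; apply: eq_expec => z; rewrite -fourier_expansion. Qed.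

(** Triangle inequality for the j-norm, with [A] and [B] bounding the two norms: convexity of the
    j-th power at t = A / (A + B), applied to [al / A] and [be / B]. A zero bound forces the
    function to vanish, which settles the case where one cannot divide. *)
Lemma minkowski (X : finType) (j : nat) (al be : {ffun X -> bool} -> R) (A B : R) :
  (0 < j)%N -> (forall z, 0 <= al z) -> (forall z, 0 <= be z) -> 0 <= A -> 0 <= B ->
  E (fun z => al z ^+ j) <= A ^+ j -> E (fun z => be z ^+ j) <= B ^+ j ->
  E (fun z => (al z + be z) ^+ j) <= (A + B) ^+ j.
Proof.
move=> j0 al0 be0; have nu0 := nu_gt0 eps_gt0 eps_lt.
rewrite le_eqVlt => /orP[/eqP <-|A0].
  move=> _ HA HB; have Z z : al z = 0.
    apply/eqP; have /eqP : al z ^+ j = 0.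
      apply: (expec_eq0 (nu1 eps) nu0 (F := fun z => al z ^+ j)) => [z'|]; first exact: exprn_ge0.
      by move: HA; rewrite expr0n (gtn_eqF j0).
    by rewrite expf_eq0 j0.
  rewrite add0r; apply: le_trans HB; rewrite le_eqVlt; apply/orP; left; apply/eqP.
  by apply: eq_expec => z; rewrite Z add0r.
rewrite le_eqVlt => /orP[/eqP <-|B0].
  move=> HA HB; have Z z : be z = 0.
    apply/eqP; have /eqP : be z ^+ j = 0.
      apply: (expec_eq0 (nu1 eps) nu0 (F := fun z => be z ^+ j)) => [z'|]; first exact: exprn_ge0.
      by move: HB; rewrite expr0n (gtn_eqF j0).
    by rewrite expf_eq0 j0.
  rewrite addr0; apply: le_trans HA; rewrite le_eqVlt; apply/orP; left; apply/eqP.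
  by apply: eq_expec => z; rewrite Z addr0.
move=> HA HB; have AB0 : 0 < A + B by rewrite addr_gt0.
pose t := A / (A + B).
have t01 : 0 <= t <= 1.
  apply/andP; split; first by apply: divr_ge0; exact: ltW.
  by rewrite /t ler_pdivrMr // mul1r lerDl; exact: ltW.
have t1E : 1 - t = B / (A + B) by rewrite /t; field; rewrite gt_eqF.
apply: (@le_trans _ _ ((A + B) ^+ j * (t * (A ^- j * E (fun z => al z ^+ j)) +
    (1 - t) * (B ^- j * E (fun z => be z ^+ j))))).
  rewrite -!expecZ -expecD -expecZ; apply: (ler_expec nu0) => z.
  have -> : al z + be z = (A + B) * (t * (al z / A) + (1 - t) * (be z / B)).
    by rewrite t1E /t; field; rewrite !gt_eqF.
  rewrite exprMn; apply: ler_wpM2l; first by rewrite exprn_ge0 // ltW.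
  have al0' : 0 <= al z / A by rewrite divr_ge0 // ltW.
  have be0' : 0 <= be z / B by rewrite divr_ge0 // ltW.
  apply: le_trans (convex_pow j t01 al0' be0') _.
  by rewrite !exprMn !exprVn ![_ ^- j * _]mulrC.
rewrite -[X in _ <= X]mulr1; apply: ler_wpM2l; first by rewrite exprn_ge0 // ltW.
have t0 : 0 <= t by case/andP: t01.
have t1 : 0 <= 1 - t by case/andP: t01; rewrite subr_ge0.
rewrite -[X in _ <= X](subrK t) addrC lerD //.
  rewrite -[X in _ <= X]mulr1; apply: ler_wpM2l => //.
  by rewrite mulrC ler_pdivrMr ?exprn_gt0 // mul1r.
rewrite -[X in _ <= X]mulr1; apply: ler_wpM2l => //.
by rewrite mulrC ler_pdivrMr ?exprn_gt0 // mul1r.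
Qed.

(** The numerator comes from [two_point]; the denominator is the bound [phi_sqr_le] on the square of
    the standardized bit. *)
Definition hyper_const (j : nat) : R := 9 ^+ j / (eps * (1 - eps)).

Lemma hyper_const_ge1 (j : nat) : 1 <= hyper_const j.
Proof.
rewrite ler_pdivlMr ?mulr_gt0 // mul1r.
apply: (@le_trans _ _ 1); last by rewrite exprn_ege1 // ler1n.
move: eps_gt0 eps_lt => ? ?; nra.
Qed.

(** Induction on the set of coordinates in use. Splitting one off writes the function as a + phi b;
    the linear term of [two_point] averages to 0, and [minkowski] adds the j-norms of a^2 and K
    b^2. *)
Lemma hypercontractivity (X : finType) (j : nat) (u : {set X} -> R) :
  (0 < j)%N ->
  E (fun z => ((\sum_A u A * chi A z) ^+ 2) ^+ j) <=
  (\sum_(A : {set X}) hyper_const j ^+ #|A| * u A ^+ 2) ^+ j.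
Proof.
move=> j0; have nu0 := nu_gt0 eps_gt0 eps_lt.
set K := hyper_const j; have K1 : 1 <= K by exact: hyper_const_ge1.
have K0 : 0 <= K by apply: le_trans K1.
suff H (n : nat) (B : {set X}) (v : {set X} -> R) : #|B| = n -> (forall A : {set X}, v A != 0 -> A \subset B) ->
    E (fun z => ((\sum_A v A * chi A z) ^+ 2) ^+ j) <= (\sum_(A : {set X}) K ^+ #|A| * v A ^+ 2) ^+ j.
  by apply: (H _ [set x | true] u erefl) => A _; apply/fintype.subsetP => x; rewrite inE.
have term0 (w : {set X} -> R) (A : {set X}) : 0 <= K ^+ #|A| * w A ^+ 2.
  by rewrite mulr_ge0 ?sqr_ge0 ?exprn_ge0.
elim: n B v => [|n IH] B v Bn vB.
  have v0 (A : {set X}) : A != finset.set0 -> v A = 0.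
    apply: contraNeq => /vB; move/eqP: Bn; rewrite cards_eq0 => /eqP ->.
    by rewrite finset.subset0.
  rewrite (bigD1 finset.set0) //= [X in _ + X]big1 ?addr0; last first.
    by move=> A /v0 ->; rewrite expr0n mulr0.
  rewrite cards0 expr0 mul1r -[X in _ <= X](expec_cst (nu1 eps) X).
  rewrite le_eqVlt; apply/orP; left; apply/eqP; apply: eq_expec => z.
  rewrite (bigD1 finset.set0) //= [X in _ + X]big1 ?addr0; last first.
    by move=> A /v0 ->; rewrite mul0r.
  by rewrite /chi big_set0 mulr1.
have [x xB] : exists x, x \in B by apply/finset.set0Pn; rewrite -cards_eq0 Bn.
pose v0 (A : {set X}) : R := if x \in A then 0 else v A.
pose v1 (A : {set X}) : R := if x \in A then 0 else v (x |: A).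
pose a (z : {ffun X -> bool}) : R := \sum_A v0 A * chi A z.
pose b (z : {ffun X -> bool}) : R := \sum_A v1 A * chi A z.
have splitE z : \sum_A v A * chi A z = a z + phi (z x) * b z.
  rewrite (sum_setU1 x) /a /b big_distrr /= -big_split /=.
  rewrite big_mkcond; apply: eq_bigr => A _ /=; rewrite /v0 /v1.
  case: (boolP (x \in A)) => xA /=; first by rewrite !mul0r mulr0 addr0.
  by rewrite (_ : chi (x |: A) z = phi (z x) * chi A z); [ring|rewrite /chi big_setU1].
pose NA := \sum_(A : {set X}) K ^+ #|A| * v0 A ^+ 2.
pose NB := \sum_(A : {set X}) K ^+ #|A| * v1 A ^+ 2.
have normE : \sum_(A : {set X}) K ^+ #|A| * v A ^+ 2 = NA + K * NB.
  rewrite (sum_setU1 x) /NA /NB big_distrr /= -big_split /=.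
  rewrite big_mkcond; apply: eq_bigr => A _ /=; rewrite /v0 /v1.
  case: (boolP (x \in A)) => xA /=; first by rewrite expr0n !mulr0 addr0.
  by rewrite cardsU1 xA /= add1n (exprS K) mulrA.
have NA0 : 0 <= NA by apply: sumr_ge0.
have NB0 : 0 <= NB by apply: sumr_ge0.
have cardBx : #|B :\ x| = n by move: (cardsD1 x B); rewrite xB Bn => -[].
have IHa : E (fun z => (a z ^+ 2) ^+ j) <= NA ^+ j.
  apply: (IH (B :\ x) v0 cardBx) => A; rewrite /v0; case: ifPn; first by rewrite eqxx.
  by move=> xA /vB AB; rewrite subsetD1 AB.
have IHb : E (fun z => (b z ^+ 2) ^+ j) <= NB ^+ j.
  apply: (IH (B :\ x) v1 cardBx) => A; rewrite /v1; case: ifPn; first by rewrite eqxx.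
  by move=> xA /vB; rewrite finset.subUset => /andP[_ AB]; rewrite subsetD1 AB.
have dep (v' : {set X} -> R) : (forall A : {set X}, x \in A -> v' A = 0) ->
    depends_on [predC pred1 x] (fun z : {ffun X -> bool} => \sum_A v' A * chi A z).
  move=> H z z' zz'; apply: eq_bigr => A _; have [xA|xA] := boolP (x \in A).
    by rewrite H // !mul0r.
  congr (_ * _); apply: eq_bigr => y yA; rewrite zz' //.
  by rewrite !inE; apply: contraNneq xA => <-.
have da : depends_on [predC pred1 x] a by apply: dep => A xA; rewrite /v0 xA.
have db : depends_on [predC pred1 x] b by apply: dep => A xA; rewrite /v1 xA.
rewrite normE.
apply: (@le_trans _ _ (E (fun z => phi (z x) * ((2 * j)%:R * a z ^+ (2 * j).-1 * b z) +
    (a z ^+ 2 + K * b z ^+ 2) ^+ j))).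
  apply: (ler_expec nu0) => z; rewrite splitE.
  apply: le_trans (two_point _ _ j0) _.
  rewrite [X in X + _ <= _](_ : _ = phi (z x) * ((2 * j)%:R * a z ^+ (2 * j).-1 * b z)); last by ring.
  rewrite lerD2l; apply: ler_pow.
    apply: addr_ge0; first exact: sqr_ge0.
    by apply: mulr_ge0; [exact: exprn_ge0|exact: sqr_ge0].
  rewrite lerD2l exprMn mulrA; apply: ler_wpM2r; first exact: sqr_ge0.
  by apply: ler_wpM2l; [exact: exprn_ge0|exact: phi_sqr_le].
rewrite expecD (expec_indep (nu1 eps) (B := pred1 x) (F := fun z => phi (z x))).
- rewrite expec_coord mean_phi mul0r add0r.
  apply: minkowski => //.
  - by move=> z; apply: sqr_ge0.
  - by move=> z; apply: mulr_ge0 => //; apply: sqr_ge0.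
  - exact: mulr_ge0.
  rewrite (eq_expec _ (G := fun z => K ^+ j * (b z ^+ 2) ^+ j)).
    rewrite expecZ [(K * NB) ^+ j]exprMn; apply: ler_wpM2l => //; exact: exprn_ge0.
  by move=> z; rewrite [(K * _) ^+ j]exprMn.
- by move=> z z' zz'; rewrite zz' // inE.
by move=> z z' zz'; rewrite (da _ _ zz') (db _ _ zz').
Qed.

End Fourier.

(** * Boosting by random graphs of linear maps *)

Definition dot (n : nat) (q x : pt n) : bool := \big[addb/false]_i (q i && x i).

Lemma dotDl (n : nat) (q q' x : pt n) : dot (addpt q q') x = dot q x (+) dot q' x.
Proof. by rewrite /dot -big_split; apply: eq_bigr => i _ /=; rewrite ffunE andb_addl. Qed.

Lemma dotC (n : nat) (q x : pt n) : dot q x = dot x q.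
Proof. by apply: eq_bigr => i _; rewrite andbC. Qed.

Lemma dot0 (n : nat) (q : pt n) : dot q [ffun => false] = false.
Proof. by rewrite /dot big1 // => i _; rewrite ffunE andbF. Qed.

Section CharacterSums.
Variable R : realType.

Let sg (b : bool) : R := if b then -1 else 1.
Let sgD b b' : sg (b (+) b') = sg b * sg b'.
Proof. by rewrite /sg; case: b; case: b'; rewrite /= ?mulr1 ?mul1r ?mulrNN ?mulr1. Qed.

Let sum_sg (n : nat) (p : pt n) :
  \sum_v sg (dot p v) = (2 ^ n)%:R * (p == [ffun => false])%:R.
Proof.
have [->|p0] := eqVneq p [ffun => false].
  rewrite mulr1 -card_pt -sumr_const; apply: eq_bigr => v _.
  by rewrite dotC dot0.
have [i pi] : exists i, p i.
  apply/existsP; apply: contraNT p0; rewrite negb_exists => /forallP H.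
  by apply/eqP/ffunP => i; rewrite ffunE; apply/negbTE.
pose e : pt n := [ffun j => j == i].
have pe : dot p e = true.
  rewrite /dot (bigD1 i) //= big1 => [|j ji]; first by rewrite ffunE eqxx pi.
  by rewrite ffunE (negbTE ji) andbF.
have : \sum_v sg (dot p v) = - \sum_v sg (dot p v).
  rewrite {1}(reindex_inj (inv_inj (addptK e))) -sumrN; apply: eq_bigr => v _.
  by rewrite dotC dotDl sgD !(dotC _ p) pe /sg mulrN1.
by rewrite mulr0; lra.
Qed.

(* Bessel's inequality for the characters indexed by [A] and the origin. *)
Lemma card_affine_solutions (n : nat) (A : {set pt n}) (c : pt n -> bool) :
  [ffun => false] \notin A ->
  (#|[set q : pt n | [forall v in A, dot q v == c v]]| * #|A|.+1 <= 2 ^ n)%N.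
Proof.
move=> A0; set U := [set q | _].
have [->|U0] := eqVneq #|U| 0%N; first by rewrite mul0n.
rewrite -(@leq_pmul2l #|U|) ?lt0n // mulnA mulnn.
rewrite -(ler_nat R) !natrM -(expr2 #|U|%:R).
pose F (v : pt n) : R := \sum_(q in U) sg (dot q v).
have total : \sum_v F v ^+ 2 = #|U|%:R * (2 ^ n)%:R.
  rewrite /F; under eq_bigr => v _ do rewrite expr2 big_distrlr /=.
  rewrite exchange_big /= mulr_natl -sumr_const; apply: eq_bigr => q qU.
  rewrite exchange_big /=.
  under eq_bigr => q' _.
    under eq_bigr => v _ do rewrite -sgD -dotDl.
    rewrite sum_sg; over.
  rewrite (bigD1 q) //= big1 => [|q' /andP[_ qq']].
    by rewrite addr0 (_ : addpt q q = [ffun => false]) ?eqxx ?mulr1 //; apply/ffunP => i; rewrite !ffunE addbb.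
  rewrite (_ : (addpt q q' == [ffun => false]) = false) ?mulr0 //; apply: contraNF qq' => /eqP E.
  by apply/eqP; rewrite -[LHS](addptKl q) E; apply/ffunP => i; rewrite !ffunE addbF.
rewrite -total (bigID (mem ([ffun => false] |: A))) /=.
apply: (@le_trans _ _ (\sum_(v in [ffun => false] |: A) F v ^+ 2)); last first.
  by rewrite lerDl sumr_ge0 // => v _; apply: sqr_ge0.
rewrite mulrC mulr_natl -(_ : #|[ffun => false] |: A| = #|A|.+1); last first.
  by rewrite cardsU1 A0.
rewrite -sumr_const; apply: ler_sum => v.
rewrite !inE => /orP[/eqP ->|vA].
  rewrite /F (eq_bigr (fun _ => 1)) ?sumr_const //.
  by move=> q _; rewrite dot0.
rewrite /F (eq_bigr (fun _ => sg (c v))) => [|q]; last first.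
  by rewrite inE => /forallP/(_ v); rewrite vA /= => /eqP ->.
by rewrite sumr_const /sg; case: (c v); rewrite ?mulNrn ?sqrrN.
Qed.

End CharacterSums.

Definition graph_map (n k : nat) (Q : {ffun 'I_k -> pt n}) (x : pt n) : pt (n + k) :=
  [ffun i : 'I_(n + k) => match fintype.split i with inl a => x a | inr b => dot (Q b) x end].

Section GraphMap.
Variables (n k : nat).
Implicit Type Q : {ffun 'I_k -> pt n}.

Lemma graph_map_l Q x (a : 'I_n) : graph_map Q x (lshift k a) = x a.
Proof. by rewrite ffunE (unsplitK (inl a)). Qed.

Lemma graph_map_r Q x (b : 'I_k) : graph_map Q x (rshift n b) = dot (Q b) x.
Proof. by rewrite ffunE (unsplitK (inr b)). Qed.

(** The first n coordinates return the base point whatever the map is. Hence two sets with a common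
    image under some pair of graphs are equal, which keeps distinct characters apart in the
    average. *)
Lemma graph_map_eq Q Q' x x' : graph_map Q x = graph_map Q' x' -> x = x'.
Proof.
move=> H; apply/ffunP => a.
by rewrite -(graph_map_l Q x) H graph_map_l.
Qed.

Lemma graph_map_inj Q : injective (graph_map Q).
Proof. by move=> x x'; apply: graph_map_eq. Qed.

Lemma graph_map0 Q : graph_map Q [ffun => false] = [ffun => false].
Proof.
apply/ffunP => i; rewrite !ffunE; case: (fintype.split i) => a; first by rewrite ffunE.
exact: dot0.
Qed.

Lemma code_graph_map Q d (w : word (n + k)) :
  w \in code (n + k) d -> [ffun x => w (graph_map Q x)] \in code n d.
Proof.
apply: code_comp => i; case: (split_ordP i) => [a ->|b ->].
  rewrite (_ : [ffun _ => _] = [ffun x : pt n => x a]) ?code_coord //.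
  by apply/ffunP => x; rewrite !ffunE (unsplitK (inl a)).
rewrite (_ : [ffun _ => _] = [ffun x : pt n => dot (Q b) x]); last first.
  by apply/ffunP => x; rewrite !ffunE (unsplitK (inr b)).
rewrite (_ : [ffun _ => _] = [ffun x : pt n => \big[addb/false]_(j <- index_enum 'I_n) (Q b j && x j)]) //.
elim: (index_enum _) => [|j s IH].
  rewrite (_ : [ffun _ => _] = zero_word n) ?code0 //.
  by apply/ffunP => x; rewrite !ffunE big_nil.
rewrite (_ : [ffun _ => _] = addpt (if Q b j then [ffun x : pt n => x j] else zero_word n)
   [ffun x : pt n => \big[addb/false]_(j <- s) (Q b j && x j)]).
  by rewrite codeD //; case: (Q b j); rewrite ?code0 ?code_coord.
by apply/ffunP => x; rewrite !ffunE big_cons; case: (Q b j); rewrite ffunE.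
Qed.

(** If two graphs send [A] onto the same [B], they agree on [A], since a point of [B] determines its
    base point. So each of the k rows of [Q] solves a fixed affine system indexed by [A]. *)
Lemma card_graph_maps (R : realType) (A : {set pt n}) (B : {set pt (n + k)}) :
  [ffun => false] \notin A ->
  (#|[set Q | graph_map Q @: A == B]| * #|A|.+1 ^ k <= (2 ^ n) ^ k)%N.
Proof.
move=> A0; have [Q0 Q0B|] := pickP [pred Q : {ffun 'I_k -> pt n} | graph_map Q @: A == B]; last first.
  by move=> H; rewrite eq_card0 // => Q; rewrite inE; apply: H.
pose U (b : 'I_k) := [set q : pt n | [forall v in A, dot q v == dot (Q0 b) v]].
apply: (@leq_trans ((\prod_(b < k) #|U b|) * #|A|.+1 ^ k)%N).
  rewrite leq_mul2r; apply/orP; right.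
  have -> : (\prod_(b < k) #|U b| = #|family (fun b => mem (U b))|)%N.
    by rewrite card_family foldrE big_map big_enum.
  apply/subset_leq_card/fintype.subsetP => Q; rewrite inE => /eqP QB.
  apply/familyP => b; rewrite inE; apply/forallP => v; apply/implyP => vA.
  have : graph_map Q v \in graph_map Q0 @: A by rewrite (eqP Q0B) -QB imset_f.
  move=> /imsetP[v' v'A E]; have vv' := graph_map_eq E.
  by rewrite -!graph_map_r E vv'.
rewrite -[X in (_ * _ ^ X)%N](card_ord k) -prod_nat_const -big_split /=.
rewrite -[X in (_ <= _ ^ X)%N](card_ord k) -prod_nat_const; apply: leq_prod => b _.
exact: (card_affine_solutions R).
Qed.

End GraphMap.

Section Boosting.
Variables (R : realType) (eps : R).
Hypotheses (eps_gt0 : 0 < eps) (eps_lt : eps < 1 / 2).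
Local Notation E := (expec (nu eps)).
Variables (n k : nat) (rho : word n -> R).
Hypothesis rho_dep : depends_on (predC1 ([ffun => false] : pt n)) rho.
Hypothesis rho_le1 : forall y, `|rho y| <= 1.
Let Qs := {ffun 'I_k -> pt n}.
Let avg (F : Qs -> R) : R := (\sum_Q F Q) / #|{: Qs}|%:R.

Let cardQs : #|{: Qs}| = ((2 ^ n) ^ k)%N.
Proof. by rewrite card_ffun card_ord card_pt. Qed.

Let cardQs_gt0 : 0 < #|{: Qs}|%:R :> R.
Proof. by rewrite cardQs ltr0n !expn_gt0. Qed.

Let avg_cst c : avg (fun _ => c) = c.
Proof. by rewrite /avg sumr_const -[c *+ _]mulr_natr mulfK // gt_eqF. Qed.

Definition boosted (z : word (n + k)) : R :=
  (\sum_(Q : {ffun 'I_k -> pt n}) rho [ffun x => z (graph_map Q x)]) /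
  #|{: {ffun 'I_k -> pt n}}|%:R.

Let coef (B : {set pt (n + k)}) : R :=
  avg (fun Q => \sum_A fourier eps rho A * (graph_map Q @: A == B)%:R).

Let prob (A : {set pt n}) (B : {set pt (n + k)}) : R :=
  avg (fun Q => (graph_map Q @: A == B)%:R).

Let chi_graph Q (A : {set pt n}) (z : word (n + k)) :
  chi eps A [ffun x => z (graph_map Q x)] = chi eps (graph_map Q @: A) z.
Proof.
rewrite /chi big_imset /=; last by move=> x y _ _; apply: graph_map_inj.
by apply: eq_bigr => x _; rewrite ffunE.
Qed.

Let boostedE z : boosted z = \sum_B coef B * chi eps B z.
Proof.
rewrite /coef /avg; under [RHS]eq_bigr => B _ do rewrite mulrAC big_distrl /=.
rewrite -big_distrl /= exchange_big /=; congr (_ / _); apply: eq_bigr => Q _.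
rewrite (fourier_expansion eps_gt0 eps_lt rho).
under [RHS]eq_bigr => B _ do rewrite big_distrl /=.
rewrite exchange_big /=; apply: eq_bigr => A _.
rewrite (bigD1 (graph_map Q @: A)) //= eqxx mulr1 chi_graph big1 ?addr0 // => B BA.
by rewrite eq_sym (negbTE BA) mulr0 mul0r.
Qed.

(** The bound [prob_le] concerns sets that avoid the origin. Only these matter, because [rho]
    ignores the bit at the origin and [phi] is centred. *)
Let fourier_origin (A : {set pt n}) : [ffun => false] \in A -> fourier eps rho A = 0.
Proof.
move=> oA; rewrite /fourier.
rewrite (eq_expec _ (G := fun z => phi eps (z [ffun => false]) *
   (rho z * chi eps (A :\ [ffun => false]) z))); last first.
  by move=> z; rewrite {1}/chi (big_setD1 _ oA) /= -/(chi _ _ _) mulrCA.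
rewrite (expec_indep (nu1 eps) (B := pred1 [ffun => false])
  (F := fun z => phi eps (z [ffun => false]))).
- rewrite expec_coord (_ : eps * _ + _ = 0) ?mul0r //.
  by rewrite /phi /=; ring.
- by move=> z z' zz'; rewrite zz' // inE.
move=> z z' zz'; congr (_ * _); first by apply: rho_dep => x; rewrite !inE; apply: zz'.
by apply: eq_bigr => x; rewrite !inE => /andP[xo _]; rewrite zz'.
Qed.

Let prob_sum A : \sum_B prob A B = 1.
Proof.
rewrite /prob /avg -big_distrl /= exchange_big /= -[RHS](avg_cst 1); congr (_ / _).
apply: eq_bigr => Q _; rewrite (bigD1 (graph_map Q @: A)) //= eqxx big1 ?addr0 // => B BA.
by rewrite eq_sym (negbTE BA).
Qed.

Let prob_ge0 A B : 0 <= prob A B.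
Proof. by apply: divr_ge0 => //; apply: sumr_ge0. Qed.

Let prob_le (A : {set pt n}) (B : {set pt (n + k)}) : [ffun => false] \notin A -> prob A B <= (#|A|.+1%:R ^+ k)^-1.
Proof.
move=> oA; have p0 : 0 < #|A|.+1%:R ^+ k :> R by rewrite exprn_gt0 ?ltr0n.
rewrite /prob /avg ler_pdivrMr // -(ler_pM2l p0) mulrA divff ?gt_eqF // mul1r.
rewrite (_ : \sum_(Q : Qs) _ = #|[set Q : Qs | graph_map Q @: A == B]|%:R).
  rewrite -natrX -natrM ler_nat cardQs mulnC; exact: (card_graph_maps R).
rewrite -sum1_card natr_sum [RHS]big_mkcond; apply: eq_bigr => Q _.
by rewrite inE; case: (_ == _).
Qed.

Let coefE (B : {set pt (n + k)}) (A : {set pt n}) : (forall A' : {set pt n}, A' != A -> prob A' B = 0) ->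
  coef B = fourier eps rho A * prob A B.
Proof.
move=> H; transitivity (\sum_A' fourier eps rho A' * prob A' B).
  rewrite /coef /prob /avg exchange_big /= big_distrl /=; apply: eq_bigr => A' _.
  by rewrite -big_distrr /= mulrA.
by rewrite (bigD1 A) //= big1 ?addr0 // => A' /H ->; rewrite mulr0.
Qed.

Let prob_neq0 (A : {set pt n}) (B : {set pt (n + k)}) : prob A B != 0 -> exists Q : Qs, graph_map Q @: A = B.
Proof.
move=> p0; have [Q QB|H] := pickP [pred Q : Qs | graph_map Q @: A == B].
  by exists Q; apply/eqP.
move: p0; rewrite /prob /avg big1 ?mul0r ?eqxx // => Q _.
by have := H Q; rewrite /= => ->.
Qed.

Let prob_unique (A A' : {set pt n}) (B : {set pt (n + k)}) : prob A B != 0 -> A' != A -> prob A' B = 0.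
Proof.
move=> /prob_neq0[Q QB] AA'; apply/eqP; apply: contraTT AA'.
move=> /prob_neq0[Q' Q'B]; rewrite negbK.
have sub (C D : {set pt n}) (P P' : Qs) : graph_map P @: C = graph_map P' @: D -> C \subset D.
  move=> e; apply/fintype.subsetP => x xC.
  have : graph_map P x \in graph_map P' @: D by rewrite -e imset_f.
  by move=> /imsetP[y yD /graph_map_eq ->].
by rewrite finset.eqEsubset (sub _ _ Q' Q) ?(sub _ _ Q Q') // QB Q'B.
Qed.

(** At most one [A] can be sent onto a given [B], so a squared coefficient is a squared Fourier
    coefficient of [rho] times the square of [prob A B]. One of these two factors is at most (|A| +
    1)^-k, the other sums to 1 over [B]. *)
Let coef_sqr_sum (c : nat -> R) : (forall a, 0 <= c a) ->
  \sum_(B : {set pt (n + k)}) c #|B| * coef B ^+ 2 <=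
  \sum_(A : {set pt n}) c #|A| / #|A|.+1%:R ^+ k * fourier eps rho A ^+ 2.
Proof.
move=> c0.
have step (B : {set pt (n + k)}) : c #|B| * coef B ^+ 2 <=
    \sum_(A : {set pt n}) (c #|A| / #|A|.+1%:R ^+ k * fourier eps rho A ^+ 2) * prob A B.
  have T0 (A : {set pt n}) : 0 <= (c #|A| / #|A|.+1%:R ^+ k * fourier eps rho A ^+ 2) * prob A B.
    by rewrite mulr_ge0 // mulr_ge0 ?sqr_ge0 // divr_ge0 // exprn_ge0.
  have [A pA|H] := pickP [pred A | prob A B != 0]; last first.
    rewrite (coefE (A := finset.set0)).
      have := H finset.set0; rewrite /= => /negbFE/eqP ->; rewrite mulr0 expr0n mulr0.
      by apply: sumr_ge0.
    by move=> A' _; have := H A'; rewrite /= => /negbFE/eqP.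
  rewrite (coefE (A := A)); last by move=> A'; apply: prob_unique.
  apply: (@le_trans _ _ ((c #|A| / #|A|.+1%:R ^+ k * fourier eps rho A ^+ 2) * prob A B)); last first.
    by rewrite (bigD1 A) //= lerDl sumr_ge0.
  have [Q QB] := prob_neq0 pA.
  rewrite -QB card_imset ?QB; last exact: graph_map_inj.
  have [oA|oA] := boolP ([ffun => false] \in A).
    by rewrite fourier_origin // !mul0r expr0n !mulr0 mul0r.
  have -> : c #|A| * (fourier eps rho A * prob A B) ^+ 2 =
    c #|A| * fourier eps rho A ^+ 2 * prob A B * prob A B by ring.
  have -> : c #|A| / #|A|.+1%:R ^+ k * fourier eps rho A ^+ 2 * prob A B =
    c #|A| * fourier eps rho A ^+ 2 * prob A B * (#|A|.+1%:R ^+ k)^-1 by ring.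
  apply: ler_wpM2l; last exact: prob_le.
  by rewrite mulr_ge0 // mulr_ge0 // sqr_ge0.
apply: le_trans (ler_sum _ (fun B _ => step B)) _.
rewrite exchange_big /=; apply: ler_sum => A _.
by rewrite -big_distrr /= prob_sum mulr1.
Qed.

Let fourier_sum_le1 : \sum_A fourier eps rho A ^+ 2 <= 1.
Proof.
rewrite fourier_sqr_sum // -[X in _ <= X](expec_cst (nu1 eps) (pt n)).
apply: (ler_expec (nu_gt0 eps_gt0 eps_lt)) => z.
by rewrite -real_normK ?num_real // exprn_ile1.
Qed.

Let coef0 : coef finset.set0 = E rho.
Proof.
rewrite (coefE (A := finset.set0)).
  rewrite (_ : prob _ _ = 1) ?mulr1.
    by apply: eq_expec => z; rewrite /chi big_set0 mulr1.
  rewrite -[RHS](avg_cst 1) /prob /avg; congr (_ / _); apply: eq_bigr => Q _.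
  by rewrite imset0 eqxx.
move=> A; apply: prob_unique.
rewrite (_ : prob _ _ = 1) ?oner_neq0 // -[RHS](avg_cst 1) /prob /avg.
by congr (_ / _); apply: eq_bigr => Q _; rewrite imset0 eqxx.
Qed.

(** If the sum is not positive, then the part of degree 1 to [s] or the part above [s] is at most -
    q / 2, with q the mean of [rho]. Markov's inequality uses the 2j-th moment for the former and
    the second moment for the latter; |A| >= 1 and |A| >= s + 1 give the survival bounds 2^-k and (s
    + 2)^-k. *)
Lemma boosted_le0 (j s : nat) : (0 < j)%N -> 0 < E rho ->
  E (fun z => (boosted z <= 0)%R%:R) <=
  (4 / E rho ^+ 2 * (hyper_const eps j ^+ s / 2 ^+ k)) ^+ j +
  4 / E rho ^+ 2 / (s.+2)%:R ^+ k.
Proof.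
move=> j0 q0; set q := E rho; have nu0 := nu_gt0 eps_gt0 eps_lt.
set K := hyper_const eps j; have K1 : 1 <= K by exact: hyper_const_ge1.
have K0 : 0 <= K by apply: le_trans K1.
have q2 : 0 < q ^+ 2 by rewrite exprn_gt0.
have q4 : 0 <= 4 / q ^+ 2 by rewrite divr_ge0 // ltW.
pose lo (B : {set pt (n + k)}) : R := if (0 < #|B| <= s)%N then coef B else 0.
pose hi (B : {set pt (n + k)}) : R := if (s < #|B|)%N then coef B else 0.
pose L z := \sum_B lo B * chi eps B z.
pose T z := \sum_B hi B * chi eps B z.
have splitE z : boosted z = q + L z + T z.
  rewrite boostedE (bigD1 finset.set0) //= coef0 {1}/chi big_set0 mulr1 -addrA; congr (_ + _).
  rewrite /L /T -big_split /= [RHS](bigD1 finset.set0) //= /lo /hi cards0 /= !mul0r !add0r.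
  apply: eq_bigr => B B0; have -> : (0 < #|B|)%N by rewrite card_gt0.
  by case: (leqP #|B| s) => _; rewrite /= mul0r ?addr0 ?add0r.
apply: (@le_trans _ _ (E (fun z => (4 / q ^+ 2) ^+ j * (L z ^+ 2) ^+ j +
    4 / q ^+ 2 * T z ^+ 2))).
  apply: (ler_expec nu0) => z; rewrite splitE -exprMn.
  have l0 : 0 <= 4 / q ^+ 2 * L z ^+ 2 by rewrite mulr_ge0 // sqr_ge0.
  have t0 : 0 <= 4 / q ^+ 2 * T z ^+ 2 by rewrite mulr_ge0 // sqr_ge0.
  case: (lerP (q + L z + T z) 0) => H /=; last by rewrite addr_ge0 // exprn_ge0.
  have big (x : R) : x <= - (q / 2) -> 1 <= 4 / q ^+ 2 * x ^+ 2.
    move=> xq; rewrite mulrAC ler_pdivlMr // mul1r -subr_ge0.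
    rewrite (_ : _ - _ = (- (2 * x) - q) * (- (2 * x) + q)); last by ring.
    by apply: mulr_ge0; move: q0; rewrite -/q; lra.
  have [/big lz|lz] := lerP (L z) (- (q / 2)).
    by apply: ler_wpDr => //; rewrite exprn_ege1.
  by apply: ler_wpDl; [exact: exprn_ge0|apply: big; lra].
rewrite expecD !expecZ [(4 / q ^+ 2 * _) ^+ j]exprMn; apply: lerD.
  apply: ler_wpM2l; first exact: exprn_ge0.
  apply: le_trans (hypercontractivity eps_gt0 eps_lt lo j0) _; apply: ler_pow.
    by apply: sumr_ge0 => B _; apply: mulr_ge0; [exact: exprn_ge0|exact: sqr_ge0].
  pose c a : R := if (0 < a <= s)%N then K ^+ a else 0.
  have c0 a : 0 <= c a by rewrite /c; case: ifP => // _; apply: exprn_ge0.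
  apply: (@le_trans _ _ (\sum_(B : {set pt (n + k)}) c #|B| * coef B ^+ 2)).
    apply: ler_sum => B _; rewrite /lo /c; case: ifP => // _.
    by rewrite expr0n mulr0 mul0r.
  apply: le_trans (coef_sqr_sum c0) _.
  apply: (@le_trans _ _ (\sum_(A : {set pt n}) K ^+ s / 2 ^+ k * fourier eps rho A ^+ 2)).
    apply: ler_sum => A _; apply: ler_wpM2r; first exact: sqr_ge0.
    have Ks : 0 <= K ^+ s / 2 ^+ k by rewrite divr_ge0 // exprn_ge0.
    rewrite /c; case: ifP => [/andP[A0 As]|_]; last by rewrite mul0r.
    apply: ler_pM; rewrite ?exprn_ge0 ?invr_ge0 ?exprn_ge0 //.
      exact: ler_weXn2l.
    by rewrite lef_pV2 ?posrE ?exprn_gt0 ?ltr0n //; apply: ler_pow; rewrite // ler_nat.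
  rewrite -big_distrr /= -[X in _ <= X]mulr1; apply: ler_wpM2l => //.
  by rewrite divr_ge0 // exprn_ge0.
apply: ler_wpM2l => //; rewrite parseval //.
pose c a : R := if (s < a)%N then 1 else 0.
have c0 a : 0 <= c a by rewrite /c; case: ifP.
apply: (@le_trans _ _ (\sum_(B : {set pt (n + k)}) c #|B| * coef B ^+ 2)).
  apply: ler_sum => B _; rewrite /hi /c; case: ifP => // _; rewrite ?mul1r //.
  by rewrite expr0n mul0r.
apply: le_trans (coef_sqr_sum c0) _.
apply: (@le_trans _ _ (\sum_(A : {set pt n}) (s.+2%:R ^+ k)^-1 * fourier eps rho A ^+ 2)).
  apply: ler_sum => A _; apply: ler_wpM2r; first exact: sqr_ge0.
  rewrite /c; case: ifP => [As|_]; last by rewrite mul0r invr_ge0 exprn_ge0.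
  rewrite mul1r lef_pV2 ?posrE ?exprn_gt0 ?ltr0n //; apply: ler_pow => //.
  by rewrite ler_nat ltnS.
rewrite -big_distrr /= -[X in _ <= X]mulr1; exact: ler_wpM2l.
Qed.

(** Every graph passes through the origin and pulls codewords back to codewords of the same degree,
    so all the averaged predictors change by the same sign. *)
Lemma boosted_add (d : nat) :
  (forall f y, f \in code n d ->
     rho (addpt f y) = (if f [ffun => false] then -1 else 1) * rho y) ->
  forall f z, f \in code (n + k) d ->
  boosted (addpt f z) = (if f [ffun => false] then -1 else 1) * boosted z.
Proof.
move=> H f z fd; rewrite /boosted mulrA; congr (_ / _); rewrite big_distrr /=.
apply: eq_bigr => Q _.
rewrite (_ : [ffun x => _] = addpt [ffun x => f (graph_map Q x)] [ffun x => z (graph_map Q x)]).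
  by rewrite H ?code_graph_map // ffunE graph_map0.
by apply/ffunP => x; rewrite !ffunE.
Qed.

End Boosting.

(** * Binomial tails *)

Lemma partial_sum_full (n : nat) : partial_sum n n.+1 = (2 ^ n)%N.
Proof.
rewrite -[2%N]/(1 + 1)%N expnDn /partial_sum; apply: eq_bigr => i _.
by rewrite !exp1n !muln1.
Qed.

Lemma partial_sum_sym (n d : nat) : (d <= n.+1)%N ->
  (partial_sum n d + partial_sum n (n.+1 - d) = 2 ^ n)%N.
Proof.
move=> dn; rewrite -partial_sum_full /partial_sum -!(big_mkord xpredT (fun j => 'C(n, j))).
rewrite [RHS](big_cat_nat (n := d)) //=; congr (_ + _)%N.
rewrite [RHS]big_nat_rev /= -{2}(add0n d) big_addn; apply: eq_big_nat => i /andP[_ id].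
by rewrite -[LHS]bin_sub; [congr 'C(_, _); lia|lia].
Qed.

Lemma partial_sumS (n d : nat) : partial_sum n d.+1 = (partial_sum n d + 'C(n, d))%N.
Proof. by rewrite /partial_sum big_ord_recr. Qed.

Lemma partial_sum_step (n d : nat) :
  (partial_sum n.+1 d.+1 + 'C(n, d) = 2 * partial_sum n d.+1)%N.
Proof.
elim: d => [|d IH]; first by rewrite /partial_sum !big_ord_recr !big_ord0 /= !bin0.
by rewrite (partial_sumS _ d.+1) (partial_sumS n d.+1) mulnDr -IH binS; lia.
Qed.

Lemma partial_sum0 (n : nat) : partial_sum n 0 = 0%N.
Proof. by rewrite /partial_sum big_ord0. Qed.

Lemma bin_decr (n j : nat) : (n <= j.*2.+1)%N -> ('C(n, j.+1) <= 'C(n, j))%N.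
Proof.
move=> nj; rewrite -(leq_pmul2l (ltn0Sn j)) mul_bin_left leq_mul2r; apply/orP; right; lia.
Qed.

Lemma bin_central_max (p j : nat) : ('C(p.*2, j) <= 'C(p.*2, p))%N.
Proof.
have H i : ('C(p.*2, p + i) <= 'C(p.*2, p))%N.
  elim: i => [|i IH]; first by rewrite addn0.
  by rewrite addnS; apply: leq_trans IH; apply: bin_decr; lia.
have [pj|jp] := leqP p j; first by rewrite -(subnKC pj).
rewrite -bin_sub; last by lia.
by rewrite (_ : p.*2 - j = p + (p - j))%N //; lia.
Qed.

(** The factor 2p + 1 makes the induction close: the step multiplies the left side by 4 (2p + 1)(2p
    + 3) / (p + 1)^2, which is below 16. *)
Lemma bin_central_bound (p : nat) : ('C(p.*2, p) ^ 2 * p.*2.+1 <= 16 ^ p)%N.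
Proof.
elim: p => [|p IH]; first by rewrite bin0.
have E : ('C(p.+1.*2, p.+1) * p.+1 = 2 * (p.*2.+1 * 'C(p.*2, p)))%N.
  have h1 : (p.+1 * 'C(p.*2.+2, p.+1) = p.*2.+2 * 'C(p.*2.+1, p))%N by rewrite mul_bin_diag.
  have h2 : (p.+1 * 'C(p.*2.+1, p) = p.*2.+1 * 'C(p.*2, p))%N.
    rewrite -(bin_sub (m := p)) ; last by lia.
    by rewrite (_ : p.*2.+1 - p = p.+1)%N ?mul_bin_diag //; lia.
  rewrite doubleS mulnC h1 -h2; lia.
rewrite -(@leq_pmul2r (p.+1 ^ 2)) ?expn_gt0 // mulnAC -expnMn E.
rewrite (expnS 16) doubleS.
move: ('C(p.*2, p)) (16 ^ p)%N IH => c b; rewrite -!mulnn -!mul2n => IH; nia.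
Qed.

Lemma bin_sqr_bound (n j : nat) : ('C(n, j) ^ 2 * n <= 4 ^ n)%N.
Proof.
have even_case p i : ('C(p.*2, i) ^ 2 * p.*2.+1 <= 16 ^ p)%N.
  apply: leq_trans (bin_central_bound p); rewrite leq_mul2r leq_exp2r //.
  by rewrite bin_central_max orbT.
rewrite -(odd_double_half n); set p := n./2; case: (odd n); last first.
  rewrite add0n; apply: (@leq_trans ('C(p.*2, j) ^ 2 * p.*2.+1)).
    by rewrite leq_mul2l leqnSn orbT.
  by apply: leq_trans (even_case p j) _; rewrite -mul2n expnM.
rewrite add1n; apply: (@leq_trans ((2 * 'C(p.*2, p)) ^ 2 * p.*2.+1)).
  rewrite leq_mul2r leq_exp2r //; apply/orP; right.
  case: j => [|j]; last first.
    by rewrite binS mul2n -[X in (_ <= X)%N]addnn; apply: leq_add; apply: bin_central_max.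
  by rewrite bin0 muln_gt0 bin_gt0 /= -addnn leq_addr.
rewrite expnMn -mulnA (expnS 4) -[X in (4 ^ X)%N]mul2n (expnM 4).
by apply: leq_mul => //; apply: even_case.
Qed.

Section Tails.
Variable R : realType.

Lemma cosh_bound (y : R) : 0 <= y <= 1 / 2 ->
  expR y + expR (- y) <= 2 * expR (3 / 2 * y ^+ 2).
Proof.
move=> /andP[y0 y1].
have h1 : expR y <= 1 + y + 2 * y ^+ 2.
  have e : 1 - y <= expR (- y) by rewrite expR_ge1Dx.
  have p : 0 < expR y by exact: expR_gt0.
  have : (1 - y) * expR y <= 1.
    by apply: le_trans (ler_wpM2r (ltW p) e) _; rewrite -expRD addNr expR0.
  have : 1 <= (1 - y) * (1 + y + 2 * y ^+ 2).
    rewrite -subr_ge0 (_ : _ - _ = y ^+ 2 * (1 - 2 * y)); last by ring.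
    by rewrite mulr_ge0 ?sqr_ge0 //; lra.
  move=> a b; rewrite -(@ler_pM2l _ (1 - y)); lra.
have h2 : expR (- y) <= 1 - y + y ^+ 2.
  have e : 1 + y <= expR y by rewrite expR_ge1Dx.
  have p : 0 < expR (- y) by exact: expR_gt0.
  have : (1 + y) * expR (- y) <= 1.
    by apply: le_trans (ler_wpM2r (ltW p) e) _; rewrite -expRD addrN expR0.
  have : 1 <= (1 + y) * (1 - y + y ^+ 2).
    rewrite -subr_ge0 (_ : _ - _ = y ^+ 2 * y); last by ring.
    by rewrite mulr_ge0 ?sqr_ge0 //; lra.
  move=> a b; rewrite -(@ler_pM2l _ (1 + y)); lra.
have := expR_ge1Dx (3 / 2 * y ^+ 2); lra.
Qed.

Lemma partial_sum_markov (n d : nat) (l : R) : 0 <= l ->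
  (partial_sum n d)%:R <= expR (2 * l * d%:R - l * n%:R) * (expR l + expR (- l)) ^+ n.
Proof.
move=> l0.
have -> : expR (2 * l * d%:R - l * n%:R) * (expR l + expR (- l)) ^+ n =
   expR (2 * l * d%:R) * (1 + expR (- (2 * l))) ^+ n.
  rewrite expRD -mulrA; congr (_ * _).
  rewrite -mulrN mulrC (_ : l * - _ = n%:R * - l); last by ring.
  rewrite expRM_natl -exprMn; congr (_ ^+ _).
  rewrite mulrDl -!expRD addrN expR0; congr (_ + expR _); ring.
rewrite exprDn big_distrr natr_sum /=.
have T0 (i : nat) : 0 <= expR (2 * l * d%:R) *
    (1 ^+ (n - i) * expR (- (2 * l)) ^+ i *+ 'C(n, i)).
  by rewrite mulr_ge0 ?expR_ge0 // mulrn_wge0 // mulr_ge0 ?exprn_ge0 ?expR_ge0.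
rewrite -(big_mkord xpredT (fun i => 'C(n, i)%:R)).
rewrite -(big_mkord xpredT (fun i => expR (2 * l * d%:R) *
    (1 ^+ (n - i) * expR (- (2 * l)) ^+ i *+ 'C(n, i)))).
have term (i : nat) : (i < d)%N -> 'C(n, i)%:R <= expR (2 * l * d%:R) *
    (1 ^+ (n - i) * expR (- (2 * l)) ^+ i *+ 'C(n, i)).
  move=> id; rewrite expr1n mul1r -[_ ^+ _ *+ _]mulr_natr mulrA -[X in X <= _]mul1r.
  apply: ler_wpM2r => //; rewrite -expRM_natl -expRD -[X in X <= _]expR0 ler_expR.
  have : i%:R <= d%:R :> R by rewrite ler_nat ltnW.
  move: (i%:R) (d%:R) => a b ab; have : 0 <= 2 * l * (b - a) by rewrite mulr_ge0 ?mulr_ge0 // subr_ge0.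
  lra.
have [dn|nd] := leqP d n.+1.
  rewrite [X in _ <= X](big_cat_nat (n := d)) //=.
  apply: ler_wpDr; first by apply: sumr_ge0.
  by rewrite !big_mkord; apply: ler_sum => i _; apply: term.
rewrite (big_cat_nat (n := n.+1)) //=; last exact: ltnW.
rewrite [X in _ + X]big_nat_cond [X in _ + X]big1 ?addr0 => [|i /andP[/andP[ni _] _]].
  by rewrite !big_mkord; apply: ler_sum => i _; apply: term; apply: leq_trans (ltn_ord i) (ltnW nd).
by rewrite bin_small.
Qed.

Lemma chernoff (n d : nat) (v : R) : (0 < n)%N -> 0 <= v -> v <= n%:R / 2 ->
  d%:R <= n%:R / 2 - v ->
  (partial_sum n d)%:R <= 2 ^+ n * expR (- (v ^+ 2 / (2 * n%:R))).
Proof.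
move=> n0 v0 vn dv; have n0' : 0 < n%:R :> R by rewrite ltr0n.
(* With this tilt the exponent is at most - 2 l v + (3 / 4) l v, which is below - l v = - v^2 / (2
   n). *)
pose l := v / (2 * n%:R).
have l0 : 0 <= l by rewrite divr_ge0 // mulr_ge0.
have l1 : l <= 1 / 2 by rewrite ler_pdivrMr ?mulr_gt0 //; lra.
apply: le_trans (partial_sum_markov n d l0) _.
have c0 : 0 <= expR l + expR (- l) by rewrite addr_ge0 ?expR_ge0.
have hb : expR l + expR (- l) <= 2 * expR (3 / 2 * l ^+ 2).
  by apply: cosh_bound; rewrite l0.
apply: le_trans (ler_wpM2l (expR_ge0 _) (ler_pow n c0 hb)) _.
rewrite exprMn mulrCA; apply: ler_wpM2l; first exact: exprn_ge0.
rewrite -expRM_natl -expRD ler_expR.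
have nl : n%:R * l = v / 2 by rewrite /l; field; rewrite gt_eqF.
have -> : v ^+ 2 / (2 * n%:R) = l * v by rewrite /l; field; rewrite gt_eqF.
have -> : n%:R * (3 / 2 * l ^+ 2) = 3 / 2 * l * (n%:R * l) by ring.
rewrite nl.
have : 0 <= l * (n%:R / 2 - v - d%:R) by rewrite mulr_ge0 // subr_ge0.
have : 0 <= l * v by rewrite mulr_ge0.
have : l * n%:R = v / 2 by rewrite mulrC.
rewrite !mulrBr; lra.
Qed.

Lemma bin_le_sqrt (n j : nat) : (0 < n)%N ->
  'C(n, j)%:R <= 2 ^+ n / Num.sqrt n%:R :> R.
Proof.
move=> n0; have s0 : 0 < Num.sqrt n%:R :> R by rewrite sqrtr_gt0 ltr0n.
rewrite ler_pdivlMr // -(@ler_pXn2r _ 2) ?nnegrE ?mulr_ge0 ?exprn_ge0 ?sqrtr_ge0 //.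
rewrite exprMn sqr_sqrtr ?ler0n // -exprM mulnC exprM.
rewrite (_ : 2 ^+ 2 = 4%:R); last by ring.
by rewrite -!natrX -natrM ler_nat bin_sqr_bound.
Qed.

(** By [partial_sum_step] one more variable lowers the density by half a normalized binomial
    coefficient, and such a coefficient is at most 1 / sqrt n. *)
Lemma rate_shift (n k d : nat) : (0 < n)%N ->
  (partial_sum n d)%:R / 2 ^+ n <=
  (partial_sum (n + k) d)%:R / 2 ^+ (n + k) + k%:R / Num.sqrt n%:R :> R.
Proof.
move=> n0; have s0 : 0 < Num.sqrt n%:R :> R by rewrite sqrtr_gt0 ltr0n.
elim: k => [|k IH]; first by rewrite addn0 mul0r addr0.
apply: le_trans IH _; rewrite addnS -[k.+1%:R]natr1 mulrDl addrA mul1r addrAC lerD2r.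
have nk0 : (0 < n + k)%N by rewrite addn_gt0 n0.
case: d => [|d].
  by rewrite !partial_sum0 !mul0r add0r invr_ge0 ltW.
have p2 : 0 < 2 ^+ (n + k) :> R by rewrite exprn_gt0.
have := partial_sum_step (n + k) d => /(congr1 (fun x : nat => x%:R : R)).
rewrite natrD natrM => E.
have C1 : 'C(n + k, d)%:R / 2 ^+ (n + k) <= (Num.sqrt n%:R)^-1 :> R.
  rewrite ler_pdivrMr // mulrC; apply: le_trans (bin_le_sqrt d nk0) _.
  apply: ler_wpM2l; first exact: ltW.
  by rewrite lef_pV2 ?posrE ?sqrtr_gt0 ?ltr0n // ler_wsqrtr // ler_nat leq_addr.
have C0 : 0 <= 'C(n + k, d)%:R / 2 ^+ (n + k) :> R by rewrite divr_ge0 // ltW.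
have -> : (partial_sum (n + k) d.+1)%:R / 2 ^+ (n + k) =
   ((partial_sum (n + k).+1 d.+1)%:R + 'C(n + k, d)%:R) / 2 ^+ (n + k).+1 :> R.
  by rewrite E exprS; field; rewrite gt_eqF.
rewrite mulrDl lerD2l exprS.
have -> : 'C(n + k, d)%:R / (2 * 2 ^+ (n + k)) = 'C(n + k, d)%:R / 2 ^+ (n + k) / 2 :> R.
  by field; rewrite gt_eqF.
lra.
Qed.

(** If d were further above n / 2, the complementary tail would be at most expR (- 2 / eta) <= eta /
    2 of the cube by [chernoff], and the density would exceed 1 - eta. This dictates A = 2 / eta. *)
Lemma degree_bound (eta : R) : 0 < eta -> exists A : R, 0 <= A /\
  forall n d : nat, (0 < n)%N -> (partial_sum n d)%:R <= (1 - eta) * 2 ^+ n ->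
  d%:R <= n%:R / 2 + A * Num.sqrt n%:R + 1.
Proof.
move=> eta0; exists (2 / eta); split; first by rewrite divr_ge0 // ltW.
move=> n d n0 rate; have s0 : 0 < Num.sqrt n%:R :> R by rewrite sqrtr_gt0 ltr0n.
have n0' : 0 < n%:R :> R by rewrite ltr0n.
have p2 : 0 < 2 ^+ n :> R by rewrite exprn_gt0.
have sq : Num.sqrt n%:R * Num.sqrt n%:R = n%:R :> R by rewrite -expr2 sqr_sqrtr.
set A := 2 / eta; rewrite leNgt; apply/negP => dlt.
have A0 : 0 < A by rewrite divr_gt0.
have [dn|nd] := leqP d n.+1; last first.
  move: rate; rewrite /partial_sum -(big_mkord xpredT (fun j => 'C(n, j))).
  rewrite (big_cat_nat (n := n.+1)) //=; last exact: ltnW.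
  rewrite big_mkord -/(partial_sum n n.+1) partial_sum_full natrD natrX => H.
  have : (0 : R) <= (\sum_(n.+1 <= i < d) 'C(n, i))%:R by [].
  have : 0 < eta * 2 ^+ n by rewrite mulr_gt0.
  lra.
have := partial_sum_sym dn => /(congr1 (fun x : nat => x%:R : R)).
rewrite natrD natrX => E.
pose v : R := d%:R - 1 - n%:R / 2.
have v0 : A * Num.sqrt n%:R <= v by rewrite /v; lra.
have vpos : 0 <= v by apply: le_trans v0; rewrite mulr_ge0 // ltW.
have dE : (n.+1 - d)%:R = n%:R + 1 - d%:R :> R by rewrite natrB // -addn1 natrD.
have dn' : d%:R <= n%:R + 1 :> R by rewrite natr1 ler_nat.
have H : (partial_sum n (n.+1 - d))%:R <= 2 ^+ n * expR (- (v ^+ 2 / (2 * n%:R))).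
  apply: chernoff => //; rewrite /v ?dE; lra.
have eta1 : eta <= 1.
  have : 0 <= (1 - eta) * 2 ^+ n by apply: le_trans rate.
  by rewrite pmulr_lge0 // subr_ge0.
have ve : 2 / eta <= v ^+ 2 / (2 * n%:R).
  rewrite ler_pdivlMr ?mulr_gt0 // -sq.
  have -> : 2 / eta * (2 * (Num.sqrt n%:R * Num.sqrt n%:R)) =
     eta * (A * Num.sqrt n%:R) ^+ 2 by rewrite /A; field; rewrite gt_eqF.
  apply: (@le_trans _ _ ((A * Num.sqrt n%:R) ^+ 2)).
    by rewrite -[X in _ <= X]mul1r; apply: ler_wpM2r => //; apply: sqr_ge0.
  by apply: ler_pow => //; rewrite mulr_ge0 // ltW.
have ee : expR (- (v ^+ 2 / (2 * n%:R))) <= eta / 2.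
  apply: (@le_trans _ _ (expR (- (2 / eta)))); first by rewrite ler_expR lerN2.
  rewrite expRN -[X in _ <= X]invf_div lef_pV2 ?posrE ?expR_gt0 ?divr_gt0 //.
  by have := expR_ge1Dx (2 / eta); lra.
have : 2 ^+ n * expR (- (v ^+ 2 / (2 * n%:R))) <= 2 ^+ n * (eta / 2).
  by apply: ler_wpM2l => //; apply: ltW.
have : 0 < 2 ^+ n * eta by rewrite mulr_gt0.
move: rate; rewrite mulrBl mul1r; lra.
Qed.

End Tails.

(** * Maximum likelihood decoding *)

Section MaximumLikelihood.
Variables (R : realType) (eps : R).
Hypotheses (eps_gt0 : 0 < eps) (eps_lt : eps < 1 / 2).
Local Notation E := (expec (nu eps)).

(** Ties count as bad, since they may be broken against [f]. The radius [W] is there because a list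
    of radius T that contains [f] has no word farther than 2 T from [f]. *)
Definition ml_bad (M d : nat) (W : R) (f g : word M) : bool :=
  [exists c in code M d,
     [&& c != f, (dH c f)%:R <= W & (agree f g <= agree c g)%N]].

Definition ml_rate : R := 1 / 2 + 2 * eps * (1 - eps).

Definition ml_sum (M d : nat) (W : R) : R :=
  \sum_(c in code M d | (c != zero_word M) && ((weight c)%:R <= W)) ml_rate ^+ weight c.

Lemma ml_rate_gt0 : 0 < ml_rate.
Proof.
rewrite addr_gt0 // !mulr_gt0 //; by move: eps_lt => ?; lra.
Qed.

Lemma ml_rate_lt1 : ml_rate < 1.
Proof. by rewrite /ml_rate; move: eps_lt eps_gt0 => ? ?; nra. Qed.

Lemma dH_weight (M : nat) (c f : word M) : dH c f = weight (addpt c f).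
Proof.
by apply: eq_card => x; rewrite !inE ffunE; case: (c x); case: (f x).
Qed.

(* [\prod_(x in D) (a or a^-1)] with [a = (2 eps)^-1] exceeds 1 as soon as half
   of [D] is flipped, and each factor has mean [ml_rate]. *)
Lemma half_flipped (X : finType) (D : {set X}) :
  E (fun z => (#|[set x in D | ~~ z x]| <= #|[set x in D | z x]|)%N%:R) <= ml_rate ^+ #|D|.
Proof.
pose a : R := (2 * eps)^-1.
have a0 : 0 < a by rewrite invr_gt0 mulr_gt0.
have a1 : 1 <= a.
  by rewrite invf_ge1 ?mulr_gt0 //; move: eps_lt => ?; lra.
pose F (z : {ffun X -> bool}) : R := \prod_(x in D) (if z x then a else a^-1).
have FE z : F z = a ^+ #|[set x in D | z x]| / a ^+ #|[set x in D | ~~ z x]|.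
  rewrite /F (bigID z) /= -[X in _ / _ ^+ X]sum1_card -[X in _ ^+ X / _]sum1_card.
  rewrite -!prodrXr -prodfV; congr (_ * _).
    rewrite [RHS](eq_bigl (fun x => (x \in D) && z x)); last by move=> x; rewrite inE.
    by apply: eq_bigr => x /andP[_ ->].
  rewrite [RHS](eq_bigl (fun x => (x \in D) && ~~ z x)); last by move=> x; rewrite inE.
  by apply: eq_bigr => x /andP[_ /negbTE ->].
have -> : ml_rate ^+ #|D| = E F.
  rewrite /F (expec_prod (nu1 eps) (mem D) (fun _ b => if b then a else a^-1)).
  rewrite -prodr_const; apply: eq_bigr => x _; rewrite /ml_rate /nu /a.
  by field; rewrite gt_eqF.
apply: (ler_expec (nu_gt0 eps_gt0 eps_lt)) => z; rewrite FE.
case: leqP => [H|_] /=; last by rewrite divr_ge0 // exprn_ge0 // ltW.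
by rewrite ler_pdivlMr ?exprn_gt0 // mul1r ler_weXn2l.
Qed.

Lemma ml_error (M d : nat) (W : R) (f : word M) : f \in code M d ->
  \sum_g chan eps f g * (ml_bad d W f g)%:R <= ml_sum M d W.
Proof.
move=> fd; rewrite sum_chan /ml_sum.
have addf c : (addpt f c \in code M d) = (c \in code M d).
  by apply/idP/idP => [H|]; [rewrite -(addptKl f c); exact: codeD|exact: codeD].
apply: (@le_trans _ _ (\sum_(c in code M d | (c != zero_word M) && ((weight c)%:R <= W))
    E (fun z => (#|[set x in [set x | c x] | ~~ z x]| <= #|[set x in [set x | c x] | z x]|)%N%:R))).
  rewrite -expec_sum; apply: (ler_expec (nu_gt0 eps_gt0 eps_lt)) => z.
  case: (boolP (ml_bad d W f (addpt f z))) => [|_] /=; last by apply: sumr_ge0.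
  move=> /existsP[c /and4P[cd cf cW ag]].
  have c0 : addpt f c != zero_word M.
    apply: contra cf => /eqP H; rewrite -(addptKl f c) H; apply/eqP/ffunP => x.
    by rewrite !ffunE addbF.
  have wc : weight (addpt f c) = dH c f by rewrite dH_weight addptC.
  rewrite (bigD1 (addpt f c)) /=; last by rewrite addf cd c0 wc cW.
  apply: ler_wpDr; first by apply: sumr_ge0.
  suff -> : (#|[set x in [set x | addpt f c x] | ~~ z x]| <=
             #|[set x in [set x | addpt f c x] | z x]|)%N by [].
  (* Agreements off the support of the difference are shared by [f] and its competitor; subtracting
     them leaves a comparison of unflipped with flipped bits on the support. *)
  pose common := #|[set x | ~~ addpt f c x && ~~ z x]|.
  have -> : #|[set x in [set x | addpt f c x] | ~~ z x]| = (agree f (addpt f z) - common)%N.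
    rewrite /agree -(cardsID [set x | addpt f c x] [set x | f x == addpt f z x]).
    rewrite addnC [X in (X + _ - _)%N](_ : _ = common) ?addKn.
      by apply: eq_card => x; rewrite !inE !ffunE; case: (f x); case: (c x); case: (z x).
    by apply: eq_card => x; rewrite !inE !ffunE; case: (f x); case: (c x); case: (z x).
  have -> : #|[set x in [set x | addpt f c x] | z x]| = (agree c (addpt f z) - common)%N.
    rewrite /agree -(cardsID [set x | addpt f c x] [set x | c x == addpt f z x]).
    rewrite addnC [X in (X + _ - _)%N](_ : _ = common) ?addKn.
      by apply: eq_card => x; rewrite !inE !ffunE; case: (f x); case: (c x); case: (z x).
    by apply: eq_card => x; rewrite !inE !ffunE; case: (f x); case: (c x); case: (z x).
  exact: leq_sub2r.
by apply: ler_sum => c _; apply: half_flipped.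
Qed.

End MaximumLikelihood.

(** * Randomized choices and list decoding *)

Section Choice.
Variable R : realType.

Lemma choiceP_ge0 (a b : R) : 0 <= choiceP a b.
Proof. by rewrite /choiceP; case: ifP => // _; case: ifP. Qed.

Lemma choiceP_sum1 (a b : R) : choiceP a b + choiceP b a = 1.
Proof.
rewrite /choiceP; case: (ltgtP a b) => _; rewrite ?add0r ?addr0 //.
by rewrite -mulrDl divff.
Qed.

(** With a and b the likelihoods of the two bit values, the left side is the error weight of
    guessing the likelier one; an evenly split tie also gives the minimum. *)
Lemma choiceP_min (a b : R) : 0 <= a -> 0 <= b ->
  a * choiceP b a + b * choiceP a b <= Num.min a b.
Proof.
move=> a0 b0; rewrite /choiceP; case: (ltgtP a b) => [ab|ab|->];
  rewrite ?mulr0 ?mulr1 ?add0r ?addr0 //.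
by rewrite -mulrDr -mulrDl divff // mulr1.
Qed.

Section Weights.
Variables (X : finType) (w : X -> bool -> R).
Hypothesis w1 : forall x, w x true + w x false = 1.

Lemma sum_prod_weights : \sum_(h : {ffun X -> bool}) \prod_x w x (h x) = 1.
Proof.
rewrite -(bigA_distr_bigA (fun x b => w x b)) big1 // => x _.
by rewrite big_bool /= w1.
Qed.

Lemma sum_prod_weights_at (x0 : X) (b : bool) :
  \sum_(h : {ffun X -> bool}) (\prod_x w x (h x)) * (h x0 == b)%:R = w x0 b.
Proof.
transitivity (\sum_(h : {ffun X -> bool})
    \prod_x (w x (h x) * (if x == x0 then (h x == b)%:R else 1))).
  apply: eq_bigr => h _; rewrite big_split /=; congr (_ * _).
  rewrite -big_mkcond (big_pred1 x0) // => x; by rewrite /= eq_sym.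
rewrite -(bigA_distr_bigA (fun x b' => w x b' * (if x == x0 then (b' == b)%:R else 1))).
rewrite (bigD1 x0) //= [X in _ * X]big1 => [|x xx0].
  by rewrite big_bool /= eqxx; case: b; rewrite /= ?mulr1 ?mulr0 ?addr0 ?add0r.
by rewrite big_bool /= (negbTE xx0) !mulr1 w1.
Qed.
End Weights.

Lemma argmax_unif_ge0 (M : nat) (l : {set word M}) (g out : word M) :
  0 <= argmax_unif R l g out.
Proof. by rewrite /argmax_unif; case: ifP. Qed.

Lemma argmax_unif_sum1 (M : nat) (l : {set word M}) (g : word M) :
  l != finset.set0 -> \sum_out argmax_unif R l g out = 1.
Proof.
move=> /finset.set0Pn[c cl]; rewrite /argmax_unif -big_mkcond /=.
set A := [set c in l | _].
have A0 : (0 < #|A|)%N.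
  case: (arg_maxnP (fun c' => agree c' g) cl) => c0 c0l H.
  apply/card_gt0P; exists c0; rewrite inE (_ : c0 \in l) //; apply/forallP => c'.
  by apply/implyP => /H.
by rewrite sumr_const -[_ *+ _]mulr_natl mul1r divff // pnatr_eq0 -lt0n.
Qed.

Lemma argmax_unif_eq1 (M : nat) (l : {set word M}) (g f : word M) :
  f \in l -> (forall c, c \in l -> c != f -> (agree c g < agree f g)%N) ->
  argmax_unif R l g f = 1.
Proof.
move=> fl H; rewrite /argmax_unif; set A := [set c in l | _].
have -> : A = [set f].
  apply/setP => c; rewrite !inE; apply/andP/eqP => [[cl /forallP/(_ f)]|->].
    rewrite fl /= => fc; apply/eqP; apply: contraLR fc => cf.
    by rewrite -ltnNge; apply: H.
  split=> //; apply/forallP => c1; apply/implyP => cl.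
  by have [->|cf] := eqVneq c1 f => //; apply/ltnW/H.
by rewrite inE eqxx cards1 invr1 mulr1.
Qed.

Lemma dH_triangle (M : nat) (c f h : word M) : (dH c f <= dH c h + dH f h)%N.
Proof.
rewrite /dH; apply: leq_trans (leq_card_setU _ _).
apply/subset_leq_card/fintype.subsetP => x; rewrite !inE.
by case: (c x); case: (f x); case: (h x).
Qed.

Lemma argmax_unif_fail (M d : nat) (T : R) (l : {set word M}) (f g h : word M) :
  l = [set c in code M d | (dH c h)%:R <= T] -> f \in code M d ->
  1 - argmax_unif R l g f <= (T < (dH f h)%:R)%R%:R + (ml_bad d (2 * T) f g)%:R.
Proof.
move=> lE fd; have a0 := argmax_unif_ge0 l g f.
have b0 : 0 <= (ml_bad d (2 * T) f g)%:R :> R by [].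
have [Tf|fT] := ltP T (dH f h)%:R; first by rewrite /=; lra.
case: (boolP (ml_bad _ _ _ _)) => [_|ok] /=; first by lra.
rewrite argmax_unif_eq1 ?subrr ?addr0 //; first by rewrite lE inE fd.
move=> c; rewrite lE inE => /andP[cd cT] cf; rewrite ltnNge.
apply: contra ok => ag; apply/existsP; exists c; rewrite cd cf ag andbT /=.
have := dH_triangle c f h; rewrite -(ler_nat R) natrD => /le_trans; apply.
by rewrite mulr_natl mulr2n lerD.
Qed.

End Choice.

(** * Optimality of the bitwise likelihood rule *)

Section BitMAP.
Variables (R : realType) (eps : R).
Hypotheses (eps_gt0 : 0 < eps) (eps_lt : eps < 1 / 2).
Local Notation E := (expec (nu eps)).
Variables (M d : nat).

Definition likelihood (g : word M) (b : bool) (x : pt M) : R :=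
  \sum_(c in code M d | c x == b) chan eps c g.

Definition bit_error (f : word M) (x : pt M) : R :=
  \sum_g chan eps f g * choiceP (likelihood g (~~ f x) x) (likelihood g (f x) x).

Let addf_in (f c : word M) : f \in code M d -> (addpt f c \in code M d) = (c \in code M d).
Proof.
by move=> fd; apply/idP/idP => [H|]; [rewrite -(addptKl f c); exact: codeD|exact: codeD].
Qed.

Let likelihood_add f z b x : f \in code M d ->
  likelihood (addpt f z) (b (+) f x) x = likelihood z b x.
Proof.
move=> fd; rewrite /likelihood (reindex_inj (inv_inj (addptKl f))) /=.
apply: eq_big => [c|c _].
  by rewrite addf_in // ffunE; case: (f x); case: (c x); case: b.
rewrite !chanE; congr (wt_prod _ _).
by apply/ffunP => y; rewrite !ffunE; case: (f y); case: (c y); case: (z y).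
Qed.

Let bit_error_zero f x : f \in code M d ->
  bit_error f x = E (fun z => choiceP (likelihood z true x) (likelihood z false x)).
Proof.
move=> fd; rewrite /bit_error.
rewrite (sum_chan _ f (fun g => choiceP (likelihood g (~~ f x) x) (likelihood g (f x) x))).
apply: eq_expec => z.
by rewrite -(likelihood_add z true x fd) -(likelihood_add z false x fd).
Qed.

(** On average over codewords the likelihood rule at [x] is at least as good as any other, in
    particular as the sign of [S] after translating [x] to the origin. Linearity of the code makes
    the error the same for every codeword, which removes the average. *)
Lemma bit_error_le (S : word M -> R) :
  (forall f z, f \in code M d ->
     S (addpt f z) = (if f [ffun => false] then -1 else 1) * S z) ->
  forall f x, f \in code M d -> bit_error f x <= E (fun z => (S z <= 0)%R%:R).
Proof.
move=> Sadd f0 x f0d; set p := E _.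
pose C := code M d.
have C0 : 0 < #|C|%:R :> R by rewrite ltr0n; apply/card_gt0P; exists f0.
pose h (g : word M) : bool := S [ffun u => g (addpt u x)] < 0.
rewrite -(ler_pM2l C0) !mulr_natl -!sumr_const.
rewrite (eq_bigr (fun f => bit_error f x)); last by move=> f fC; rewrite !bit_error_zero.
have chan0 f g : 0 <= chan eps f g by apply/ltW/chan_gt0.
have L0 g b : 0 <= likelihood g b x by apply: sumr_ge0.
have splitL (g : word M) (G : bool -> R) :
    \sum_(f in C) chan eps f g * G (f x) = likelihood g true x * G true + likelihood g false x * G false.
  rewrite (bigID (fun f : word M => f x == true)) /= /likelihood !big_distrl /=.
  congr (_ + _); first by apply: eq_bigr => f /andP[_ /eqP ->].
  rewrite (eq_bigl (fun c => (c \in code M d) && (c x == false))); last by move=> c; case: (c x).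
  by apply: eq_bigr => f /andP[_ /eqP ->].
apply: (@le_trans _ _ (\sum_(f in C) \sum_g chan eps f g * (h g != f x)%:R)).
  rewrite /bit_error exchange_big [X in _ <= X]exchange_big /=; apply: ler_sum => g _.
  rewrite (splitL g (fun b => choiceP (likelihood g (~~ b) x) (likelihood g b x))).
  rewrite (splitL g (fun b => (h g != b)%:R)) /=.
  apply: le_trans (choiceP_min (L0 g true) (L0 g false)) _.
  by case: (h g); rewrite /= ?mulr0 ?mulr1 ?add0r ?addr0 ge_min lexx ?orbT.
apply: ler_sum => f fC; rewrite (sum_chan _ f (fun g => (h g != f x)%:R)).
apply: (@le_trans _ _ (E (fun z => (S [ffun u => z (addpt u x)] <= 0)%R%:R))); last first.
  rewrite -[X in _ <= X](expec_perm (nu1 eps) (h := fun u => addpt u x)); last first.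
    exact: (inv_inj (addptK x)).
  by [].
apply: (ler_expec (nu_gt0 eps_gt0 eps_lt)) => z.
rewrite /h (_ : [ffun u => addpt f z (addpt u x)] =
   addpt [ffun u => f (addpt u x)] [ffun u => z (addpt u x)]); last first.
  by apply/ffunP => u; rewrite !ffunE.
rewrite Sadd ?code_shift // ffunE (_ : addpt _ x = x); last first.
  by apply/ffunP => i; rewrite !ffunE.
set s := S _; case: (f x); rewrite ?mulN1r ?mul1r ?oppr_lt0 ler_nat.
  by case: (ltgtP s 0).
by case: (ltgtP s 0).
Qed.

End BitMAP.

(** * Failure probability of [RMRec] for a fixed codeword *)

Section RMRecAnalysis.
Variables (R : realType) (eps : R).
Hypotheses (eps_gt0 : 0 < eps) (eps_lt : eps < 1 / 2).
Variables (M r : nat) (c' : R).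
Let T : R := 2 `^ (M%:R - c' * Num.sqrt (M%:R) * log2 (M%:R) / 2) / 2.

Let T0 : 0 < T. Proof. by rewrite divr_gt0 // powR_gt0. Qed.

Let guess (g h : word M) : R :=
  \prod_x choiceP (likelihood eps r.+1 g (h x) x) (likelihood eps r.+1 g (~~ h x) x).

Let guess_weights (g : word M) (x : pt M) (b : bool) : R :=
  choiceP (likelihood eps r.+1 g b x) (likelihood eps r.+1 g (~~ b) x).

Let guess_weights1 g x : guess_weights g x true + guess_weights g x false = 1.
Proof. exact: choiceP_sum1. Qed.

Let guess_ge0 g h : 0 <= guess g h.
Proof. by apply: prodr_ge0 => x _; apply: choiceP_ge0. Qed.

Let guess_sum1 g : \sum_h guess g h = 1.
Proof. exact: (sum_prod_weights (guess_weights1 g)). Qed.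

Let final (g h out : word M) : R :=
  let l := [set c in code M r.+1 | (dH c h)%:R <= T] in
  if #|l| == 0%N then (out == zero_word M)%:R else argmax_unif R l g out.

Let RMRecE g out : RMRec_prob r eps g c' out = \sum_h guess g h * final g h out.
Proof. by rewrite /RMRec_prob /guess /final /likelihood -/T RM_code. Qed.

Let final_ge0 g h out : 0 <= final g h out.
Proof. by rewrite /final; case: ifP => // _; apply: argmax_unif_ge0. Qed.

Lemma RMRec_ge0 (g out : word M) : 0 <= RMRec_prob r eps g c' out.
Proof. by rewrite RMRecE; apply: sumr_ge0 => h _; apply: mulr_ge0. Qed.

Lemma RMRec_sum1 (g : word M) : \sum_out RMRec_prob r eps g c' out = 1.
Proof.
under eq_bigr => out _ do rewrite RMRecE.
rewrite exchange_big /= -[RHS](guess_sum1 g); apply: eq_bigr => h _.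
rewrite -big_distrr /= (_ : \sum_out _ = 1) ?mulr1 // /final /=.
have [_|l0] := eqVneq #|_| 0%N.
  by rewrite (bigD1 (zero_word M)) //= eqxx big1 ?addr0 // => o /negbTE ->.
by apply: argmax_unif_sum1; rewrite -cards_eq0.
Qed.

(** The guess has at most 2^M p wrong bits on average, so by Markov's inequality [f] misses the list
    with probability at most 2^M p / T. If it is on the list, every other candidate is within 2 T of
    it. *)
Lemma RMRec_fail (p : R) (f : word M) :
  (forall x, bit_error eps r.+1 f x <= p) -> f \in code M r.+1 ->
  \sum_g chan eps f g * (1 - RMRec_prob r eps g c' f) <=
  2 ^+ M * p / T + ml_sum eps M r.+1 (2 * T).
Proof.
move=> Hp fd; have chan0 g : 0 <= chan eps f g by apply/ltW/chan_gt0.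
have final_fail g h : 1 - final g h f <=
    (T < (dH f h)%:R)%R%:R + (ml_bad r.+1 (2 * T) f g)%:R.
  rewrite /final /=; case: ifP => [/eqP l0|_]; last exact: argmax_unif_fail.
  (* An empty list misses [f], so whatever the default output is, the failure is already charged to
     the first term. *)
  have -> : T < (dH f h)%:R.
    rewrite ltNge; apply/negP => fT; move/eqP: l0; rewrite cards_eq0 => /eqP/setP/(_ f).
    by rewrite !inE fd fT.
  by have : 0 <= (ml_bad r.+1 (2 * T) f g)%:R :> R by []; case: (f == _) => /=; lra.
apply: (@le_trans _ _ (\sum_g chan eps f g *
   ((\sum_x choiceP (likelihood eps r.+1 g (~~ f x) x) (likelihood eps r.+1 g (f x) x)) / T +
    (ml_bad r.+1 (2 * T) f g)%:R))).
  apply: ler_sum => g _; apply: ler_wpM2l => //.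
  have -> : 1 - RMRec_prob r eps g c' f = \sum_h guess g h * (1 - final g h f).
    rewrite RMRecE -{1}(guess_sum1 g) -sumrB; apply: eq_bigr => h _.
    by rewrite mulrBr mulr1.
  apply: (@le_trans _ _ (\sum_h guess g h *
     ((\sum_x (h x == ~~ f x)%:R) / T + (ml_bad r.+1 (2 * T) f g)%:R))).
    apply: ler_sum => h _; apply: ler_wpM2l => //; apply: le_trans (final_fail g h) _.
    rewrite lerD2r; have -> : \sum_x (h x == ~~ f x)%:R = (dH f h)%:R :> R.
      rewrite -natr_sum; congr _%:R; rewrite /dH -sum1_card [RHS]big_mkcond.
      by apply: eq_bigr => x _; rewrite inE; case: (h x); case: (f x).
    case: ltP => [H|_] /=; last by rewrite divr_ge0 // ltW.
    by rewrite ler_pdivlMr // mul1r ltW.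
  under eq_bigr => h _ do rewrite mulrDr mulrA.
  rewrite big_split /= -!big_distrl /= guess_sum1 mul1r lerD2r.
  rewrite le_eqVlt; apply/orP; left; apply/eqP; congr (_ / _).
  under eq_bigr => h _ do rewrite big_distrr /=.
  rewrite exchange_big /=; apply: eq_bigr => x _.
  by rewrite (sum_prod_weights_at (guess_weights1 g) x (~~ f x)) /guess_weights negbK.
under eq_bigr => g _ do rewrite mulrDr.
rewrite big_split /=; apply: lerD; last exact: ml_error.
under eq_bigr => g _ do rewrite mulrA.
rewrite -big_distrl /=; apply: ler_wpM2r; first by rewrite invr_ge0 ltW.
under eq_bigr => g _ do rewrite big_distrr /=.
rewrite exchange_big /= -natrX -card_pt mulr_natl -sumr_const; apply: ler_sum => x _.
exact: Hp.
Qed.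

End RMRecAnalysis.

(** * Independence across coordinate blocks *)

Lemma card_sets_of_ord (m : nat) (S : {set 'I_m}) : (#|S| + #|~: S| = m)%N.
Proof. by rewrite cardsC card_ord. Qed.

Section Subcubes.
Variables (m : nat) (S : {set 'I_m}).
Local Notation n := #|~: S|.

Lemma embed_in (x : pt m) (z : pt n) (i : 'I_m) : i \in S -> embed x z i = x i.
Proof.
move=> iS; rewrite ffunE; case: pickP => // j /eqP ij.
by have := enum_valP j; rewrite ij inE iS.
Qed.

Lemma embed_val (x : pt m) (z : pt n) (j : 'I_n) : embed x z (enum_val j) = z j.
Proof.
rewrite ffunE; case: pickP => [j' /eqP/enum_val_inj -> //|/(_ j)].
by rewrite eqxx.
Qed.

Lemma outside_val (i : 'I_m) : i \notin S -> exists j : 'I_n, i = enum_val j.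
Proof.
move=> iS; have iC : i \in ~: S by rewrite inE.
by exists (enum_rank_in iC i); rewrite enum_rankK_in.
Qed.

Lemma embed_inj (x : pt m) : injective (fun z : pt n => embed x z).
Proof.
move=> z z' H; apply/ffunP => j.
by rewrite -(embed_val x z) H embed_val.
Qed.

Lemma mem_reps (x : pt m) : (x \in reps S) = (rep S x == x).
Proof. by rewrite inE. Qed.

Lemma rep_in_reps (y : pt m) : rep S y \in reps S.
Proof. by rewrite inE; apply/eqP/ffunP => i; rewrite !ffunE; case: (i \in S). Qed.

Lemma rep_embed (x : pt m) (z : pt n) : x \in reps S -> rep S (embed x z) = x.
Proof.
rewrite mem_reps => /eqP xr; apply/ffunP => i; rewrite -[in RHS]xr [LHS]ffunE [RHS]ffunE.
by have [iS|iS] := boolP (i \in S) => //=; rewrite embed_in.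
Qed.

Lemma embed_rep (y : pt m) : embed (rep S y) [ffun j : 'I_n => y (enum_val j)] = y.
Proof.
apply/ffunP => i; have [iS|/outside_val[j ->]] := boolP (i \in S).
  by rewrite embed_in // ffunE iS.
by rewrite embed_val ffunE.
Qed.

Definition cube (x : pt m) : {set pt m} := [set y | rep S y == x].

Lemma cubeE (x : pt m) : x \in reps S -> cube x = [set embed x z | z : pt n].
Proof.
move=> xr; apply/setP => y; rewrite inE; apply/eqP/imsetP => [<-|[z _ ->]].
  by exists [ffun j : 'I_n => y (enum_val j)]; rewrite ?embed_rep.
exact: rep_embed.
Qed.

Lemma card_cube (x : pt m) : x \in reps S -> #|cube x| = (2 ^ n)%N.
Proof.
move=> xr; rewrite cubeE // card_imset; last exact: embed_inj.
by rewrite -card_pt; apply: eq_card => z; rewrite !inE.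
Qed.

Lemma sum_rep (V : nmodType) (F : pt m -> V) :
  \sum_y F (rep S y) = \sum_(x in reps S) F x *+ 2 ^ n.
Proof.
rewrite (partition_big (rep S) (mem (reps S))) /=; last by move=> y _; apply: rep_in_reps.
apply: eq_bigr => x xr; rewrite -(card_cube xr) -sumr_const.
by apply: eq_big => [y|y /eqP ->//]; rewrite inE.
Qed.

Lemma card_reps : #|reps S| = (2 ^ #|S|)%N.
Proof.
have := sum_rep (fun _ => 1%N); rewrite sum1_card card_pt sumrMnl sum1_card.
rewrite -{1}(card_sets_of_ord S) expnD -mulr_natr natn => /eqP.
by rewrite eqn_pmul2r ?expn_gt0 // => /eqP.
Qed.

Lemma code_restrict (d : nat) (f : word m) (x : pt m) :
  f \in code m d -> Defs.restrict S f x \in code n d.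
Proof.
apply: code_comp => i; have [iS|/outside_val[j ->]] := boolP (i \in S).
  rewrite (_ : [ffun _ => _] = [ffun => x i]) ?code_cst //.
  by apply/ffunP => z; rewrite ffunE embed_in // ffunE.
rewrite (_ : [ffun _ => _] = [ffun z : pt n => z j]) ?code_coord //.
by apply/ffunP => z; rewrite ffunE embed_val ffunE.
Qed.

Lemma restrict_add (f z : word m) (x : pt m) :
  Defs.restrict S (addpt f z) x = addpt (Defs.restrict S f x) (Defs.restrict S z x).
Proof. by apply/ffunP => y; rewrite !ffunE. Qed.

Variable R : realType.

(** Cubes through distinct representatives are disjoint, hence independent, and [embed] makes each
    of them a copy of the smaller space. *)
Lemma expec_subcubes (w : bool -> R) (G : pt m -> word n -> R) :
  w true + w false = 1 ->
  expec w (fun z : word m => \prod_(x in reps S) G x (Defs.restrict S z x)) =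
  \prod_(x in reps S) expec w (G x).
Proof.
move=> w1; rewrite (expec_indep_family w1 (B := cube)).
- by apply: eq_bigr => x _; apply: (expec_comp_inj w1); apply: embed_inj.
- move=> x x' xr x'r xx'; rewrite finset.disjoints_subset.
  apply/fintype.subsetP => y; rewrite !inE => /eqP ->.
  by apply: contraNneq xx' => ->.
move=> x xr z z' zz'; congr (G x _); apply/ffunP => y; rewrite !ffunE.
by apply: zz'; rewrite cubeE // imset_f.
Qed.

Lemma sum_chan_subcubes (eps : R) (f : word m) (G : pt m -> word n -> R) :
  \sum_ft chan eps f ft * \prod_(x in reps S) G x (Defs.restrict S ft x) =
  \prod_(x in reps S) \sum_g chan eps (Defs.restrict S f x) g * G x g.
Proof.
rewrite (sum_chan _ f (fun ft => \prod_(x in reps S) G x (Defs.restrict S ft x))).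
under [RHS]eq_bigr => x _ do rewrite sum_chan.
rewrite -(expec_subcubes (fun x g => G x (addpt (Defs.restrict S f x) g)) (nu1 eps)).
by apply: eq_expec => z; apply: eq_bigr => x _; rewrite restrict_add.
Qed.

Let half (b : bool) : R := 1 / 2.

Let half1 : half true + half false = 1.
Proof. by rewrite /half -mulrDl divff. Qed.

(** Through the uniform measure, the independence lemmas also factor plain sums, both over words and
    over points of the cube. *)
Lemma sum_expec_half (X : finType) (F : {ffun X -> bool} -> R) :
  \sum_z F z = 2 ^+ #|X| * expec half F.
Proof.
rewrite /expec big_distrr /=; apply: eq_bigr => z _.
by rewrite /wt_prod prodr_const mulrA /half -exprMn [2 * _]mulrC divfK // expr1n mul1r.
Qed.

Lemma sum_words_subcubes (G : pt m -> word n -> R) :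
  \sum_(W : word m) \prod_(x in reps S) G x (Defs.restrict S W x) =
  \prod_(x in reps S) \sum_g G x g.
Proof.
rewrite sum_expec_half (expec_subcubes _ half1).
under [RHS]eq_bigr => x _ do rewrite sum_expec_half.
rewrite big_split /= prodr_const; congr (_ * _).
by rewrite card_reps !card_pt -exprM mulnC -expnD card_sets_of_ord.
Qed.

End Subcubes.

(** * Failure probability of [RMRec2] for a fixed codeword *)

Section RMRec2Analysis.
Variables (R : realType) (eps : R).
Hypotheses (eps_gt0 : 0 < eps) (eps_lt : eps < 1 / 2).
Variables (m r : nat) (c c' : R).
Let mp := mprime m c.
Let S (j : 'I_mp) : {set 'I_m} := Spart m j.
Variables (f : word m) (q : R) (tau : nat).
Hypothesis f_code : f \in code m r.+1.
Hypothesis q_fail : forall (j : 'I_mp) (h : word #|~: S j|), h \in code #|~: S j| r.+1 ->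
  \sum_g chan eps h g * (1 - RMRec_prob r eps g c' h) <= q.
Hypothesis q_small : q * expR 2 * 4 ^+ tau <= 1.

Let T : R := 2 `^ (m%:R - Num.sqrt (m%:R) * log2 (m%:R)) / 2.

Let fails (j : 'I_mp) (W : word m) : {set pt m} :=
  [set x in reps (S j) | Defs.restrict (S j) W x != Defs.restrict (S j) f x].

Let bad (j : 'I_mp) (W : word m) : bool :=
  (2 ^ #|S j| < #|fails j W| * 4 ^ tau)%N.

Let PW (ft : word m) (j : 'I_mp) (W : word m) : R :=
  \prod_(x in reps (S j))
    RMRec_prob r eps (Defs.restrict (S j) ft x) c' (Defs.restrict (S j) W x).

Let PW_ge0 ft j W : 0 <= PW ft j W.
Proof. by apply: prodr_ge0 => x _; apply: RMRec_ge0. Qed.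

Let PW_sum1 ft j : \sum_W PW ft j W = 1.
Proof.
rewrite /PW (sum_words_subcubes (fun x g => RMRec_prob r eps (Defs.restrict (S j) ft x) c' g)).
by rewrite big1 // => x _; apply: RMRec_sum1.
Qed.

Let chan_ge0 M (h g : word M) : 0 <= chan eps h g.
Proof. exact/ltW/chan_gt0. Qed.

(** Chernoff bound with weight e^2 per failed subcube: the subcubes are disjoint, so the mean
    factors, and by [q_small] each factor is at most 1 + e^2 q <= expR (4^-tau). The product expR D
    meets the threshold expR (2 D), where D = 2^|S j| / 4^tau. *)
Let bad_prob (j : 'I_mp) :
  \sum_ft chan eps f ft * \sum_W PW ft j W * (bad j W)%:R <=
  expR (- (2 ^+ #|S j| / 4 ^+ tau)).
Proof.
set D : R := 2 ^+ #|S j| / 4 ^+ tau.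
have t0 : 0 < 4 ^+ tau :> R by rewrite exprn_gt0.
pose e2 : R := expR 2.
have e2_ge1 : 1 <= e2 by rewrite -expR0 ler_expR.
pose G (x : pt m) (w : word #|~: S j|) : R :=
  if w != Defs.restrict (S j) f x then e2 else 1.
have indic W : (bad j W)%:R <= expR (- (2 * D)) * \prod_(x in reps (S j)) G x (Defs.restrict (S j) W x).
  have -> : \prod_(x in reps (S j)) G x (Defs.restrict (S j) W x) = e2 ^+ #|fails j W|.
    rewrite -prodr_const /fails [RHS]big_mkcond [LHS]big_mkcond; apply: eq_bigr => x _.
    by rewrite inE /G; case: (x \in reps _); case: (_ != _).
  have [b|_] := boolP (bad j W); last by rewrite mulr_ge0 ?expR_ge0 // exprn_ge0 // expR_ge0.
  rewrite /e2 -expRM_natl -expRD -[X in X <= _]expR0 ler_expR.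
  have : D <= #|fails j W|%:R.
    by rewrite ler_pdivrMr // -!natrX -natrM ler_nat ltnW.
  lra.
apply: (@le_trans _ _ (\sum_ft chan eps f ft * (expR (- (2 * D)) *
   \prod_(x in reps (S j)) (1 + (e2 - 1) * (1 - RMRec_prob r eps (Defs.restrict (S j) ft x) c' (Defs.restrict (S j) f x)))))).
  apply: ler_sum => ft _; apply: ler_wpM2l => //.
  apply: (@le_trans _ _ (\sum_W PW ft j W * (expR (- (2 * D)) *
      \prod_(x in reps (S j)) G x (Defs.restrict (S j) W x)))).
    by apply: ler_sum => W _; apply: ler_wpM2l.
  rewrite le_eqVlt; apply/orP; left; apply/eqP.
  transitivity (\sum_W expR (- (2 * D)) * \prod_(x in reps (S j))
     (RMRec_prob r eps (Defs.restrict (S j) ft x) c' (Defs.restrict (S j) W x) *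
      G x (Defs.restrict (S j) W x))).
    by apply: eq_bigr => W _; rewrite big_split mulrCA.
  rewrite -big_distrr /=; congr (_ * _).
  rewrite (sum_words_subcubes (fun x g =>
     RMRec_prob r eps (Defs.restrict (S j) ft x) c' g * G x g)).
  apply: eq_bigr => x _; set h := Defs.restrict (S j) f x; set g0 := Defs.restrict _ _ _.
  transitivity (\sum_g (e2 * RMRec_prob r eps g0 c' g -
      (if g == h then (e2 - 1) * RMRec_prob r eps g0 c' h else 0))).
    by apply: eq_bigr => g _; rewrite /G; case: eqP => [->|_] /=; ring.
  by rewrite sumrB -big_mkcond big_pred1_eq -big_distrr /= RMRec_sum1; ring.
under eq_bigr => ft _ do rewrite mulrCA.
rewrite -big_distrr /=.
rewrite (sum_chan_subcubes (S := S j) eps f (fun x g =>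
   1 + (e2 - 1) * (1 - RMRec_prob r eps g c' (Defs.restrict (S j) f x)))).
have -> : - D = - (2 * D) + D by ring.
rewrite expRD; apply: ler_wpM2l; first exact: expR_ge0.
have q1 : q * e2 <= (4 ^+ tau)^-1.
  by rewrite -[X in _ <= X]mul1r ler_pdivlMr.
have DE : D = #|reps (S j)|%:R * (4 ^+ tau)^-1 by rewrite card_reps natrX.
rewrite DE expRM_natl -prodr_const; apply: ler_prod => x _.
set h := Defs.restrict (S j) f x.
have -> : \sum_g chan eps h g * (1 + (e2 - 1) * (1 - RMRec_prob r eps g c' h)) =
   1 + (e2 - 1) * \sum_g chan eps h g * (1 - RMRec_prob r eps g c' h).
  under eq_bigr => g _ do rewrite mulrDr mulr1 mulrCA.
  by rewrite big_split /= sum_chan1 -big_distrr.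
have qx : \sum_g chan eps h g * (1 - RMRec_prob r eps g c' h) <= q.
  by apply: q_fail; apply: code_restrict.
have q0 : 0 <= \sum_g chan eps h g * (1 - RMRec_prob r eps g c' h).
  apply: sumr_ge0 => g _; apply: mulr_ge0 => //; rewrite subr_ge0.
  rewrite -(RMRec_sum1 eps r c' g) (bigD1 h) //= lerDl; apply: sumr_ge0 => g' _.
  exact: RMRec_ge0.
have e1 : 0 <= e2 - 1 by rewrite subr_ge0.
apply/andP; split; first by rewrite addr_ge0 // mulr_ge0.
apply: le_trans (expR_ge1Dx _); rewrite lerD2l; apply: le_trans q1.
apply: (@le_trans _ _ ((e2 - 1) * q)); first exact: ler_wpM2l.
have : 0 <= q by apply: le_trans qx.
by rewrite mulrBl mul1r mulrC; lra.
Qed.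

Let mp_part (j j' : 'I_mp) : j != j' -> [disjoint S j & S j'].
Proof.
move=> jj'; rewrite finset.disjoints_subset; apply/fintype.subsetP => i; rewrite !inE => /eqP ij.
by rewrite ij; apply: contra jj' => /eqP H; apply/eqP/val_inj.
Qed.

(* The blocks [S j] are disjoint, so for uniform [y] the events
   [rep (S j) y \in fails j _] are independent, each of probability at most [4 ^- tau];
   the weights [2 ^ tau] and [2 ^ - tau] then have mean at most [2 / 2 ^ tau]. *)
Let few_majority_errors (W : 'I_mp -> word m) : (forall j, ~~ bad j (W j)) ->
  (#|[set y | (#|[set j | W j y == f y]| <= #|[set j | W j y != f y]|)%N]|)%:R <=
  2 ^+ m * (2 / 2 ^+ tau) ^+ mp :> R.
Proof.
move=> good; pose a : R := 2 ^+ tau.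
have a0 : 0 < a by rewrite exprn_gt0.
have a1 : 1 <= a by rewrite exprn_ege1 // ler1n.
pose ph (j : 'I_mp) (y : pt m) : R := if rep (S j) y \in fails j (W j) then a else a^-1.
have ph0 j y : 0 <= ph j y by rewrite /ph; case: ifP => _; rewrite ?invr_ge0 ltW.
have wrong j y : W j y != f y -> rep (S j) y \in fails j (W j).
  move=> Wf; rewrite inE rep_in_reps /=; apply: contra Wf => /eqP H; apply/eqP.
  have := congr1 (fun u : word #|~: S j| => u [ffun i => y (enum_val i)]) H.
  by rewrite !ffunE embed_rep.
have step1 : (#|[set y | (#|[set j | W j y == f y]| <= #|[set j | W j y != f y]|)%N]|)%:R <=
    \sum_(y : pt m) \prod_j ph j y.
  rewrite -sum1_card natr_sum big_mkcond; apply: ler_sum => y _; rewrite inE.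
  case: leqP => [H|_]; last by apply: prodr_ge0.
  apply: (@le_trans _ _ (a ^+ #|[set j | W j y != f y]| / a ^+ #|[set j | W j y == f y]|)).
    by rewrite ler_pdivlMr ?exprn_gt0 // mul1r ler_weXn2l.
  rewrite -exprVn -!prodr_const [X in X * _]big_mkcond [X in _ * X]big_mkcond -big_split.
  apply: ler_prod => j _; rewrite /= !inE.
  have := @wrong j y; rewrite /ph; case: (W j y == f y) => /= w.
    rewrite mul1r invr_ge0 (ltW a0) /=; case: ifP => // _.
    by apply: (le_trans _ a1); rewrite invf_le1.
  by rewrite w // mulr1 (ltW a0) lexx.
apply: le_trans step1 _.
rewrite sum_expec_half card_ord; apply: ler_wpM2l; first exact: exprn_ge0.
have half1 : (1 / 2 : R) + 1 / 2 = 1 by lra.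
rewrite (_ : expec _ _ = \prod_j expec (fun _ : bool => 1 / 2 : R) (ph j)); last first.
  have := expec_indep_family (w := fun _ : bool => 1 / 2 : R) half1
    (A := predT) (B := S) (F := ph).
  apply=> [i j _ _|j _ y y' yy']; first exact: mp_part.
  rewrite /ph (_ : rep (S j) y = rep (S j) y') //; apply/ffunP => i; rewrite !ffunE.
  by case: (boolP (i \in S j)) => //= iS; apply: yy'.
rewrite -[X in _ ^+ X](card_ord mp) -prodr_const; apply: ler_prod => j _.
have half0 b : 0 < (fun _ : bool => 1 / 2 : R) b by [].
rewrite (expec_ge0 half1 half0) //=.
have p2 : 0 < 2 ^+ m :> R by rewrite exprn_gt0.
have := sum_expec_half (ph j); rewrite card_ord => E.
rewrite -(ler_pM2l p2) -E.
rewrite (sum_rep (S j) (fun x => if x \in fails j (W j) then a else a^-1)).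
have -> : 2 ^+ m = 2 ^+ #|~: S j| * 2 ^+ #|S j| :> R.
  by rewrite -exprD addnC card_sets_of_ord.
rewrite sumrMnl -[_ *+ (2 ^ _)]mulr_natl natrX -mulrA; apply: ler_wpM2l; first exact: exprn_ge0.
apply: (@le_trans _ _ (\sum_(x in reps (S j)) ((x \in fails j (W j))%:R * a + a^-1))).
  apply: ler_sum => x _; case: ifP => _ /=; rewrite ?mul1r ?mul0r ?add0r //.
  by rewrite lerDl invr_ge0 ltW.
rewrite big_split /= sumr_const card_reps -big_distrl /=.
have -> : \sum_(x in reps (S j)) (x \in fails j (W j))%:R = #|fails j (W j)|%:R :> R.
  rewrite -sum1_card natr_sum [RHS]big_mkcond [LHS]big_mkcond; apply: eq_bigr => x _.
  case: (boolP (x \in fails j (W j))) => [|_]; last by case: ifP.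
  by rewrite inE => /andP[-> _].
have := good j; rewrite /bad -leqNgt -(ler_nat R) natrM !natrX => H.
have a2 : 4 ^+ tau = a * a :> R.
  by rewrite /a -exprMn; congr (_ ^+ _); ring.
rewrite -[_ *+ (2 ^ _)]mulr_natr natrX -/a.
have -> : 2 ^+ #|S j| * (2 / a) = (2 ^+ #|S j| + 2 ^+ #|S j|) / a :> R.
  by field; rewrite gt_eqF.
rewrite ler_pdivlMr // mulrDl (mulrC a^-1) divfK ?gt_eqF // lerD2r -mulrA -a2.
exact: H.
Qed.

Let vote (W : 'I_mp -> word m) (fh : word m) : R :=
  \prod_y choiceP (#|[set j | W j y == fh y]|%:R : R) (#|[set j | W j y != fh y]|%:R).

Let vote_ge0 W fh : 0 <= vote W fh.
Proof. by apply: prodr_ge0 => y _; apply: choiceP_ge0. Qed.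

Let vote_sum1 W : \sum_fh vote W fh = 1.
Proof.
pose wv (y : pt m) (b : bool) : R :=
  choiceP #|[set j | W j y == b]|%:R #|[set j | W j y != b]|%:R.
apply: (sum_prod_weights (w := wv)) => y; rewrite /wv.
rewrite [X in choiceP _ X + _](_ : _ = #|[set j | W j y == false]|%:R); last first.
  by congr _%:R; apply: eq_card => j; rewrite !inE; case: (W j y).
rewrite [X in _ + choiceP _ X](_ : _ = #|[set j | W j y == true]|%:R); last first.
  by congr _%:R; apply: eq_card => j; rewrite !inE; case: (W j y).
exact: choiceP_sum1.
Qed.

Hypothesis T_large : 2 ^+ m * (2 / 2 ^+ tau) ^+ mp <= T.

(** Without a bad direction, a vote of positive probability differs from [f] only where at least
    half of the directions do, and by [few_majority_errors] there are at most T such points. *)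
Let vote_error (W : {ffun 'I_mp -> word m}) (fh : word m) :
  vote W fh * (T < (dH f fh)%:R)%R%:R <= vote W fh * \sum_j (bad j (W j))%:R.
Proof.
have [|good] := boolP [exists j, bad j (W j)].
  move=> /existsP[j bj]; apply: ler_wpM2l => //.
  rewrite (bigD1 j) //= bj; case: (_ < _) => /=; first by rewrite lerDl sumr_ge0.
  by rewrite addr_ge0 // sumr_ge0.
have [->|v0] := eqVneq (vote W fh) 0; first by rewrite !mul0r.
rewrite (_ : T < _ = false) ?mulr0; last first.
  apply/negbTE; rewrite -leNgt; apply: le_trans T_large.
  apply: le_trans (few_majority_errors (W := W) _); last first.
    by move=> j; move: good; rewrite negb_exists => /forallP/(_ j).
  rewrite ler_nat; apply/subset_leq_card/fintype.subsetP => y; rewrite !inE => ffh.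
  have /prodf_neq0/(_ y isT) : vote W fh != 0 by [].
  rewrite /choiceP.
  have -> : #|[set j | W j y == fh y]| = #|[set j | W j y != f y]|.
    by apply: eq_card => j; rewrite !inE; move: ffh; case: (f y); case: (fh y); case: (W j y).
  have -> : #|[set j | W j y != fh y]| = #|[set j | W j y == f y]|.
    by apply: eq_card => j; rewrite !inE; move: ffh; case: (f y); case: (fh y); case: (W j y).
  rewrite ltr_nat eqr_nat; case: ltngtP => //; by rewrite eqxx.
by apply: mulr_ge0 => //; apply: sumr_ge0.
Qed.

Lemma RMRec2_fail :
  \sum_ft chan eps f ft * (1 - RMRec2_prob r eps ft c c' f) <=
  \sum_j expR (- (2 ^+ #|S j| / 4 ^+ tau)) + ml_sum eps m r.+1 (2 * T).
Proof.
have PWprod1 ft : \sum_(W : {ffun 'I_mp -> word m}) \prod_j PW ft j (W j) = 1.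
  rewrite -(bigA_distr_bigA (fun j W => PW ft j W)).
  by apply: big1 => j _; apply: PW_sum1.
have marg ft (j0 : 'I_mp) : \sum_(W : {ffun 'I_mp -> word m}) (\prod_j PW ft j (W j)) * (bad j0 (W j0))%:R =
    \sum_W PW ft j0 W * (bad j0 W)%:R.
  transitivity (\sum_(W : {ffun 'I_mp -> word m})
     \prod_j (PW ft j (W j) * (if j == j0 then (bad j0 (W j))%:R else 1))).
    apply: eq_bigr => W _; rewrite big_split /=; congr (_ * _).
    by rewrite -big_mkcond (big_pred1 j0).
  rewrite -(bigA_distr_bigA (fun j W => PW ft j W * (if j == j0 then (bad j0 W)%:R else 1))).
  rewrite (bigD1 j0) //= [X in _ * X]big1 => [|j jj0].
    by rewrite mulr1; apply: eq_bigr => W _; rewrite eqxx.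
  by rewrite -[RHS](PW_sum1 ft j); apply: eq_bigr => W _; rewrite (negbTE jj0) mulr1.
pose l (fh : word m) := [set c0 in code m r.+1 | (dH c0 fh)%:R <= T].
have RE ft : RMRec2_prob r eps ft c c' f =
   \sum_(W : {ffun 'I_mp -> word m}) (\prod_j PW ft j (W j)) *
     \sum_fh vote W fh * argmax_unif R (l fh) ft f.
  rewrite /RMRec2_prob -/mp; apply: eq_bigr => W _; congr (_ * _).
  by apply: eq_bigr => fh _; rewrite /l /T RM_code.
apply: (@le_trans _ _ (\sum_ft chan eps f ft *
    (\sum_j \sum_W PW ft j W * (bad j W)%:R + (ml_bad r.+1 (2 * T) f ft)%:R))).
  apply: ler_sum => ft _; apply: ler_wpM2l => //.
  have -> : 1 - RMRec2_prob r eps ft c c' f =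
    \sum_(W : {ffun 'I_mp -> word m}) (\prod_j PW ft j (W j)) *
     \sum_fh vote W fh * (1 - argmax_unif R (l fh) ft f).
    rewrite RE -{1}(PWprod1 ft) -sumrB; apply: eq_bigr => W _.
    have -> : \sum_fh vote W fh * (1 - argmax_unif R (l fh) ft f) =
       1 - \sum_fh vote W fh * argmax_unif R (l fh) ft f.
      rewrite -[in RHS](vote_sum1 W) -sumrB.
      by apply: eq_bigr => fh _; rewrite mulrBr mulr1.
    by rewrite mulrBr mulr1.
  apply: (@le_trans _ _ (\sum_(W : {ffun 'I_mp -> word m}) (\prod_j PW ft j (W j)) *
     (\sum_j (bad j (W j))%:R + (ml_bad r.+1 (2 * T) f ft)%:R))).
    apply: ler_sum => W _; apply: ler_wpM2l; first by apply: prodr_ge0 => j _.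
    rewrite -[X in _ <= X]mul1r -[X in _ <= X * _](vote_sum1 W) big_distrl /=; apply: ler_sum => fh _.
    apply: (@le_trans _ _ (vote W fh *
       ((T < (dH f fh)%:R)%R%:R + (ml_bad r.+1 (2 * T) f ft)%:R))).
      by apply: ler_wpM2l => //; apply: (argmax_unif_fail ft (erefl (l fh)) f_code).
    by rewrite !mulrDr; apply: lerD => //; apply: vote_error.
  under eq_bigr => W _ do rewrite mulrDr big_distrr /=.
  rewrite big_split /= -big_distrl /= PWprod1 mul1r lerD2r exchange_big /=.
  by apply: ler_sum => j _; rewrite marg.
under eq_bigr => ft _ do rewrite mulrDr big_distrr /=.
rewrite big_split /=; apply: lerD; last exact: ml_error.
rewrite exchange_big /=; apply: ler_sum => j _; exact: bad_prob.
Qed.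

End RMRec2Analysis.

(** * Asymptotic rates *)

Section Asymptotics.
Variable R : realType.
Local Notation u M := (Num.sqrt (M%:R : R)).
Local Notation root8 M := (Num.sqrt (Num.sqrt (Num.sqrt (M%:R : R)))).

Lemma near_ge_nat (A : R) : \forall M \near \oo%classic, A <= M%:R.
Proof.
exists (Num.truncn A).+1 => // M /= AM; apply/ltW/(lt_le_trans (truncnS_gt A)).
by rewrite ler_nat.
Qed.

Lemma near_le_root8 (A : R) : \forall M \near \oo%classic, A <= root8 M.
Proof.
near=> M; have [A0|/ltW A0] := lerP 0 A; last by apply: le_trans A0 _; apply: sqrtr_ge0.
have H : A ^+ 8 <= M%:R by near: M; apply: near_ge_nat.
rewrite -(ger0_norm A0) -sqrtr_sqr; apply: ler_wsqrtr.
rewrite -(ger0_norm (sqr_ge0 A)) -sqrtr_sqr; apply: ler_wsqrtr.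
rewrite -(ger0_norm (sqr_ge0 (A ^+ 2))) -sqrtr_sqr; apply: ler_wsqrtr.
by rewrite -!exprM.
Unshelve. all: by end_near. Qed.

Lemma root8_sqrt (M : nat) : root8 M ^+ 4 = u M.
Proof. by rewrite (exprM _ 2 2) !sqr_sqrtr ?sqrtr_ge0. Qed.

Lemma root8_nat (M : nat) : root8 M ^+ 8 = M%:R.
Proof. by rewrite (exprM _ 4 2) root8_sqrt sqr_sqrtr. Qed.

(** The eighth root v of M is the unit of the estimates below: ln M is at most of order v while sqrt
    M = v^4, so a degree cutoff v^2 times a moment of order ln M stays below k ~ v^4. *)
Lemma ln_le_root8 (M : nat) : (0 < M)%N -> ln (M%:R : R) <= 8 * root8 M.
Proof.
move=> M0; have v0 : 0 < root8 M by rewrite !sqrtr_gt0 ltr0n.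
rewrite -{1}(root8_nat M) lnXn // -[X in X <= _]mulr_natl; apply: ler_wpM2l => //.
by have := ln_le_sub1 v0; lra.
Qed.

Lemma expR_root8 (M : nat) : (0 < M)%N -> expR (ln (M%:R : R)) = root8 M ^+ 8.
Proof. by move=> M0; rewrite root8_nat lnK // posrE ltr0n. Qed.

Lemma near_le_ln (A : R) : \forall M \near \oo%classic, A <= ln (M%:R : R).
Proof.
near=> M; have H : expR A <= M%:R by near: M; apply: near_ge_nat.
rewrite -[X in X <= _](expRK A) ler_ln ?posrE ?expR_gt0 //.
exact: lt_le_trans (expR_gt0 A) H.
Unshelve. all: by end_near. Qed.

Lemma expR_half_le2 : expR (1 / 2 : R) <= 2.
Proof.
have := expR_ge1Dx (- (1 / 2) : R); have := expR_gt0 (1 / 2 : R).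
have : expR (1 / 2 : R) * expR (- (1 / 2)) = 1 by rewrite -expRD subrr expR0.
set a := expR (1 / 2); set b := expR _; nra.
Qed.

Lemma nine_le_expR4 : 9 <= expR (4 : R).
Proof.
have h : 2 <= expR (1 : R) by have := expR_ge1Dx (1 : R); lra.
have -> : expR (4 : R) = expR 1 ^+ 4 by rewrite -expRM_natl mulr1.
by apply: le_trans (ler_pow 4 _ h); [rewrite -natrX ler_nat|].
Qed.

End Asymptotics.

(** * Bit error probability below capacity *)

Section BitErrorRate.
Variables (R : realType) (eps : R).
Hypotheses (eps_gt0 : 0 < eps) (eps_lt : eps < 1 / 2).
Local Notation u M := (Num.sqrt (M%:R : R)).
Local Notation root8 M := (Num.sqrt (Num.sqrt (Num.sqrt (M%:R : R)))).

(* With [v = M^(1/8)], [k = floor (kappa v^4)] extra dimensions, moment [j ~ ln M] and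
   degree cutoff [s ~ v^2]: the low-degree part contributes [expR (- kappa v^4 / 4) ^ j] and the
   high-degree part [(v^2)^-k]; both are [expR (- Omega (sqrt M * ln M))]. *)
Lemma bit_error_rate (delta : R) : 0 < delta -> exists2 c1 : R, 0 < c1 &
  \forall M \near \oo%classic, forall d : nat,
    (partial_sum M d)%:R <= (1 - H eps - 2 * delta) * 2 ^+ M ->
    forall (f : word M) (x : pt M), f \in code M d ->
    bit_error eps d f x <= expR (- (c1 * u M * ln M%:R)).
Proof.
move=> delta0.
(* The bound delta / 4 keeps the rate loss k / sqrt n below delta; 1 / 4 keeps k <= M / 4, so that n
   remains of the order of M. *)
pose kappa : R := Num.min (delta / 4) (1 / 4).
have kappa0 : 0 < kappa by rewrite lt_min; apply/andP; split; lra.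
have kd : kappa <= delta / 4 by rewrite ge_min lexx.
have k14 : kappa <= 1 / 4 by rewrite ge_min lexx orbT.
have l2 : 0 < ln (2 : R) by rewrite ln_gt0 // ltr1n.
pose q0 := delta * ln 2.
have q00 : 0 < q0 by rewrite mulr_gt0.
pose B := 4 / q0 ^+ 2.
have B0 : 0 < B by rewrite divr_gt0 // exprn_gt0.
pose C := (eps * (1 - eps))^-1.
have C0 : 0 < C by rewrite invr_gt0 mulr_gt0 //; move: eps_gt0 eps_lt => ? ?; lra.
exists (kappa / 16); first by rewrite divr_gt0.
near=> M => d rate f x fd.
have v1 : 1 <= root8 M by near: M; apply: near_le_root8.
have vA : 4 * (B + C + 50) / kappa <= root8 M by near: M; apply: near_le_root8.
have vB : 16 * (B + 1) / kappa <= root8 M by near: M; apply: near_le_root8.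
have L1 : 1 <= ln (M%:R : R) by near: M; apply: near_le_ln.
have M0 : (0 < M)%N by near: M; exists 1%N.
have Lv := ln_le_root8 R M0; have Lexp := expR_root8 R M0.
have uE := root8_sqrt R M; have ME := root8_nat R M.
have u2 : u M * u M = M%:R by rewrite -expr2 sqr_sqrtr.
move: v1 vA vB Lv Lexp uE ME; set v := root8 M => v1 vA vB Lv Lexp uE ME.
move: u2 L1 Lv Lexp; rewrite -uE; set L := ln M%:R => u2 L1 Lv Lexp.
rewrite ler_pdivrMr // in vA; rewrite ler_pdivrMr // in vB.
have v0 : 0 < v by lra.
have v20 : 0 < v ^+ 2 by rewrite exprn_gt0.
have v4v : v <= v ^+ 4 by rewrite -[X in X <= _]expr1 ler_weXn2l.
have v40 : 0 < v ^+ 4 by lra.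
pose k := Num.truncn (kappa * v ^+ 4).
have kk : 0 <= kappa * v ^+ 4 by rewrite mulr_ge0 // ltW.
have /andP[k1 k2] := truncn_itv kk; rewrite -/k -natr1 in k1 k2.
have kv4 : v * kappa <= kappa * v ^+ 4 by rewrite mulrC; apply: ler_wpM2l => //; apply: ltW.
have khalf : kappa * v ^+ 4 / 2 <= k%:R by lra.
have kM : k%:R <= M%:R / 4 :> R.
  apply: le_trans k1 _; rewrite -u2; have : v ^+ 4 <= v ^+ 4 * v ^+ 4.
    by rewrite ler_peMr ?(le_trans v1) // ltW.
  have : kappa * v ^+ 4 <= 1 / 4 * v ^+ 4 by apply: ler_wpM2r => //; apply: ltW.
  lra.
have [n Mnk] : exists n, M = (n + k)%N.
  exists (M - k)%N; rewrite subnK // -(ler_nat R).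
  by apply: le_trans kM _; have : (0 : R) <= M%:R by []; lra.
have nM : M%:R / 4 <= n%:R :> R.
  by have : M%:R = n%:R + k%:R :> R; [rewrite {1}Mnk natrD|]; have : (0 : R) <= M%:R by []; lra.
have n0 : (0 < n)%N.
  by rewrite -(ltr_nat R); apply: lt_le_trans nM; rewrite divr_gt0 // ltr0n.
have sn : v ^+ 4 / 2 <= u n.
  have -> : v ^+ 4 / 2 = Num.sqrt (M%:R / 4).
    rewrite -u2 (_ : _ / 4 = (v ^+ 4 / 2) ^+ 2); last by field.
    by rewrite sqrtr_sqr ger0_norm // divr_ge0 // ltW.
  exact: ler_wsqrtr.
have rate_n : (partial_sum n d)%:R <= (1 - H eps - delta) * 2 ^+ n.
  rewrite -ler_pdivrMr ?exprn_gt0 //; apply: le_trans (rate_shift R k d n0) _.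
  rewrite -Mnk; apply: (@le_trans _ _ ((1 - H eps - 2 * delta) + delta)); last by lra.
  apply: lerD; first by rewrite ler_pdivrMr ?exprn_gt0.
  rewrite ler_pdivrMr ?sqrtr_gt0 ?ltr0n //; apply: le_trans k1 _.
  apply: (@le_trans _ _ (delta * (v ^+ 4 / 2))); last by apply: ler_wpM2l => //; apply: ltW.
  have : kappa * v ^+ 4 <= delta / 4 * v ^+ 4 by apply: ler_wpM2r => //; apply: ltW.
  have : 0 <= delta * v ^+ 4 by apply: mulr_ge0; apply: ltW.
  lra.
have [rho [rho_dep rho_le1 rho_add rho_mean]] :=
  weak_predictor eps_gt0 eps_lt (ltW delta0) rate_n.
pose s := Num.truncn (v ^+ 2).
have /andP[s1 s2] := truncn_itv (ltW v20); rewrite -/s -natr1 in s1 s2.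
pose j := (Num.truncn L).+1.
have L0 : 0 <= L by apply: le_trans L1.
have /andP[j1 j2] := truncn_itv L0.
have jL : L <= j%:R by apply: ltW.
have jU : j%:R <= 8 * v + 1 by rewrite /j -natr1; move: j1 Lv; clear; lra.
have q_pos : 0 < expec (nu eps) rho by apply: lt_le_trans rho_mean.
have BE : 4 / expec (nu eps) rho ^+ 2 <= B.
  apply: ler_wpM2l => //; rewrite lef_pV2 ?posrE ?exprn_gt0 //.
  by apply: ler_pow => //; apply: ltW.
have bound := boosted_le0 eps_gt0 eps_lt k rho_dep rho_le1 s (ltn0Sn (Num.truncn L)) q_pos.
rewrite -/j in bound.
have KE : hyper_const eps j <= expR (4 * j%:R + C).
  rewrite expRD (mulrC 4) expRM_natl; apply: ler_pM; first exact: exprn_ge0.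
  - exact: ltW.
  - by apply: ler_pow => //; apply: nine_le_expR4.
  by apply: le_trans (expR_ge1Dx C); rewrite lerDr.
have K0 : 0 <= hyper_const eps j.
  by apply: le_trans (hyper_const_ge1 eps_gt0 eps_lt j).
have low : B * (hyper_const eps j ^+ s / 2 ^+ k) <= expR (- (kappa / 4 * v ^+ 4)).
  apply: (@le_trans _ _ (expR (B + s%:R * (4 * j%:R + C) - k%:R / 2))).
    rewrite -addrA expRD; apply: ler_pM => //; first exact: ltW.
    - by rewrite divr_ge0 // exprn_ge0.
    - by apply: le_trans (expR_ge1Dx B); rewrite lerDr.
    rewrite expRD expRM_natl expRN; apply: ler_pM; rewrite ?exprn_ge0 ?invr_ge0 ?exprn_ge0 //.
      exact: ler_pow.
    rewrite lef_pV2 ?posrE ?exprn_gt0 ?expR_gt0 //.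
    rewrite (_ : k%:R / 2 = k%:R * (1 / 2)); last by ring.
    by rewrite expRM_natl; apply: ler_pow; [exact: expR_ge0|exact: expR_half_le2].
  rewrite ler_expR.
  have : s%:R * (4 * j%:R + C) <= v ^+ 2 * (4 * (8 * v + 1) + C).
    apply: ler_pM => //; first by rewrite addr_ge0 ?mulr_ge0 // ltW.
    by rewrite lerD2r; apply: ler_wpM2l.
  have v2v3 : v ^+ 2 <= v ^+ 3 by apply: ler_weXn2l.
  have v13 : 1 <= v ^+ 3 by apply: exprn_ege1.
  have : (B + C + 50) * v ^+ 3 <= kappa / 4 * v ^+ 4.
    rewrite (_ : kappa / 4 * v ^+ 4 = kappa / 4 * v * v ^+ 3); last by ring.
    by apply: ler_wpM2r; [exact: exprn_ge0 (ltW v0)|move: vA; clear; lra].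
  have : 0 <= (B + C + 4) * (v ^+ 3 - v ^+ 2).
    by apply: mulr_ge0; [rewrite !addr_ge0 // ltW|rewrite subr_ge0].
  have : 0 <= B * (v ^+ 2 - 1).
    by apply: mulr_ge0; [exact: ltW|rewrite subr_ge0 exprn_ege1].
  have -> : v ^+ 2 * (4 * (8 * v + 1) + C) = 32 * v ^+ 3 + (4 + C) * v ^+ 2 by ring.
  by rewrite !mulrBr mulr1 !mulrDl; move: v13 k2 B0 C0; clear; lra.
(* The factor L appears because v^2 = expR (L / 4), as v^8 = M. *)
have high : (s.+2%:R ^+ k)^-1 <= expR (- (kappa / 8 * v ^+ 4 * L)).
  rewrite expRN lef_pV2 ?posrE ?expR_gt0 ?exprn_gt0 //.
  apply: (@le_trans _ _ (expR (k%:R * (L / 4)))).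
    rewrite ler_expR (_ : kappa / 8 * v ^+ 4 * L = kappa * v ^+ 4 / 2 * (L / 4)); last by field.
    by apply: ler_wpM2r => //; apply: divr_ge0.
  rewrite expRM_natl; apply: ler_pow; first exact: expR_ge0.
  apply: (@le_trans _ _ (v ^+ 2)).
    have e0 : 0 <= expR (L / 4) by exact: expR_ge0.
    rewrite -(@ler_pXn2r _ 4) ?nnegrE ?exprn_ge0 ?(ltW v0) //.
    rewrite -expRM_natl (_ : 4 * (L / 4) = L); last by field.
    by rewrite Lexp -exprM.
  by rewrite -natr1 -natr1; move: s2; clear; lra.
(* Stated for a variable length, so that the equation M = n + k can be substituted in the types of
   the word and the point. *)
have concl M' (e : M' = (n + k)%N) (f' : word M') (x' : pt M') : f' \in code M' d ->
    bit_error eps d f' x' <= (4 / expec (nu eps) rho ^+ 2 * (hyper_const eps j ^+ s / 2 ^+ k)) ^+ j +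
      4 / expec (nu eps) rho ^+ 2 / s.+2%:R ^+ k.
  subst M' => fd'; apply: le_trans bound.
  exact: (bit_error_le eps_gt0 eps_lt (boosted_add (k := k) rho_add)).
apply: le_trans (concl M Mnk f x fd) _.
have E40 : 0 <= 4 / expec (nu eps) rho ^+ 2 by rewrite divr_ge0 // exprn_ge0 // ltW.
have t1 : (4 / expec (nu eps) rho ^+ 2 * (hyper_const eps j ^+ s / 2 ^+ k)) ^+ j <=
    expR (- (kappa / 8 * v ^+ 4 * L)).
  apply: (@le_trans _ _ (expR (- (kappa / 4 * v ^+ 4)) ^+ j)).
    apply: ler_pow; first by rewrite mulr_ge0 // divr_ge0 // exprn_ge0.
    apply: le_trans low; apply: ler_wpM2r => //.
    by rewrite divr_ge0 // exprn_ge0.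
  rewrite -expRM_natl ler_expR mulrN lerN2.
  have k8 : 0 <= kappa / 8 * v ^+ 4 by rewrite mulr_ge0 // ?divr_ge0 // ltW.
  have : 0 <= kappa / 8 * v ^+ 4 * (j%:R - L) by rewrite mulr_ge0 // subr_ge0.
  have : 0 <= kappa / 8 * v ^+ 4 * j%:R by rewrite mulr_ge0.
  by rewrite mulrBr; clear; lra.
have t2 : 4 / expec (nu eps) rho ^+ 2 / s.+2%:R ^+ k <= B * expR (- (kappa / 8 * v ^+ 4 * L)).
  by apply: ler_pM => //; rewrite invr_ge0 exprn_ge0.
apply: le_trans (lerD t1 t2) _.
have -> : - (kappa / 16 * v ^+ 4 * L) = kappa / 16 * v ^+ 4 * L + - (kappa / 8 * v ^+ 4 * L) by field.
rewrite expRD -[X in X + _]mul1r -mulrDl; apply: ler_wpM2r; first exact: expR_ge0.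
apply: le_trans (expR_ge1Dx _); rewrite lerD2l.
have : kappa * v ^+ 4 <= kappa * v ^+ 4 * L by rewrite ler_peMr // mulr_ge0 // ltW.
by move: vB kv4 kappa0; clear; lra.
Unshelve. all: by end_near. Qed.

End BitErrorRate.

(** * Competing codewords of low weight *)

Section MLAsymptotics.
Variables (R : realType) (eps : R).
Hypotheses (eps_gt0 : 0 < eps) (eps_lt : eps < 1 / 2).
Local Notation u M := (Num.sqrt (M%:R : R)).
Local Notation root8 M := (Num.sqrt (Num.sqrt (Num.sqrt (M%:R : R)))).
Local Notation light M d l := [set w in code M d | (weight w * 2 ^ l <= 2 ^ M)%N].

Lemma dyadic_level (w M a b : nat) : (w * 2 ^ a <= 2 ^ M)%N -> (2 ^ M < w * 2 ^ b)%N ->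
  exists l, [/\ (a <= l < b)%N, (w * 2 ^ l <= 2 ^ M)%N & (2 ^ (M - l.+1) <= w)%N].
Proof.
move=> wa wb; have ab : (a < b)%N.
  rewrite ltnNge; apply/negP => ba; move: wb; rewrite ltnNge => /negP; apply.
  by apply: leq_trans wa; rewrite leq_mul2l leq_exp2l // ba orbT.
have [n bE] : exists n, b = (a + n)%N by exists (b - a)%N; rewrite subnKC // ltnW.
subst b; elim: n a wa wb {ab} => [|n IH] a wa wb.
  by move: wb; rewrite addn0 ltnNge wa.
have [wa1|] := leqP (w * 2 ^ a.+1) (2 ^ M).
  have [|l [/andP[al ln] wl wM]] := IH a.+1 wa1; first by rewrite addSnnS.
  by exists l; split=> //; rewrite (ltnW al) -addSnnS ln.
move=> Mw; exists a; split=> //; first by rewrite leqnn -addSnnS leq_addr.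
have w0 : (0 < w)%N by case: (w) Mw.
have [aM|Ma] := leqP a.+1 M; last by rewrite (eqP (ltnW Ma : M - a.+1 == 0)%N).
by move: Mw; rewrite -{1}(subnK aM) expnD ltn_pmul2r ?expn_gt0 // => /ltnW.
Qed.

(** Weights are grouped into levels between 2^(M-l-1) and 2^(M-l). The radius [W] allows only levels
    from l0 on, and [low_weight_zero] stops them before d + 4. *)
Lemma ml_sum_dyadic (M d l0 : nat) (W : R) : W <= 2 ^+ M / 2 ^+ l0 ->
  ml_sum eps M d W <=
  \sum_(l0 <= l < d + 4) #|light M d l|%:R * ml_rate eps ^+ (2 ^ (M - l.+1)).
Proof.
move=> Wl0; have g0 : 0 <= ml_rate eps by apply/ltW/ml_rate_gt0.
have g1 : ml_rate eps <= 1 by apply/ltW/ml_rate_lt1.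
rewrite /ml_sum.
apply: (@le_trans _ _ (\sum_(c in code M d | (c != zero_word M) && ((weight c)%:R <= W))
   \sum_(l0 <= l < d + 4) (c \in light M d l)%:R * ml_rate eps ^+ (2 ^ (M - l.+1)))).
  apply: ler_sum => c /and3P[cd c0 cW].
  have [||l [lb wl wM]] := @dyadic_level (weight c) M l0 (d + 4).
  - move: (le_trans cW Wl0); rewrite ler_pdivlMr ?exprn_gt0 // -!natrX -natrM ler_nat.
    exact.
  - rewrite ltnNge; apply: contra c0 => H; apply/eqP; exact: low_weight_zero H.
  rewrite (bigD1_seq l) ?mem_index_iota ?iota_uniq //=.
  rewrite inE cd wl mul1r; apply: ler_wpDr.
    by apply: sumr_ge0 => i _; apply: mulr_ge0 => //; apply: exprn_ge0.
  exact: ler_wiXn2l.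
rewrite exchange_big /=; apply: ler_sum => l _.
rewrite -big_distrl /=; apply: ler_wpM2r; first exact: exprn_ge0.
rewrite -sum1_card natr_sum big_mkcond [X in _ <= X]big_mkcond; apply: ler_sum => c _.
by case: (c \in light M d l); case: ifP.
Qed.

Lemma two_le_expR1 : 2 <= expR (1 : R).
Proof. by have := expR_ge1Dx (1 : R); lra. Qed.

Lemma near_poly_le_expR (A : R) : \forall M \near \oo%classic,
  A * M%:R ^+ 3 <= expR (M%:R / 8).
Proof.
near=> M.
have M1 : `|A| * 32 ^+ 4 <= M%:R by near: M; apply: near_ge_nat.
have e : 0 <= M%:R / 32 :> R by rewrite divr_ge0.
have -> : M%:R / 8 = 4%:R * (M%:R / 32) :> R by field.
rewrite expRM_natl; apply: (@le_trans _ _ ((M%:R / 32) ^+ 4)); last first.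
  by apply: ler_pow => //; apply: le_trans (expR_ge1Dx _); rewrite lerDr.
rewrite expr_div_n ler_pdivlMr ?exprn_gt0 // (exprS M%:R 3) mulrAC.
apply: ler_wpM2r; first exact: exprn_ge0.
by apply: le_trans M1; apply: ler_wpM2r; [exact: exprn_ge0|exact: ler_norm].
Unshelve. all: by end_near. Qed.

(** At level l = k + 4 the exponent of the number of codewords is essentially M + 1 times a partial
    sum for M - k variables and degree d - k. As d <= M / 2 + O(sqrt M), this degree lies about k /
    2 below the middle, with k at least of order sqrt M * ln M. So the partial sum is at most
    2^(M-k) * expR (- Omega ((ln M)^2)), and even times M + 1 it is negligible against the weight
    2^(M-l-1). *)
Lemma ml_sum_small (a eta : R) : 0 < a -> 0 < eta ->
  \forall M \near \oo%classic, forall (d : nat) (W : R),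
    (partial_sum M d)%:R <= (1 - eta) * 2 ^+ M ->
    W <= 2 ^+ M * expR (- (a * u M * ln M%:R)) ->
    ml_sum eps M d W <= expR (- expR (u M)).
Proof.
move=> a0 eta0; have [A [A0 degA]] := degree_bound eta0.
pose g := - ln (ml_rate eps).
have gE : ml_rate eps = expR (- g) by rewrite opprK lnK // posrE ml_rate_gt0.
have g0 : 0 < g by rewrite oppr_gt0 ln_lt0 // ml_rate_gt0 ?ml_rate_lt1.
near=> M => d W rate WM.
have v1 : 16 * a + 8 * A + 100 <= root8 M by near: M; apply: near_le_root8.
have L1 : 4 * (A + 10) / a <= ln (M%:R : R) by near: M; apply: near_le_ln.
have L2 : 64 / a ^+ 2 <= ln (M%:R : R) by near: M; apply: near_le_ln.
have L3 : 256 / g <= ln (M%:R : R) by near: M; apply: near_le_ln.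
have L4 : 1 <= ln (M%:R : R) by near: M; apply: near_le_ln.
have Mg : 64 / g <= M%:R :> R by near: M; apply: near_ge_nat.
have poly : 8 / g * M%:R ^+ 3 <= expR (M%:R / 8 : R).
  by near: M; apply: near_poly_le_expR.
have M0 : (0 < M)%N by near: M; exists 1%N.
have dM := degA M d M0 rate.
have Lv := ln_le_root8 R M0.
have uE := root8_sqrt R M; have ME := root8_nat R M.
have lnM : expR (ln M%:R) = M%:R :> R by rewrite lnK // posrE ltr0n.
move: v1 Lv uE ME; set v := root8 M => v1 Lv uE ME.
move: dM WM; rewrite -uE; move: L1 L2 L3 L4 Lv lnM; set L := ln M%:R => L1 L2 L3 L4 Lv lnM dM WM.
rewrite ler_pdivrMr // in L1; rewrite ler_pdivrMr ?exprn_gt0 // in L2.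
rewrite ler_pdivrMr // in L3; rewrite ler_pdivrMr // in Mg.
have v100 : 100 <= v by move: v1 a0 A0; clear; lra.
have v0 : 0 < v by move: v100; clear; lra.
have L0 : 0 < L by move: L4; clear; lra.
have v4v : v <= v ^+ 4 by rewrite -[X in X <= _]expr1 ler_weXn2l //; move: v100; clear; lra.
have v40 : 0 < v ^+ 4 by rewrite exprn_gt0.
have M8 : M%:R = v ^+ 4 * v ^+ 4 :> R by rewrite -ME -exprD.
have big4 : (16 * a + 8 * A + 100) * v ^+ 4 <= M%:R.
  rewrite M8; apply: ler_wpM2r; first exact: ltW.
  by apply: le_trans v4v.
have aL : a * v ^+ 4 * L <= M%:R / 8.
  have -> : M%:R / 8 = v ^+ 5 * (v ^+ 3 / 8) by rewrite -ME; field.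
  apply: (@le_trans _ _ (a * v ^+ 4 * (8 * v))).
    by apply: ler_wpM2l => //; apply: mulr_ge0; apply: ltW.
  have -> : a * v ^+ 4 * (8 * v) = v ^+ 5 * (8 * a) by ring.
  apply: ler_wpM2l; first by rewrite exprn_ge0 // ltW.
  have : v * v <= v ^+ 3 by rewrite -expr2 ler_weXn2l //; move: v100; clear; lra.
  have : 100 * v <= v * v by apply: ler_wpM2r => //; apply: ltW.
  by move: v1 a0 A0; clear; lra.
(* Levels end before d + 4, so M - l stays above about M / 4 and all the weights in play are
   exponential in M. *)
have Md : M%:R / 4 + 8 <= M%:R - d%:R :> R.
  have : 0 <= a * v ^+ 4 by apply: mulr_ge0; apply: ltW.
  have : 0 <= A * v ^+ 4 by apply: mulr_ge0 => //; apply: ltW.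
  by move: dM big4 v4v v100; clear; lra.
have dMn : (d + 8 <= M)%N.
  by rewrite -(ler_nat R) natrD; have : (0 : R) <= M%:R by []; move: Md; clear; lra.
have aL0 : 0 <= a * v ^+ 4 * L by rewrite !mulr_ge0 // ltW.
pose l0 := Num.truncn (a * v ^+ 4 * L).
have /andP[l01 l02] := truncn_itv aL0; rewrite -/l0 -natr1 in l01 l02.
have big_aL : 4 * (A + 10) * v ^+ 4 <= a * v ^+ 4 * L.
  rewrite (_ : a * v ^+ 4 * L = L * a * v ^+ 4); last by ring.
  by apply: ler_wpM2r => //; apply: ltW.
have l0_ge : (4 <= l0)%N.
  rewrite -ltnS -(ltr_nat R) -[l0.+1%:R]natr1; apply: le_lt_trans l02.
  apply: le_trans big_aL; have : 0 <= A * v ^+ 4 by apply: mulr_ge0 => //; apply: ltW.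
  by move: v4v v100; clear; lra.
have Wl0 : W <= 2 ^+ M / 2 ^+ l0.
  apply: le_trans WM _; apply: ler_wpM2l; first exact: exprn_ge0.
  rewrite expRN lef_pV2 ?posrE ?expR_gt0 ?exprn_gt0 //.
  apply: (@le_trans _ _ (expR 1 ^+ l0)); first by apply: ler_pow => //; apply: two_le_expR1.
  by rewrite -expRM_natl mulr1 ler_expR.
apply: le_trans (ml_sum_dyadic d Wl0) _.
have two_half (n : nat) : expR (n%:R / 2) <= 2 ^+ n :> R.
  rewrite (_ : n%:R / 2 = n%:R * (1 / 2)); last by ring.
  by rewrite expRM_natl; apply: ler_pow; [exact: expR_ge0|exact: expR_half_le2].
have Xbig (l : nat) : (l < d + 4)%N -> expR (M%:R / 8) <= 2 ^+ (M - l.+1) :> R.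
  move=> ld; apply: le_trans (two_half _); rewrite ler_expR.
  have : (M - (d + 4))%:R <= (M - l.+1)%:R :> R by rewrite ler_nat leq_sub2l.
  by rewrite (natrB _ (_ : d + 4 <= M)%N) ?natrD; [move: Md; clear; lra|move: dMn; clear; lia].
have term (l : nat) : (l0 <= l < d + 4)%N ->
    #|light M d l|%:R * ml_rate eps ^+ (2 ^ (M - l.+1)) <= expR (- (g / 2 * expR (M%:R / 8))).
  move=> /andP[l0l ld]; pose X : R := 2 ^+ (M - l.+1).
  have Xb : expR (M%:R / 8) <= X by apply: Xbig.
  apply: (@le_trans _ _ (expR (- (g / 2 * X)))); last first.
    by rewrite ler_expR lerN2; apply: ler_wpM2l => //; apply: divr_ge0 => //; apply: ltW.
  have [k lE] : exists k, l = (k + 4)%N.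
    by exists (l - 4)%N; rewrite subnK // (leq_trans l0_ge).
  have kd : (k < d)%N by move: ld lE; clear; lia.
  have kM : (k <= M)%N by move: kd dMn; clear; lia.
  (* A lower bound for the distance to the middle: half of k, less the error A v^4 of the degree
     bound, which [big_aL] absorbs. *)
  pose w := a / 4 * v ^+ 4 * L.
  have wE : w = a * v ^+ 4 * L / 4 by rewrite /w; field.
  have w0 : 0 <= w by rewrite wE divr_ge0.
  have Mk : (M - k)%:R = M%:R - k%:R :> R by rewrite natrB.
  have kdR : k%:R <= d%:R :> R by rewrite ler_nat ltnW.
  (* The factor 32 is 2^5, as M - k = 5 + (M - l - 1); the divisor 256 M is such that the product
     with 2 M >= M + 1 is g / 4 * X. *)
  have tail : (partial_sum (M - k) (d - k))%:R <= 32 * X * (g / (256 * M%:R)).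
    have k_ge : a * v ^+ 4 * L - 5 <= k%:R.
      have : l0%:R <= k%:R + 4 :> R by rewrite -natrD ler_nat -lE.
      by move: l02; clear; lra.
    apply: (@le_trans _ _ (2 ^+ (M - k) * expR (- (w ^+ 2 / (2 * (M - k)%:R))))).
      apply: chernoff => //.
      - by rewrite subn_gt0; move: kd dMn; clear; lia.
      - rewrite wE Mk; move: aL Md kdR aL0; have : (0 : R) <= M%:R by [].
        by clear; lra.
      rewrite natrB ?(ltnW kd) // Mk wE.
      have : 0 <= A * v ^+ 4 by apply: mulr_ge0 => //; apply: ltW.
      by move: big_aL dM k_ge v4v v100; clear; lra.
    have -> : 2 ^+ (M - k) = 32 * X.
      rewrite /X lE (_ : M - k = 5 + (M - (k + 4).+1))%N; last by move: kd dMn; clear; lia.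
      by rewrite exprD; congr (_ * _); ring.
    apply: ler_wpM2l; first by rewrite mulr_ge0 // exprn_ge0.
    have M0' : 0 < M%:R :> R by rewrite ltr0n.
    apply: (@le_trans _ _ (expR (- (a ^+ 2 * L ^+ 2 / 32)))).
      rewrite ler_expR lerN2.
      have -> : a ^+ 2 * L ^+ 2 / 32 = w ^+ 2 / (2 * M%:R).
        by rewrite /w M8; field; rewrite gt_eqF.
      apply: ler_wpM2l; first exact: sqr_ge0.
      have Mk0 : 0 < (M - k)%:R :> R by rewrite ltr0n subn_gt0; move: kd dMn; clear; lia.
      rewrite lef_pV2 ?posrE ?mulr_gt0 //; apply: ler_wpM2l => //.
      by rewrite ler_nat leq_subr.
    apply: (@le_trans _ _ (expR (- (2 * L)))).
      rewrite ler_expR lerN2 (_ : a ^+ 2 * L ^+ 2 / 32 = L * (L * a ^+ 2 / 32)); last by field.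
      rewrite mulrC; apply: ler_wpM2l; first exact: ltW.
      by move: L2; clear; lra.
    have c256 : 0 < 256 * M%:R :> R by exact: (mulr_gt0 _ M0').
    rewrite ler_pdivlMr // -lnM.
    have -> : expR (- (2 * L)) * (256 * expR L) = 256 / expR L.
      by rewrite mulrCA -expRD -expRN; congr (256 * expR _); ring.
    rewrite ler_pdivrMr ?expR_gt0 // mulrC.
    have : L <= expR L by apply: le_trans (expR_ge1Dx L); rewrite lerDr.
    move=> LeL; apply: le_trans L3 _; apply: ler_wpM2r => //; exact: ltW.
  have Mp0 : 0 < M%:R :> R by rewrite ltr0n.
  have M1 : 1 <= M%:R :> R by rewrite ler1n.
  have X0 : 0 < X by rewrite exprn_gt0.
  have cardE : #|light M d l|%:R <=
      expR (M%:R * k%:R * (M%:R + 1) + (partial_sum (M - k) (d - k))%:R * (M%:R + 1)) :> R.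
    have := card_low_weight M d k; rewrite -lE -(ler_nat R) => /le_trans; apply.
    rewrite -!expnM -expnD natrX.
    apply: (@le_trans _ _ (expR 1 ^+ (M * (k * M.+1) + partial_sum (M - k) (d - k) * M.+1))).
      by apply: ler_pow => //; apply: two_le_expR1.
    by rewrite -expRM_natl mulr1 ler_expR natrD !natrM -natr1 mulrA.
  rewrite gE -expRM_natl natrX -/X.
  apply: le_trans (ler_wpM2r (expR_ge0 _) cardE) _.
  rewrite -expRD ler_expR.
  have i1 : M%:R * k%:R * (M%:R + 1) <= g / 4 * X.
    apply: (@le_trans _ _ (2 * M%:R ^+ 3)).
      have -> : 2 * M%:R ^+ 3 = M%:R * M%:R * (2 * M%:R) :> R by ring.
      apply: ler_pM; rewrite ?mulr_ge0 ?addr_ge0 //.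
        by apply: ler_wpM2l => //; rewrite ler_nat.
      by rewrite mulr_natl mulr2n lerD2l.
    apply: (@le_trans _ _ (g / 4 * expR (M%:R / 8))); last first.
      by apply: ler_wpM2l => //; apply: divr_ge0 => //; apply: ltW.
    have -> : 2 * M%:R ^+ 3 = g / 4 * (8 / g * M%:R ^+ 3) by field; rewrite gt_eqF.
    by apply: ler_wpM2l => //; apply: divr_ge0 => //; apply: ltW.
  have i2 : (partial_sum (M - k) (d - k))%:R * (M%:R + 1) <= g / 4 * X.
    have p0 : (0 : R) <= (partial_sum (M - k) (d - k))%:R by [].
    apply: (@le_trans _ _ (32 * X * (g / (256 * M%:R)) * (2 * M%:R))).
      by apply: ler_pM => //; rewrite [2 * _]mulr_natl mulr2n lerD2l.
    by rewrite le_eqVlt; apply/orP; left; apply/eqP; field; rewrite gt_eqF.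
  by move: i1 i2; rewrite mulrN (mulrC X); clear; lra.
apply: (@le_trans _ _ (\sum_(l0 <= l < d + 4) expR (- (g / 2 * expR (M%:R / 8))))).
  rewrite big_nat_cond [X in _ <= X]big_nat_cond; apply: ler_sum => l /andP[lb _].
  exact: term.
rewrite big_const_nat iter_addr addr0 -[X in X <= _]mulr_natl.
apply: (@le_trans _ _ (expR L * expR (- (g / 2 * expR (M%:R / 8))))).
  apply: ler_wpM2r; first exact: expR_ge0.
  by rewrite lnM ler_nat; move: dMn; clear; lia.
rewrite -expRD ler_expR.
have uM : v ^+ 4 <= M%:R / 16.
  by move: big4 v40; have : 0 <= (16 * a + 8 * A) * v ^+ 4;
    [rewrite mulr_ge0 ?addr_ge0 ?mulr_ge0 // ltW|clear; lra].
have eu : L <= expR (v ^+ 4).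
  apply: (@le_trans _ _ (v ^+ 4)); last by apply: le_trans (expR_ge1Dx _); rewrite lerDr.
  apply: le_trans Lv _; rewrite exprSr; apply: ler_wpM2r; first exact: ltW.
  apply: (@le_trans _ _ (v ^+ 1)); first by move: v100; clear; rewrite expr1; lra.
  by rewrite ler_weXn2l //; move: v100; clear; lra.
have split8 : expR (M%:R / 8) = expR (M%:R / 16) * expR (M%:R / 16) :> R.
  by rewrite -expRD; congr expR; field.
have e1 : expR (v ^+ 4) <= expR (M%:R / 16) by rewrite ler_expR.
have e2 : 4 / g <= expR (M%:R / 16).
  apply: le_trans (expR_ge1Dx _); rewrite ler_pdivrMr // mulrDl mul1r.
  by move: Mg g0; clear; lra.
have : 2 * expR (v ^+ 4) <= g / 2 * expR (M%:R / 8).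
  rewrite split8 mulrA; apply: ler_pM => //.
  by move: e2; rewrite ler_pdivrMr // mulrC; clear; lra.
by move: eu; clear; lra.
Unshelve. all: by end_near. Qed.

End MLAsymptotics.

Lemma powR2 (R : realType) (x : R) : 2 `^ x = expR (x * ln 2).
Proof. by rewrite /powR pnatr_eq0. Qed.

Lemma powR2_rate (R : realType) (M : nat) (a : R) :
  2 `^ (M%:R - a * Num.sqrt M%:R * log2 M%:R) =
  2 ^+ M * expR (- (a * Num.sqrt M%:R * ln M%:R)).
Proof.
have l2 : 0 < ln (2 : R) by rewrite ln_gt0 // ltr1n.
rewrite powR2 mulrBl expRD expRM_natl lnK ?posrE //; congr (_ * expR (- _)).
by rewrite /log2; field; rewrite gt_eqF.
Qed.

Lemma entropy_ge0 (R : realType) (eps : R) : 0 < eps -> eps < 1 / 2 -> 0 <= H eps.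
Proof.
move=> e0 e1; have l2 : 0 < ln (2 : R) by rewrite ln_gt0 // ltr1n.
have h1 : 0 <= - log2 eps.
  rewrite -mulNr; apply: divr_ge0; last exact: ltW.
  by rewrite oppr_ge0 ln_le0 //; move: e1; clear; lra.
have h2 : 0 <= - log2 (1 - eps).
  rewrite -mulNr; apply: divr_ge0; last exact: ltW.
  by rewrite oppr_ge0 ln_le0 //; move: e0; clear; lra.
have -> : H eps = eps * (- log2 eps) + (1 - eps) * (- log2 (1 - eps)).
  by rewrite /H; ring.
by apply: addr_ge0; apply: mulr_ge0 => //; [exact: ltW|move: e1; clear; lra].
Qed.

(** * Failure rates of the two decoders and choice of the constants *)

Section FailureRates.
Variables (R : realType) (eps : R).
Hypotheses (eps_gt0 : 0 < eps) (eps_lt : eps < 1 / 2).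
Local Notation u M := (Num.sqrt (M%:R : R)).
Local Notation root8 M := (Num.sqrt (Num.sqrt (Num.sqrt (M%:R : R)))).

Lemma rate_le_eta (M d : nat) (delta : R) :
  (partial_sum M d)%:R <= (1 - H eps - delta) * 2 ^+ M ->
  (partial_sum M d)%:R <= (1 - delta) * 2 ^+ M.
Proof.
move=> /le_trans; apply; apply: ler_wpM2r; first exact: exprn_ge0.
by have := entropy_ge0 eps_gt0 eps_lt; move: (H eps) => h; clear -eps_gt0 eps_lt; lra.
Qed.

(** With c' = c1 the list radius is, up to a constant, 2^M times the square root of the bit error,
    so Markov's inequality leaves a multiple of expR (- c1 / 2 * sqrt M * ln M). Its factor ln M
    beats every [B], which is why c' can be chosen before [B]. *)
Lemma RMRec_failure_rate (delta : R) : 0 < delta -> exists2 c' : R, 0 < c' &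
  forall B : R, 0 <= B -> \forall M \near \oo%classic, forall r : nat,
    (partial_sum M r.+1)%:R <= (1 - H eps - 2 * delta) * 2 ^+ M ->
    forall f : word M, f \in code M r.+1 ->
    \sum_g chan eps f g * (1 - RMRec_prob r eps g c' f) <= expR (- (B * u M)).
Proof.
move=> delta0; have [c1 c10 bitE] := bit_error_rate eps_gt0 eps_lt delta0.
exists c1 => // B B0.
have c12 : 0 < c1 / 2 by rewrite divr_gt0.
have eta0 : 0 < 2 * delta by rewrite mulr_gt0.
near=> M => r rate f fC.
have bits0 : forall d : nat, (partial_sum M d)%:R <= (1 - H eps - 2 * delta) * 2 ^+ M ->
    forall (f : word M) (x : pt M), f \in code M d ->
    bit_error eps d f x <= expR (- (c1 * u M * ln M%:R)) by near: M.
have bits := bits0 _ rate.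
have mls0 : forall (d : nat) (W : R), (partial_sum M d)%:R <= (1 - 2 * delta) * 2 ^+ M ->
    W <= 2 ^+ M * expR (- (c1 / 2 * u M * ln M%:R)) ->
    ml_sum eps M d W <= expR (- expR (u M)).
  by near: M; exact: (ml_sum_small eps_gt0 eps_lt c12 eta0).
have mls W := mls0 _ W (rate_le_eta rate).
have L1 : 2 * (B + 2) / c1 <= ln (M%:R : R) by near: M; apply: near_le_ln.
have v1 : 4 * (B + 2) <= root8 M by near: M; apply: near_le_root8.
rewrite ler_pdivrMr // in L1.
have v4 : 4 * (B + 2) <= u M.
  apply: (le_trans v1); rewrite -[X in _ <= X]root8_sqrt -[X in X <= _]expr1 ler_weXn2l //.
  by apply: le_trans v1; move: B0; clear -eps_gt0 eps_lt; lra.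
have u1 : 8 <= u M by apply: le_trans v4; move: B0; clear -eps_gt0 eps_lt; lra.
set T : R := 2 `^ (M%:R - c1 * u M * log2 M%:R / 2) / 2.
have TE : T = 2 ^+ M * expR (- (c1 / 2 * u M * ln M%:R)) / 2.
  by rewrite /T -powR2_rate; congr (2 `^ (_ - _) / 2); field.
have p2 : 0 < 2 ^+ M :> R by rewrite exprn_gt0.
apply: le_trans (RMRec_fail eps_gt0 eps_lt c1 (fun x => bits f x fC) fC) _.
rewrite -/T.
have h1 : 2 ^+ M * expR (- (c1 * u M * ln M%:R)) / T <= expR (- (B * u M + 1)).
  have -> : 2 ^+ M * expR (- (c1 * u M * ln M%:R)) / T = 2 * expR (- (c1 / 2 * u M * ln M%:R)).
    have -> : - (c1 * u M * ln M%:R) = - (c1 / 2 * u M * ln M%:R) + - (c1 / 2 * u M * ln M%:R).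
      by field.
    rewrite TE expRD; set y := expR _; have y0 : 0 < y by exact: expR_gt0.
    by field; rewrite !gt_eqF.
  apply: le_trans (ler_wpM2r (expR_ge0 _) (two_le_expR1 R)) _.
  rewrite -expRD ler_expR.
  have : 2 * (B + 2) * u M <= ln M%:R * c1 * u M.
    by apply: ler_wpM2r => //; apply: sqrtr_ge0.
  have -> : c1 / 2 * u M * ln M%:R = ln M%:R * c1 * u M / 2 by field.
  by move: u1; clear -eps_gt0 eps_lt; lra.
have h2 : ml_sum eps M r.+1 (2 * T) <= expR (- (B * u M + 1)).
  apply: le_trans (mls _ _) _; first by rewrite TE mulrC divfK.
  rewrite ler_expR lerN2.
  have e2 : expR (u M) = expR (u M / 2) * expR (u M / 2).
    by rewrite -expRD; congr expR; field.
  have e3 : u M / 2 <= expR (u M / 2) by apply: le_trans (expR_ge1Dx _); rewrite lerDr.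
  have u20 : 0 <= u M / 2 by rewrite divr_ge0 ?sqrtr_ge0.
  rewrite e2; apply: le_trans (ler_pM u20 u20 e3 e3).
  have : 4 * (B + 2) * u M <= u M * u M by apply: ler_wpM2r => //; apply: sqrtr_ge0.
  by move: u1; clear -eps_gt0 eps_lt; lra.
apply: le_trans (lerD h1 h2) _.
have -> : - (B * u M) = 1 + - (B * u M + 1) by ring.
rewrite expRD -mulr2n -[X in X <= _]mulr_natl; apply: ler_wpM2r; first exact: expR_ge0.
exact: two_le_expR1.
Unshelve. all: by end_near. Qed.

Lemma mprime_bounds (m : nat) (c : R) : 0 < c ->
  u m / c <= (mprime m c)%:R < u m / c + 1.
Proof.
move=> c0; have x0 : 0 <= u m / c by rewrite divr_ge0 ?sqrtr_ge0 // ltW.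
rewrite /mprime natr_absz ger0_norm; last by rewrite ceil_ge0; apply: lt_le_trans x0; rewrite ltrN10.
rewrite ceil_ge /=; have := ceilB1_lt (u m / c).
by rewrite intrB ltrBlDr.
Qed.

Lemma card_Spart (m mp : nat) (j : 'I_mp) :
  (m %/ mp <= #|Spart m j| <= (m %/ mp).+1)%N.
Proof.
have mp0 : (0 < mp)%N by apply: leq_ltn_trans (ltn_ord j).
apply/andP; split.
  have lt (q : 'I_(m %/ mp)) : (q * mp + j < m)%N.
    apply: (@leq_trans (q.+1 * mp)); first by rewrite mulSn addnC ltn_add2r.
    by apply: leq_trans (leq_divM m mp); rewrite leq_mul2r ltn_ord orbT.
  have inj : injective (fun q => Ordinal (lt q)).
    move=> q q' /(congr1 val) /= /eqP; rewrite eqn_add2r eqn_pmul2r // => /eqP.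
    exact: val_inj.
  rewrite -[X in (X <= _)%N]card_ord -(card_imset predT inj).
  apply/subset_leq_card/fintype.subsetP => i /imsetP[q _ ->].
  by rewrite inE /= modnMDl modn_small.
have lt (i : 'I_m) : (i %/ mp < (m %/ mp).+1)%N.
  by rewrite ltnS leq_div2r // ltnW.
rewrite -[X in (_ <= X)%N]card_ord -(@card_in_imset _ _ (fun i : 'I_m => Ordinal (lt i))).
  exact: max_card.
move=> i i'; rewrite !inE => /eqP ij /eqP i'j /(congr1 val) /= e.
by apply: val_inj; rewrite /= (divn_eq i mp) (divn_eq i' mp) e ij i'j.
Qed.

Lemma RM2_failure_rate (delta : R) : 0 < delta -> exists c c' c'' : R,
  [/\ 0 < c, 0 < c' & 0 < c''] /\
  \forall m \near \oo%classic, forall r : nat,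
    (partial_sum m r.+1)%:R <= (1 - H eps - 3 * delta) * 2 ^+ m ->
    forall f : word m, f \in code m r.+1 ->
    \sum_ft chan eps f ft * (1 - RMRec2_prob r eps ft c c' f) <=
    2 * 2 `^ (- 2 `^ (c'' * u m)).
Proof.
move=> delta0; have [c' c'0 recE] := RMRec_failure_rate delta0.
(* The bound delta / 4 limits to delta the rate lost by fixing the |S j| ~ c sqrt m coordinates of a
   block; 1 / 2 keeps the dimension of the subcubes above m / 4. *)
pose c : R := Num.min (delta / 4) (1 / 2).
have c0 : 0 < c by rewrite lt_min divr_gt0 // divr_gt0.
have cd : c <= delta / 4 by rewrite ge_min lexx.
have c2 : c <= 1 / 2 by rewrite ge_min lexx orbT.
exists c, c', (c / 8); split; first by split=> //; rewrite divr_gt0.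
(* Here c + 4 is the [B] of [RMRec_failure_rate]: the square root of the subcube dimension is at
   least U / 2, and expR (- (c + 4) / 2 * U) is small enough against e^2 * 4^tau. *)
have B0 : 0 <= c + 4 by rewrite addr_ge0 // ltW.
have [N _ recN] := recE _ B0.
have d3 : 0 < 3 * delta by rewrite mulr_gt0.
near=> m => r rate f fC.
have m0 : (0 < m)%N by near: m; exists 1%N.
have v1 : 4 / delta + 64 / c + 16 * (16 * (1 / c + 1)) / c ^+ 2 + 64 * 9 <= root8 m.
  by near: m; apply: near_le_root8.
have mN : 4 * N%:R <= m%:R :> R by near: m; apply: near_ge_nat.
have mls0 : forall (d : nat) (W : R), (partial_sum m d)%:R <= (1 - 3 * delta) * 2 ^+ m ->
    W <= 2 ^+ m * expR (- (1 * u m * ln m%:R)) ->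
    ml_sum eps m d W <= expR (- expR (u m)).
  by near: m; exact: (ml_sum_small eps_gt0 eps_lt ltr01 d3).
have mls W := mls0 _ W (rate_le_eta rate).
have Lv := ln_le_root8 R m0; have uE := root8_sqrt R m.
set v := root8 m in v1 Lv uE.
set U := u m in uE mls *.
have d40 : 0 < 4 / delta by rewrite divr_gt0.
have c10 : 0 < 64 / c by rewrite divr_gt0.
have c20 : 0 < 16 * (16 * (1 / c + 1)) / c ^+ 2.
  by rewrite divr_gt0 ?exprn_gt0 // !mulr_gt0 // addr_gt0 // divr_gt0.
have v64 : 64 * 9 <= v by move: v1 d40 c10 c20; clear -eps_gt0 eps_lt; lra.
have v0 : 0 < v by move: v64; clear -eps_gt0 eps_lt; lra.
have vU : v <= U by rewrite -uE -[X in X <= _]expr1 ler_weXn2l //; move: v64; clear -eps_gt0 eps_lt; lra.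
have U1 : 64 * 9 <= U by apply: le_trans vU.
have U0 : 0 < U by move: U1; clear -eps_gt0 eps_lt; lra.
have Ud : 4 <= U * delta by rewrite -ler_pdivrMr //; move: v1 vU c10 c20; clear -eps_gt0 eps_lt; lra.
have Uc : 64 <= c * U.
  by rewrite mulrC -ler_pdivrMr //; move: v1 vU d40 c20; clear -eps_gt0 eps_lt; lra.
have Uc2 : 16 * (16 * (1 / c + 1)) <= U * c ^+ 2.
  by rewrite -ler_pdivrMr ?exprn_gt0 //; move: v1 vU d40 c10; clear -eps_gt0 eps_lt; lra.
have UU : U * U = m%:R by rewrite -expr2 sqr_sqrtr.
have UL : 64 * ln m%:R + 64 <= U.
  have vv : v ^+ 2 <= v ^+ 4 by rewrite ler_weXn2l //; move: v64; clear -eps_gt0 eps_lt; lra.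
  have v2 : 64 * 9 * v <= v ^+ 2 by rewrite expr2; apply: ler_wpM2r => //; apply: ltW.
  by rewrite -uE; move: vv v2 Lv v64; clear -eps_gt0 eps_lt; lra.
pose mp := mprime m c.
have /andP[mp1 mp2] := mprime_bounds m c0; rewrite -/mp -/U in mp1 mp2.
have mpR0 : 0 < mp%:R :> R by apply: lt_le_trans mp1; rewrite divr_gt0.
have mp0 : (0 < mp)%N by rewrite -(ltr_nat R).
have cU : U <= mp%:R * c by rewrite -ler_pdivrMr.
have quot_lo : c * U - 2 <= (m %/ mp)%:R.
  have mdiv : m%:R <= ((m %/ mp)%:R + 1) * mp%:R :> R.
    by rewrite natr1 -natrM ler_nat ltnW // ltn_ceil.
  have : U * U <= ((m %/ mp)%:R + 1) * (U / c + 1).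
    by rewrite UU; apply: le_trans mdiv _; apply: ler_wpM2l; [rewrite addr_ge0|exact: ltW].
  move=> H1; rewrite -subr_ge0.
  have Uc0 : 0 < U / c + 1 by rewrite addr_gt0 // divr_gt0.
  rewrite -(pmulr_lge0 _ Uc0).
  have -> : ((m %/ mp)%:R - (c * U - 2)) * (U / c + 1) =
     ((m %/ mp)%:R + 1) * (U / c + 1) - U * U + (U / c + 1 - c * U).
    by field; rewrite gt_eqF.
  have : c * U <= 1 / 2 * U by apply: ler_wpM2r => //; apply: ltW.
  have : U <= U / c.
    by rewrite ler_pdivlMr // -[X in _ <= X]mulr1; apply: ler_wpM2l; [exact: ltW|move: c2; clear -eps_gt0 eps_lt; lra].
  by move: H1 U0; clear -eps_gt0 eps_lt; lra.
have quot_hi : (m %/ mp)%:R <= c * U.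
  have : (m %/ mp)%:R * mp%:R <= m%:R :> R by rewrite -natrM ler_nat leq_divM.
  rewrite -UU => H1; rewrite -(ler_pM2r mpR0); apply: le_trans H1 _.
  rewrite (_ : c * U * mp%:R = U * (mp%:R * c)); last by ring.
  by apply: ler_wpM2l => //; apply: ltW.
pose S (j : 'I_mp) := Spart m j.
have S_lo j : c * U / 2 <= #|S j|%:R.
  have /andP[H1 _] := card_Spart m j; rewrite -(ler_nat R) in H1.
  by apply: le_trans H1; move: quot_lo Uc; clear -eps_gt0 eps_lt; lra.
have S_hi j : #|S j|%:R <= c * U + 1.
  have /andP[_ H1] := card_Spart m j; rewrite -(ler_nat R) -natr1 in H1.
  by apply: le_trans H1 _; move: quot_hi; clear -eps_gt0 eps_lt; lra.
have Um : 64 * 9 * U <= m%:R by rewrite -UU; apply: ler_wpM2r => //; apply: ltW.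
have nE (j : 'I_mp) : #|~: S j|%:R = m%:R - #|S j|%:R :> R.
  by apply/eqP; rewrite eq_sym subr_eq addrC -natrD card_sets_of_ord.
have nbound (j : 'I_mp) : m%:R / 4 <= #|~: S j|%:R :> R.
  rewrite nE; have := S_hi j; have : c * U <= 1 / 2 * U by apply: ler_wpM2r => //; apply: ltW.
  by move: Um U1; clear -eps_gt0 eps_lt; lra.
have un (j : 'I_mp) : U / 2 <= u #|~: S j|.
  have -> : U / 2 = Num.sqrt (m%:R / 4).
    rewrite -UU (_ : _ / 4 = (U / 2) ^+ 2); last by field.
    by rewrite sqrtr_sqr ger0_norm // divr_ge0 // ltW.
  exact: ler_wsqrtr.
have q_fail (j : 'I_mp) (h : word #|~: S j|) : h \in code #|~: S j| r.+1 ->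
    \sum_g chan eps h g * (1 - RMRec_prob r eps g c' h) <= expR (- ((c + 4) / 2 * U)).
  move=> hC; apply: (@le_trans _ _ (expR (- ((c + 4) * u #|~: S j|)))); last first.
    rewrite ler_expR lerN2 -mulrA; apply: ler_wpM2l => //.
    by rewrite mulrC; apply: un.
  apply: recN => //.
    by rewrite /= -(ler_nat R); move: (nbound j) mN; clear -eps_gt0 eps_lt; lra.
  have n0 : (0 < #|~: S j|)%N.
    by rewrite -(ltr_nat R); apply: lt_le_trans (nbound j); rewrite divr_gt0 // ltr0n.
  have := rate_shift R #|S j| r.+1 n0; rewrite [(_ + #|S j|)%N]addnC card_sets_of_ord.
  rewrite -ler_pdivrMr ?exprn_gt0 // => /le_trans; apply.
  apply: (@le_trans _ _ ((1 - H eps - 3 * delta) + delta)); last first.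
    by move: (H eps) => h0; clear -eps_gt0 eps_lt; lra.
  apply: lerD; first by rewrite ler_pdivrMr ?exprn_gt0.
  rewrite ler_pdivrMr ?sqrtr_gt0 ?ltr0n //; apply: le_trans (S_hi j) _.
  apply: (@le_trans _ _ (delta * (U / 2))); last by apply: ler_wpM2l => //; apply: ltW.
  have : c * U <= delta / 4 * U by apply: ler_wpM2r => //; apply: ltW.
  by move: Ud; clear -eps_gt0 eps_lt; lra.
(* Then tau * mp is about m / 8, so the majority errs on a fraction 2^(- Omega(m)) of the points,
   far below 2^(- sqrt m * log2 m), while 4^tau ~ 2^(c U / 4) remains small against 2^|S j| ~ 2^(c
   U). *)
pose tau := Num.truncn (c * U / 8).
have cU0 : 0 <= c * U / 8 by rewrite divr_ge0 // mulr_ge0 // ltW.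
have /andP[t1 t2] := truncn_itv cU0; rewrite -/tau -[tau.+1%:R]natr1 in t1 t2.
have two_exp (n : nat) : 2 ^+ n <= expR (n%:R : R).
  rewrite -[X in expR X]mulr1 expRM_natl; apply: ler_pow => //; exact: two_le_expR1.
have two_half (n : nat) : expR (n%:R / 2) <= 2 ^+ n :> R.
  rewrite (_ : n%:R / 2 = n%:R * (1 / 2)); last by ring.
  by rewrite expRM_natl; apply: ler_pow; [exact: expR_ge0|exact: expR_half_le2].
have four_two (n : nat) : 4 ^+ n = 2 ^+ (2 * n) :> R.
  by rewrite exprM; congr (_ ^+ _); ring.
have q_small : expR (- ((c + 4) / 2 * U)) * expR 2 * 4 ^+ tau <= 1.
  rewrite four_two; apply: le_trans (ler_wpM2l _ (two_exp _)) _.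
    by rewrite mulr_ge0 ?expR_ge0.
  rewrite -!expRD -[X in _ <= X]expR0 ler_expR natrM.
  have : 0 <= c * U by move: Uc; clear -eps_gt0 eps_lt; lra.
  by move: t1 U1; clear -eps_gt0 eps_lt; lra.
have TE : 2 `^ (m%:R - Num.sqrt m%:R * log2 m%:R) = 2 ^+ m * expR (- (1 * U * ln m%:R)) :> R.
  by rewrite -powR2_rate mul1r.
have T_large : 2 ^+ m * (2 / 2 ^+ tau) ^+ mp <= 2 `^ (m%:R - Num.sqrt m%:R * log2 m%:R) / 2 :> R.
  rewrite TE -mulrA; apply: ler_wpM2l; first exact: exprn_ge0.
  apply: (@le_trans _ _ (expR (mp%:R * (1 - tau%:R / 2)))).
    rewrite expRM_natl; apply: ler_pow; first by rewrite divr_ge0 // exprn_ge0.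
    rewrite expRD expRN; apply: ler_pM; rewrite ?invr_ge0 ?exprn_ge0 //.
      exact: two_le_expR1.
    by rewrite lef_pV2 ?posrE ?expR_gt0 ?exprn_gt0.
  apply: (@le_trans _ _ (expR (- (1 * U * ln m%:R) + -1))).
    rewrite ler_expR.
    have : 1 - tau%:R / 2 <= - (c * U / 32) by move: t2 Uc; clear -eps_gt0 eps_lt; lra.
    move=> /(ler_wpM2l (ltW mpR0)) /le_trans; apply.
    have : U * U <= mp%:R * c * U by apply: ler_wpM2r => //; apply: ltW.
    have : (64 * ln m%:R + 64) * U <= U * U by apply: ler_wpM2r => //; apply: ltW.
    have : 0 <= ln m%:R * U by rewrite mulr_ge0 ?ln_ge0 ?ler1n // ltW.
    by move: U1; clear -eps_gt0 eps_lt; lra.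
  rewrite expRD; apply: ler_wpM2l; first exact: expR_ge0.
  by rewrite expRN lef_pV2 ?posrE ?expR_gt0 //; apply: two_le_expR1.
have f_code : f \in code m r.+1 by [].
apply: le_trans (RMRec2_fail eps_gt0 eps_lt f_code q_fail q_small T_large) _.
pose X : R := expR (c / 8 * U).
have X2 : 2 <= X.
  by apply: le_trans (expR_ge1Dx _); move: Uc; clear -eps_gt0 eps_lt; lra.
have mpX : mp%:R <= X.
  have e1 : X = expR (c * U / 16) * expR (c * U / 16).
    by rewrite -expRD; congr expR; field.
  have e2 : c * U / 16 <= expR (c * U / 16) by apply: le_trans (expR_ge1Dx _); rewrite lerDr.
  have e0 : 0 <= c * U / 16 by move: cU0; clear -eps_gt0 eps_lt; lra.
  rewrite e1; apply: le_trans (ltW mp2) _; apply: le_trans (ler_pM e0 e0 e2 e2).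
  have : 16 * (16 * (1 / c + 1)) * U <= U * c ^+ 2 * U by apply: ler_wpM2r => //; apply: ltW.
  have -> : U / c = 1 / c * U by rewrite mul1r mulrC.
  by move: U1; move: (1 / c) => ic; clear -eps_gt0 eps_lt; lra.
(* The exponent 2^|S j| / 4^tau is at least X^2, which pays for the union over the mp <= X
   directions. *)
have blocks : \sum_(j < mp) expR (- (2 ^+ #|S j| / 4 ^+ tau)) <= expR (- X).
  apply: (@le_trans _ _ (\sum_(j < mp) expR (- (X * X)))).
    apply: ler_sum => j _; rewrite ler_expR lerN2.
    have Sj : c * U - 2 <= #|S j|%:R.
      have /andP[H1 _] := card_Spart m j; rewrite -(ler_nat R) in H1.
      exact: le_trans quot_lo H1.
    have tS : (2 * tau <= #|S j|)%N.
      by rewrite -(ler_nat R) natrM; move: t1 Sj Uc; clear -eps_gt0 eps_lt; lra.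
    have -> : 2 ^+ #|S j| / 4 ^+ tau = 2 ^+ (#|S j| - 2 * tau) :> R.
      by rewrite four_two -{1}(subnK tS) exprD mulfK // gt_eqF // exprn_gt0.
    apply: le_trans (two_half _); rewrite -expRD ler_expR natrB // natrM.
    by move: t1 Sj Uc; clear -eps_gt0 eps_lt; lra.
  rewrite sumr_const card_ord -[X in X <= _]mulr_natl.
  apply: (@le_trans _ _ (expR X * expR (- (X * X)))).
    apply: ler_wpM2r; first exact: expR_ge0.
    by apply: le_trans mpX _; apply: le_trans (expR_ge1Dx _); rewrite lerDr.
  rewrite -expRD ler_expR.
  have : 2 * X <= X * X by apply: ler_wpM2r => //; move: X2; clear -eps_gt0 eps_lt; lra.
  by clear -eps_gt0 eps_lt; lra.
have ml : ml_sum eps m r.+1 (2 * (2 `^ (m%:R - Num.sqrt m%:R * log2 m%:R) / 2)) <= expR (- X).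
  apply: le_trans (mls _ _) _; first by rewrite TE mulrC divfK.
  rewrite ler_expR lerN2 ler_expR -[X in _ <= X]mul1r; apply: ler_wpM2r; first exact: ltW.
  by move: c2 c0; clear -eps_gt0 eps_lt; lra.
apply: le_trans (lerD blocks ml) _.
rewrite -mulr2n -[X in X <= _]mulr_natl; apply: ler_wpM2l => //.
(* Base e is traded for base 2 twice; since ln 2 <= 1, both exchanges go in the right direction and
   c'' = c / 8 is kept. *)
have l2 : 0 < ln (2 : R) by rewrite ln_gt0 // ltr1n.
have l21 : ln (2 : R) <= 1.
  by rewrite -[X in _ <= X](expRK (1 : R)) ler_ln ?posrE ?expR_gt0 //; apply: two_le_expR1.
rewrite powR2 ler_expR mulNr lerN2 powR2.
apply: (@le_trans _ _ (expR (c / 8 * U * ln 2) * 1)).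
  by apply: ler_wpM2l => //; apply: expR_ge0.
rewrite mulr1 ler_expR -[X in _ <= X]mulr1; apply: ler_wpM2l => //.
by rewrite mulr_ge0 // ?divr_ge0 // ltW.
Unshelve. all: by end_near. Qed.

End FailureRates.

(** * The limit superior and the average over codewords *)

Lemma partial_sum_le (n d : nat) : (partial_sum n d <= 2 ^ n)%N.
Proof.
elim: d => [|d IH]; first by rewrite partial_sum0.
have [dn|nd] := leqP d.+1 n.+1; last by rewrite partial_sumS bin_small // addn0.
rewrite -partial_sum_full /partial_sum -!(big_mkord xpredT (fun j => 'C(n, j))).
by rewrite [X in (_ <= X)%N](big_cat_nat (n := d.+1)) //= leq_addr.
Qed.

(** For a bounded sequence the limit superior is the infimum of the tail suprema, so some tail
    supremum is already below [b]. *)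
Lemma limn_sup_lt (R : realType) (a : nat -> R) (b : R) :
  (forall n, 0 <= a n <= 1) -> limn_sup a < b -> exists N, forall n, (N <= n)%N -> a n <= b.
Proof.
move=> a01; have bnd : bounded_fun (a : nat -> R^o).
  exists 1; split; first exact: num_real.
  move=> y y1 n _; have /andP[a0 a1] := a01 n; rewrite /= ger0_norm //.
  exact: le_trans a1 (ltW y1).
rewrite limn_supE // => /inf_lt[|_ [N _ <-] supb]; first by exists (sups a 0%N); exists 0%N.
exists N => n Nn; apply: le_trans (ltW supb); apply: ub_le_sup; last by exists n.
exact/has_ubound_sdrop/bounded_fun_has_ubound.
Qed.

Lemma failure_prob_le (R : realType) (m r : nat) (eps c c' b : R) :
  (forall f : word m, f \in code m r.+1 ->
     \sum_ft chan eps f ft * (1 - RMRec2_prob r eps ft c c' f) <= b) ->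
  1 - success_prob m r eps c c' <= b.
Proof.
move=> fail; have RM0 : (0 < #|RM m r|)%N.
  by apply/card_gt0P; exists (zero_word m); rewrite RM_code code0.
have RMR : 0 < #|RM m r|%:R :> R by rewrite ltr0n.
have mean (x : R) : \sum_(f in RM m r) 1 / #|RM m r|%:R * x = x.
  by rewrite sumr_const -[LHS]mulr_natl mulrA div1r mulfV ?mul1r // gt_eqF.
rewrite -{1}(mean 1) -[b]mean /success_prob -sumrB; apply: ler_sum => f fC.
rewrite -mulrBr; apply: ler_wpM2l; first by rewrite divr_ge0.
rewrite -(sum_chan1 eps f) -sumrB.
under eq_bigr => ft _ do rewrite -[X in X - _]mulr1 -mulrBr.
by apply: fail; rewrite -RM_code.
Qed.

Theorem theorem3 (R : realType) (eps : R) (m r : nat -> nat) :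
  0 < eps < 1 / 2 ->
  (forall i, (0 < m i)%N) -> (forall i, (0 < r i)%N) ->
  (forall B : nat, exists N : nat, forall i, (N <= i)%N -> (B <= m i)%N) ->
  limn_sup (fun i => (binom_le (m i) (r i))%:R / 2 ^+ (m i) : R) < 1 - H eps ->
  exists c c' c'' : R, [/\ 0 < c, 0 < c' & 0 < c''] /\
    exists (C : R) (N : nat), forall i, (N <= i)%N ->
      1 - success_prob (m i) (r i) eps c c' <= C * 2 `^ (- 2 `^ (c'' * Num.sqrt ((m i)%:R))).
Proof.
move=> /andP[eps0 eps1] _ _ m_oo; set a := fun i => _.
move: (erefl (limn_sup a)); move: {2 3}(limn_sup a) => s aE sH.
(* The limit superior is 1 - H eps - 4 delta. One delta makes the bound hold from some index on, one
   is lost on the subcubes, one on the graphs in [bit_error_rate], and the last is the deficit that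
   feeds [weak_predictor]. *)
pose delta := (1 - H eps - s) / 4.
have delta0 : 0 < delta by rewrite divr_gt0 // subr_gt0.
have sd : limn_sup a < 1 - H eps - 3 * delta.
  by rewrite aE /delta; move: sH; clear; move: (H eps) => h; lra.
have a01 i : 0 <= a i <= 1.
  apply/andP; split; first by rewrite divr_ge0 // exprn_ge0.
  by rewrite ler_pdivrMr ?exprn_gt0 // mul1r -natrX ler_nat; apply: partial_sum_le.
have [N1 aN1] := limn_sup_lt a01 sd.
have [c [c' [c'' [c0 [N2 _ fail]]]]] := RM2_failure_rate eps0 eps1 delta0.
have [N3 mN3] := m_oo N2.
exists c, c', c''; split => //; exists 2, (maxn N1 N3) => i; rewrite geq_max => /andP[iN1 iN3].
apply: failure_prob_le => f fC; apply: fail => //; first exact: mN3.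
by have := aN1 i iN1; rewrite ler_pdivrMr ?exprn_gt0.
Qed.
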